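(* Let $p\in(1,\infty)$. Let $(E,|\cdot|_E,\leq)$ be a Banach lattice. Let $\mu$ be a locally finite Borel measure on $\mathbb{R}^d$, and let $\lambda_Q:E\to E$ be positive operators indexed by the dyadic cubes $Q$ of $\mathbb{R}^d$. For a finite collection $\mathcal{D}$ of dyadic cubes and $R\in\mathcal{D}$, put $$T_{\mathcal{D}}(f\mu):=\sum_{Q\in\mathcal{D}}\lambda_Q\Big(\int_Qf\,\mathrm{d}\mu\Big)1_Q,\qquad T_{\mathcal{D},R}(f\mu):=\sum_{Q\in\mathcal{D}:\,Q\subseteq R}\lambda_Q\Big(\int_Qf\,\mathrm{d}\mu\Big)1_Q .$$ Then the operator $T_\lambda(\,\cdot\,\mu):L^p_E(\mu)\to L^p_E(\mu)$ is bounded, in the sense that $$\sup_{\mathcal{D}}\|T_{\mathcal{D}}(\,\cdot\,\mu)\|_{L^p_E(\mu)\to L^p_E(\mu)}<\infty$$ with the supremum over all finite collections $\mathcal{D}$ of dyadic cubes, if any of the following conditions is satisfied: (i) The endpoint direct $L^\infty$ testing condition holds: there is a constant $\mathfrak{B}<\infty$ such that $$\|T_{\mathcal{D},R}(f\mu)\|_{L^1_E(\mu)}\leq\mathfrak{B}\,\|f\|_{L^\infty_E(R,\mu)}\,\mu(R)$$ for every finite collection $\mathcal{D}$ of dyadic cubes, every $R\in\mathcal{D}$, and every $f\in L^\infty_E(R,\mu)$; and, additionally, $E$ has the dyadic Hardy--Littlewood property. (ii) The endpoint direct $L^\infty$ testing condition of (i) holds, and, additionally, the measure $\mu$ is doubling.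 (iii) For some $t\in(p,\infty)$, the endpoint direct $L^t$ testing condition holds: there is a constant $\mathfrak{B}_t<\infty$ such that $$\|T_{\mathcal{D},R}(f\mu)\|_{L^1_E(\mu)}\leq\mathfrak{B}_t\,\|f\|_{L^t_E(R,\mu)}\,\mu(R)^{1-1/t}$$ for every finite collection $\mathcal{D}$ of dyadic cubes, every $R\in\mathcal{D}$, and every $f\in L^t_E(R,\mu)$.
   Context: A Banach lattice $(E,|\cdot|_E,\leq)$ is a real Banach space with a compatible lattice order. A linear operator $\lambda:E\to E$ is positive if $e\ge 0$ implies $\lambda e\ge 0$. $L^p_E(\mu)$ is the Lebesgue--Bochner space with norm $(\int |f|_E^p\,\mathrm{d}\mu)^{1/p}$; $L^p_E$ is the case of Lebesgue measure on $\mathbb{R}^d$; $L^t_E(R,\mu)$ is the corresponding space of functions on $R$. For a finite collection $\mathcal{D}$ of dyadic cubes, $\bar M_{\mathcal{D}}f:=\sup_{Q\in\mathcal{D}}\langle f\rangle_Q1_Q$, where $\langle f\rangle_Q=\frac1{|Q|}\int_Q f\,\mathrm{d}x$ and the supremum is taken in the lattice order of $E$. $E$ has the dyadic Hardy--Littlewood property if for some $p\in(1,\infty)$ one has $\sup_{\mathcal{D}}\|\bar M_{\mathcal{D}}\|_{L^p_E\to L^p_E}<\infty$, the supremum being over all finite collections of dyadic cubes (it is a known fact that then this holds for every $p\in(1,\infty)$). The measure $\mu$ is doubling if there is a constant $K$ with $0<\mu(B(x,2r))\leq K\mu(B(x,r))<\infty$ for all $x\in\mathbb{R}^d$ and $r>0$.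 *)

(* Defs.v *)
From HB Require Import structures.
From mathcomp Require Import all_boot all_order all_algebra finmap.
From mathcomp Require Import all_classical all_reals all_analysis.
From mathcomp Require Import measurable_realfun.

Set Implicit Arguments.
Unset Strict Implicit.
Unset Printing Implicit Defensive.

Import Order.TTheory GRing.Theory Num.Theory.
Import numFieldNormedType.Exports.

Local Open Scope classical_set_scope.
Local Open Scope ring_scope.

(* HB does not allow a structure that joins CompleteNormedModule and
   Order.Lattice, so the order is given by fields here and turned into a
   ring_display lattice (notations <=, Order.join, Order.meet) just below. *)
HB.mixin Record isBanachLattice (R : realType) E of CompleteNormedModule R E := {
  ble : rel E;
  bmeet : E -> E -> E;
  bjoin : E -> E -> E;
  ble_refl : reflexive ble;
  ble_anti : antisymmetric ble;
  ble_trans : transitive ble;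
  bmeetP : forall x y z, ble x (bmeet y z) = ble x y && ble x z;
  bjoinP : forall x y z, ble (bjoin x y) z = ble x z && ble y z;
  ble_leD2r : forall x y z, ble x y -> ble (x + z) (y + z);
  ble_leZ2l : forall (a : R) x y, 0 <= a -> ble x y -> ble (a *: x) (a *: y);
  (* the modulus of x is the join of x and - x *)
  ble_norm : forall x y,
    ble (bjoin x (- x)) (bjoin y (- y)) -> `|x| <= `|y|
}.

#[short(type="banachLatticeType")]
HB.structure Definition BanachLattice (R : realType) :=
  {E of CompleteNormedModule R E & isBanachLattice R E}.

HB.instance Definition _ (R : realType) (E : banachLatticeType R) :=
  Order.Le_isPOrder.Build ring_display (BanachLattice.sort E)
    ble_refl ble_anti ble_trans.
HB.instance Definition _ (R : realType) (E : banachLatticeType R) :=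
  Order.POrder_MeetJoin_isLattice.Build ring_display (BanachLattice.sort E)
    bmeetP bjoinP.

(* 0 on the empty sequence, where E has no supremum in general *)
Definition lattice_sup (R : realType) (E : banachLatticeType R) (s : seq E) : E :=
  if s is x :: s' then \big[Order.join/x]_(y <- s') y else 0.

Definition positive_operator (R : realType) (E : banachLatticeType R)
  (u : E -> E) := forall e : E, 0 <= e -> 0 <= u e.

(* the Borel sigma-algebra of R^d *)
HB.instance Definition _ (R : realType) (d : nat) :=
  Measurable.copy 'rV[R]_d (g_sigma_algebraType (@open 'rV[R]_d)).

Section lebesgue_rV.
Variable R : realType.

Let ratbox n (q : {ffun 'I_n -> rat * rat}) : set 'rV[R]_n :=
  [set v | forall i, ratr (q i).1 < v ord0 i < ratr (q i).2].

Let ratbox_cover n (U : set 'rV[R]_n) : open U ->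
  U = \bigcup_(q in [set q | ratbox q `<=` U]) ratbox q.
Proof.
move=> oU; apply/seteqP; split; last by move=> v [q /= qU]; exact: qU.
move=> v Uv; have /nbhs_ballP[e /= e0 veU] : nbhs v U by exact: open_nbhs_nbhs.
have /fin_all_exists[q qP] : forall i, exists q : rat * rat,
    [/\ v ord0 i - e < ratr q.1, ratr q.1 < v ord0 i,
        v ord0 i < ratr q.2 & ratr q.2 < v ord0 i + e].
  move=> i.
  have [a /andP[]] : exists q : rat, v ord0 i - e < ratr q < v ord0 i.
    have [|q] := @rat_in_itvoo R (v ord0 i - e) (v ord0 i).
      by rewrite ltrBlDr ltrDl.
    by rewrite in_itv => ?; exists q.
  have [b /andP[]] : exists q : rat, v ord0 i < ratr q < v ord0 i + e.
    have [|q] := @rat_in_itvoo R (v ord0 i) (v ord0 i + e).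
      by rewrite ltrDl.
    by rewrite in_itv => ?; exists q.
  by exists (a, b).
exists [ffun i => q i]; last first.
  by move=> i; rewrite ffunE; have [_ -> ->] := qP i.
move=> w /= wq; apply: veU; split=> // a i; rewrite (ord1 a).
have [q1 q2 q3 q4] := qP i; have := wq i; rewrite ffunE => /andP[w1 w2].
rewrite /ball /= ltr_distlC.
by rewrite (lt_trans q1 w1) (lt_trans w2 q4).
Qed.

Lemma rV_open_measurable n (U : set 'rV[R]_n) : open U -> measurable U.
Proof. by move=> oU; exact: sub_sigma_algebra. Qed.


Lemma measurable_rV_coord n (i : 'I_n) :
  measurable_fun [set: 'rV[R]_n] (fun v => v ord0 i).
Proof.
apply: (measurability _ (RGenOpens.measurableE R)) => //.
move=> _ [_ [x [y ->]] <-]; rewrite setTI.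
apply: rV_open_measurable; apply: open_comp; last exact: interval_open.
by move=> v _; exact: coord_continuous.
Qed.

Lemma measurable_rVP d (T : measurableType d) n (f : T -> 'rV[R]_n) :
  (forall i, measurable_fun [set: T] (fun t => f t ord0 i)) ->
  measurable_fun [set: T] f.
Proof.
move=> mf; have mO : @measurable _ 'rV[R]_n = <<s @open 'rV[R]_n >> by [].
apply: (measurability _ mO) => _ [U oU <-].
rewrite setTI (ratbox_cover oU) preimage_bigcup.
rewrite bigcup_mkcond; apply: countable_bigcupT_measurable => [|q].
  exact: countableP.
case: ifP => // _.
have -> : f @^-1` ratbox q =
    \bigcap_i (fun t => f t ord0 i) @^-1` `]ratr (q i).1, ratr (q i).2[%classic.
  apply/seteqP; split=> t /= H i; first by move=> _ /=; rewrite in_itv; exact: H.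
  by have := H i I; rewrite /= in_itv.
apply: fin_bigcap_measurable => // i _.
by rewrite -[X in measurable X]setTI; exact: mf.
Qed.

Definition rV_cons n (z : R * 'rV[R]_n) : 'rV[R]_n.+1 :=
  \row_i (if unlift ord0 i is Some j then z.2 ord0 j else z.1).

Lemma measurable_rV_cons n : measurable_fun setT (@rV_cons n).
Proof.
apply: measurable_rVP => i.
under eq_fun do rewrite mxE; case: unliftP => [j _|_]; last exact: measurable_fst.
exact: (measurableT_comp (@measurable_rV_coord n j) measurable_snd).
Qed.

Section step.
Variables (n : nat) (m : {sigma_finite_measure set 'rV[R]_n -> \bar R}).

Definition lebesgue_rV_step : set 'rV[R]_n.+1 -> \bar R :=
  pushforward (lebesgue_measure \x m)%E (@rV_cons n).

Let lebesgue_rV_step0 : lebesgue_rV_step set0 = 0%E.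
Proof. by rewrite /lebesgue_rV_step /pushforward preimage_set0 measure0. Qed.

Let lebesgue_rV_step_ge0 A : (0 <= lebesgue_rV_step A)%E.
Proof. by rewrite /lebesgue_rV_step /pushforward; exact: measure_ge0. Qed.

Let lebesgue_rV_step_sigma_additive : semi_sigma_additive lebesgue_rV_step.
Proof.
have mpre (A : set 'rV[R]_n.+1) : measurable A ->
    measurable (@rV_cons n @^-1` A).
  by move=> mA; rewrite -[X in measurable X]setTI; exact: measurable_rV_cons.
move=> F mF tF mUF; rewrite /lebesgue_rV_step /pushforward preimage_bigcup.
apply: measure_semi_sigma_additive; first by move=> k; exact: mpre.
  apply/trivIsetP => /= i j _ _ ij; rewrite -preimage_setI.
  by move/trivIsetP : tF => /(_ _ _ _ _ ij) ->//; rewrite preimage_set0.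
by rewrite -preimage_bigcup; exact: mpre.
Qed.

HB.instance Definition _ := isMeasure.Build _ _ _ lebesgue_rV_step
  lebesgue_rV_step0 lebesgue_rV_step_ge0 lebesgue_rV_step_sigma_additive.

Let lebesgue_rV_step_sigma_finite : sigma_finite setT lebesgue_rV_step.
Proof.
have /sigma_finiteP[F [TF ndF Foo]] := sigma_finiteT (@lebesgue_measure R).
have /sigma_finiteP[G [TG ndG Goo]] := sigma_finiteT m.
pose uncons (v : 'rV[R]_n.+1) : R * 'rV[R]_n :=
  (v ord0 ord0, \row_i v ord0 (lift ord0 i)).
have munc : measurable_fun setT uncons.
  apply/measurable_fun_pairP; split; first exact: measurable_rV_coord.
  apply: measurable_rVP => i.
  by under eq_fun do rewrite /= mxE; exact: measurable_rV_coord.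
have consK : cancel (@rV_cons n) uncons.
  move=> [x v]; rewrite /uncons mxE unlift_none/=; congr pair.
  by apply/rowP => i; rewrite !mxE liftK.
exists (fun k => uncons @^-1` (F k `*` G k)).
  rewrite -preimage_bigcup -(preimage_setT uncons); congr (_ @^-1` _).
  apply/seteqP; split=> [[x y] _|//]; have [i _ Fx] : (\bigcup_k F k) x.
    by rewrite -TF.
  have [j _ Gy] : (\bigcup_k G k) y by rewrite -TG.
  exists (maxn i j) => //; split=> /=.
    by move: Fx; exact/subsetPset/ndF/leq_maxl.
  by move: Gy; exact/subsetPset/ndG/leq_maxr.
move=> k; have [[mF Fk] [mG Gk]] := (Foo k, Goo k); split.
  by rewrite -[X in measurable X]setTI; apply: munc => //; exact: measurableX.
rewrite /lebesgue_rV_step /pushforward -comp_preimage.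
rewrite (_ : _ \o _ = id) ?preimage_id; last exact/funext.
by rewrite product_measure1E// lte_mul_pinfty// ge0_fin_numE.
Qed.

HB.instance Definition _ := Measure_isSigmaFinite.Build _ _ _ lebesgue_rV_step
  lebesgue_rV_step_sigma_finite.
End step.

(* Lebesgue measure on R^n, as an iterated product *)
Fixpoint lebesgue_rV (n : nat) :
    {sigma_finite_measure set 'rV[R]_n -> \bar R} :=
  if n is n'.+1 then lebesgue_rV_step (lebesgue_rV n') else \d_(0 : 'rV[R]_0).

Lemma lebesgue_rV_box n (a b : 'I_n -> R) : (forall i, a i <= b i) ->
  lebesgue_rV n [set v | forall i, a i <= v ord0 i < b i] =
  (\prod_(i < n) (b i - a i))%:E.
Proof.
elim: n a b => [|n IHn] a b ab /=.
  by rewrite big_ord0 diracE mem_set// => -[].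
rewrite /lebesgue_rV_step /pushforward.
set B := _ @^-1` _.
pose B' := [set v : 'rV[R]_n |
  forall i, a (lift ord0 i) <= v ord0 i < b (lift ord0 i)].
have mB' : measurable B'.
  have -> : B' = \bigcap_i (fun v : 'rV[R]_n => v ord0 i) @^-1`
      `[a (lift ord0 i), b (lift ord0 i)[%classic.
    apply/seteqP; split=> v H i; first by move=> _; rewrite /= in_itv; exact: H.
    by have := H i I; rewrite /= in_itv.
  apply: fin_bigcap_measurable => // i _.
  by rewrite -[X in measurable X]setTI; exact: measurable_rV_coord.
have -> : B = `[a ord0, b ord0[%classic `*` B'.
  apply/seteqP; split=> [[x v] H|[x v] [H1 H2] i] /=.
    split=> [|i]; first by have := H ord0; rewrite mxE unlift_none /= in_itv.
    by have := H (lift ord0 i); rewrite mxE liftK.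
  by rewrite mxE; case: unliftP => [j ->|->]; [exact: H2|move: H1; rewrite /= in_itv].
rewrite product_measure1E//.
rewrite IHn// big_ord_recl EFinM; congr (_ * _)%E.
rewrite [LHS](_ : _ =
    (if (a ord0 < b ord0)%R then (b ord0)%:E - (a ord0)%:E else 0)%E); last first.
  by rewrite -lte_fin; exact: (lebesgue_measure_itv `[a ord0, b ord0[).
by case: ltgtP (ab ord0) => // -> _; rewrite subrr.
Qed.

End lebesgue_rV.

Section bochner.
Context d (T : measurableType d) (R : realType) (E : completeNormedModType R).
Variable mu : {measure set T -> \bar R}.
Implicit Types (A : set T) (f s : T -> E).

Definition simple_function s :=
  finite_set (range s) /\ forall y, measurable (s @^-1` [set y]).

(* Only the values of f on A matter.  Asking for convergence everywhere on A
   rather than mu-almost everywhere selects, in each class of functions of the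
   Bochner spaces, the representatives without exceptional null set. *)
Definition strongly_measurable A f :=
  exists2 s : nat -> T -> E, (forall n, simple_function (s n)) &
    forall x, A x -> s n x @[n --> \oo] --> f x.

Definition integrable_simple A s := simple_function s /\
  forall y, y != 0 -> (mu (A `&` s @^-1` [set y]) < +oo)%E.

Definition simple_integral A s : E :=
  \sum_(y \in range s) fine (mu (A `&` s @^-1` [set y])) *: y.

Definition is_bochner_integral A f (v : E) := strongly_measurable A f /\
  exists s : nat -> T -> E, [/\ forall n, integrable_simple A (s n),
    (\int[mu]_(x in A) `|f x - s n x|%:E)%E @[n --> \oo] --> 0%E &
    simple_integral A (s n) @[n --> \oo] --> v].

(* 0 when f is not Bochner integrable on A *)
Definition bochner_integral A f : E := xget 0 (is_bochner_integral A f).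

(* for q : \bar R, including q = +oo *)
Definition LE_norm (q : \bar R) A f : \bar R :=
  'N[mu]_q[(fun x => `|f x|%:E) \_ A].

Definition LE (q : \bar R) A : set (T -> E) :=
  [set f | strongly_measurable A f /\ (LE_norm q A f < +oo)%E].

(* the least bound C, for possibly non-linear S; +oo if there is none *)
Definition LE_opnorm (q : R) (S : (T -> E) -> T -> E) : \bar R :=
  ereal_inf [set C%:E | C in [set C : R | 0 <= C /\
    forall f, LE q%:E setT f ->
      (LE_norm q%:E setT (S f) <= C%:E * LE_norm q%:E setT f)%E]].

End bochner.

(* (k, m) stands for the cube 2^-k ([0, 1)^d + m); for 0 < d, distinct pairs
   give distinct cubes *)
Definition dyadic_cube (d : nat) := (int * {ffun 'I_d -> int})%type.

Definition cube (R : realType) (d : nat) (Q : dyadic_cube d) : set 'rV[R]_d :=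
  [set x | forall i, (Q.2 i)%:~R * 2 ^ (- Q.1) <= x ord0 i <
                     (Q.2 i + 1)%:~R * 2 ^ (- Q.1)].

Section operators.
Variables (R : realType) (d : nat) (E : banachLatticeType R).
Implicit Types (D : {fset dyadic_cube d}) (f : 'rV[R]_d -> E).

Definition average (Q : dyadic_cube d) f : E :=
  (fine (lebesgue_rV R d (cube Q)))^-1 *:
    bochner_integral (lebesgue_rV R d) (cube Q) f.

Definition dyadic_maximal D f : 'rV[R]_d -> E := fun x =>
  lattice_sup [seq \1_(cube Q) x *: average Q f | Q <- D].

Definition dyadic_Hardy_Littlewood := exists2 q : R, 1 < q &
  (ereal_sup [set LE_opnorm (lebesgue_rV R d) q (dyadic_maximal D) |
               D in [set: {fset dyadic_cube d}]] < +oo)%E.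

Variables (mu : {measure set 'rV[R]_d -> \bar R}).
Variable lambda : dyadic_cube d -> {linear E -> E}.

Definition dyadic_op D f : 'rV[R]_d -> E := fun x =>
  \sum_(Q <- D) \1_(cube Q) x *: lambda Q (bochner_integral mu (cube Q) f).

Definition dyadic_op_in D (P : dyadic_cube d) f : 'rV[R]_d -> E := fun x =>
  \sum_(Q <- D | `[< cube Q `<=` (cube P : set 'rV[R]_d) >])
    \1_(cube Q) x *: lambda Q (bochner_integral mu (cube Q) f).

Definition Loo_testing := exists B : R, forall D P f,
  P \in D -> LE mu +oo%E (cube P) f ->
  (LE_norm mu 1 setT (dyadic_op_in D P f) <=
     B%:E * LE_norm mu +oo (cube P) f * mu (cube P))%E.

Definition Lt_testing (t : R) := exists B : R, forall D P f,
  P \in D -> LE mu t%:E (cube P) f ->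
  (LE_norm mu 1 setT (dyadic_op_in D P f) <=
     B%:E * LE_norm mu t%:E (cube P) f * mu (cube P) `^ (1 - t^-1))%E.

End operators.
Arguments dyadic_Hardy_Littlewood {R} d E.

Section measures.
Variables (R : realType) (d : nat) (mu : {measure set 'rV[R]_d -> \bar R}).

Definition locally_finite := forall x : 'rV[R]_d,
  exists2 U : set 'rV[R]_d, open_nbhs x U & (mu U < +oo)%E.

(* the library's ball on 'rV[R]_d is for the maximum norm *)
Definition euclidean_ball (x : 'rV[R]_d) (r : R) : set 'rV[R]_d :=
  [set y | Num.sqrt (\sum_(i < d) (y ord0 i - x ord0 i) ^+ 2) < r].

Definition doubling := exists K : R, forall (x : 'rV[R]_d) (r : R), 0 < r ->
  [/\ (0 < mu (euclidean_ball x (2 * r)))%E,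
      (mu (euclidean_ball x (2 * r)) <= K%:E * mu (euclidean_ball x r))%E &
      (K%:E * mu (euclidean_ball x r) < +oo)%E].

End measures.

(* Main.v *)
Require Import Defs.
From HB Require Import structures.
From mathcomp Require Import all_boot all_order all_algebra finmap.
From mathcomp Require Import all_classical all_reals all_analysis.
From mathcomp Require Import measurable_realfun ring lra.

Set Implicit Arguments.
Unset Strict Implicit.
Unset Printing Implicit Defensive.

Import Order.TTheory GRing.Theory Num.Theory.
Import numFieldNormedType.Exports.

Local Open Scope classical_set_scope.
Local Open Scope ring_scope.

(** The problem is discrete: for a given finite collection, add all dyadic
    descendants down to some generation, and replace [f] on each cube of that
    generation by the modulus of its mean. As the operators [lambda Q] are positive,
    this can only increase the norm of the operator at each point
    ([norm_op_value]), and by Jensen's inequality it can only decrease the norm of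
    [f] ([leaf_modulus_total]). What remains is a nonnegative function on a finite
    weighted set and a laminar family of subsets, the cubes, with all singletons.

    There the bound is a stopping argument. Suppose that every cube [F] has a subset
    [Om] of small relative mass such that the cubes inside [F] but not inside [Om]
    contribute to the operator at most a constant times the mean of [|f|] over [F],
    at every point of [F] ([sparse_stopping]). Continuing with the maximal cubes
    inside [Om], and pairing with a function [g] of the dual exponent, one is left
    with the sum over all stopping cubes of mass times mean of [|f|] times mean of
    [g]; the stopping cubes being sparse, Young's and Jensen's inequalities bound
    it by the norms ([duality_bound], [sparse_stopping_bound]).

    Such sets come from testing. Let [h >= 0] have at least the integral of [f] over
    each cube not inside [Om]. By positivity the operator on [h] dominates the
    contribution of these cubes, testing bounds its [L^1] norm, and Chebyshev's
    inequality bounds it at the points outside a second small set. Once the cubes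
    inside that set are discarded too, the bound holds at all points, because the
    remaining cubes through a point have a point outside the set in common
    ([testing_majorant_sparse]). It remains to find [h] to which testing applies.
    In each case [Om] contains the heavy cubes, those on which [|f|] has a mean much
    larger than on [F].

    If the measure is doubling, average [f] over the maximal cubes inside [Om]: the
    means over their parents are under control, hence so are these averages, and
    [h] is bounded ([doubling_majorant]). For other measures, the integral of [f]
    over the heavy cubes is moved up to the smallest cubes that are not inside [Om].
    The resulting [h] need not be bounded, but it satisfies a Carleson packing
    condition, so all its power means are controlled ([light_majorant_power]). This
    suffices for the testing condition with a finite exponent
    ([power_testing_majorant]). When testing is known for bounded functions only,
    that [h] is replaced by its lattice maximal function over the cubes not inside
    [Om]. This dominates the mean of [h] over each such cube, and it is bounded in
    norm once the small set where the maximal function is large has been added to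
    [Om] ([maximal_majorant]).

    The last step needs a maximal inequality for the given measure, whereas the
    Hardy--Littlewood property is about Lebesgue measure. It carries over because
    the successive averages over a finite family of cubes can be imitated by a step
    function on a Lebesgue cube, each subcube being represented by equal dyadic
    cubes in a number proportional to its mass ([simulation], [maximal_transfer]). *)

(** * Order and modulus in a Banach lattice *)

Section banach_lattice_order.
Variables (R : realType) (E : banachLatticeType R).
Implicit Types x y z u v : E.

Lemma bl_leD2r z x y : x <= y -> x + z <= y + z.
Proof. exact: ble_leD2r. Qed.

Lemma bl_leZ (a : R) x y : 0 <= a -> x <= y -> a *: x <= a *: y.
Proof. exact: ble_leZ2l. Qed.

Lemma bl_leD x y u v : x <= y -> u <= v -> x + u <= y + v.
Proof.
move=> xy uv; apply: (le_trans (bl_leD2r u xy)).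
by rewrite addrC (addrC y); exact: bl_leD2r.
Qed.

Lemma bl_sub_ge0 x y : (0 <= y - x) = (x <= y).
Proof.
by apply/idP/idP => [/(bl_leD2r x)|/(bl_leD2r (- x))]; rewrite ?subrr // add0r subrK.
Qed.

Lemma bl_leN x y : x <= y -> - y <= - x.
Proof. by rewrite -(bl_sub_ge0 x y) -(bl_sub_ge0 (- y)) opprK addrC. Qed.

Lemma bl_ge0Z (a : R) x : 0 <= a -> 0 <= x -> 0 <= a *: x.
Proof. by move=> a0 /(bl_leZ a0); rewrite scaler0. Qed.

Lemma bl_leZr (a b : R) x : 0 <= x -> a <= b -> a *: x <= b *: x.
Proof. by move=> x0 ab; rewrite -(bl_sub_ge0 (a *: x)) -scalerBl bl_ge0Z// subr_ge0. Qed.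

Lemma bl_sum_ge0 I (r : seq I) (P : pred I) (F : I -> E) :
  (forall i, P i -> 0 <= F i) -> 0 <= \sum_(i <- r | P i) F i.
Proof.
move=> F0; apply: (big_ind (fun x : E => 0 <= x)) => // x y x0 y0.
by rewrite -(addr0 0); exact: bl_leD.
Qed.

Lemma bl_ler_sum I (r : seq I) (P : pred I) (F G : I -> E) :
  (forall i, P i -> F i <= G i) ->
  \sum_(i <- r | P i) F i <= \sum_(i <- r | P i) G i.
Proof.
move=> FG; rewrite -(bl_sub_ge0 (\sum_(i <- r | P i) F i)) -sumrB; apply: bl_sum_ge0 => i Pi.
by rewrite bl_sub_ge0; exact: FG.
Qed.

Lemma bl_sum_subset (I : finType) (P Q : pred I) (F : I -> E) :
  (forall i, Q i -> 0 <= F i) -> (forall i, P i -> Q i) ->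
  \sum_(i | P i) F i <= \sum_(i | Q i) F i.
Proof.
move=> F0 PQ; rewrite [leRHS](bigID P) /=.
rewrite -[leLHS]addr0; apply: bl_leD.
  rewrite le_eqVlt; apply/orP; left; apply/eqP; apply: eq_bigl => i.
  by case Pi : (P i); rewrite ?andbF// andbT PQ.
by apply: bl_sum_ge0 => i /andP[+ _]; exact: F0.
Qed.

Lemma bl_norm_sandwich x u : - u <= x -> x <= u -> `|x| <= `|u|.
Proof.
move=> ux xu; apply: ble_norm; rewrite bjoinP; apply/andP.
have ujoin : u <= Order.join u (- u) by exact: (@leUl _ E).
split; first exact: (le_trans xu ujoin).
by apply: (le_trans _ ujoin); rewrite -[u]opprK; exact: bl_leN.
Qed.

Lemma bl_norm_le x y : 0 <= x -> x <= y -> `|x| <= `|y|.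
Proof.
move=> x0 xy; apply: bl_norm_sandwich => //; apply: (le_trans _ x0).
by have := bl_leN (le_trans x0 xy); rewrite oppr0.
Qed.

Definition modulus x : E := Order.join x (- x).

Lemma ler_modulus x : x <= modulus x. Proof. exact: (@leUl _ E). Qed.

Lemma lerN_modulus x : - modulus x <= x.
Proof. by rewrite -{2}[x]opprK; apply: bl_leN; exact: (@leUr _ E). Qed.

Lemma modulus_ge0 x : 0 <= modulus x.
Proof.
have : 0 <= modulus x + modulus x.
  by rewrite -(subrr x); apply: bl_leD; [exact: (@leUl _ E)|exact: (@leUr _ E)].
rewrite -mulr2n -scaler_nat => /(@bl_ge0Z 2^-1).
by rewrite scalerA mulVf ?pnatr_eq0// scale1r invr_ge0 ler0n; exact.
Qed.

Lemma norm_modulus x : `|modulus x| = `|x|.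
Proof.
apply/eqP; rewrite eq_le; apply/andP; split; last first.
  exact: bl_norm_sandwich (lerN_modulus x) (ler_modulus x).
apply: ble_norm; rewrite bjoinP; apply/andP; split; first exact: (lexx (modulus x)).
apply: (@le_trans _ _ (x : E)); [exact: lerN_modulus|exact: ler_modulus].
Qed.

Section positive.
Variable u : {linear E -> E}.
Hypothesis u_pos : positive_operator u.

Lemma positive_le x y : x <= y -> u x <= u y.
Proof. by rewrite -(bl_sub_ge0 x) => /u_pos; rewrite linearB bl_sub_ge0. Qed.

End positive.

End banach_lattice_order.

(** * Weighted finite sets *)
Section weights.
Variables (R : realType) (L : finType) (w : L -> R).
Hypothesis w_ge0 : forall P, 0 <= w P.
Implicit Types (A B : {set L}).

Definition mass A : R := \sum_(P in A) w P.

Definition wsum (V : lmodType R) A (f : L -> V) : V := \sum_(P in A) w P *: f P.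

Definition wmean (V : lmodType R) A (f : L -> V) : V := (mass A)^-1 *: wsum A f.

Definition rsum A (phi : L -> R) : R := \sum_(P in A) w P * phi P.

Definition rmean A (phi : L -> R) : R := (mass A)^-1 * rsum A phi.

Lemma mass_ge0 A : 0 <= mass A.
Proof. exact: sumr_ge0. Qed.

Lemma mass_le A B : A \subset B -> mass A <= mass B.
Proof.
move=> AB; rewrite /mass [leRHS](big_setID A) /= (finset.setIidPr AB).
by rewrite lerDl sumr_ge0.
Qed.

Lemma mass0 A P : mass A = 0 -> P \in A -> w P = 0.
Proof.
move=> A0 PA; apply/eqP; rewrite eq_le w_ge0 andbT -A0 /mass (bigD1 P) //=.
by rewrite lerDl sumr_ge0.
Qed.

Lemma rsum_ge0 A phi : (forall P, P \in A -> 0 <= phi P) -> 0 <= rsum A phi.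
Proof. by move=> phi0; apply: sumr_ge0 => P PA; rewrite mulr_ge0 ?phi0. Qed.

Lemma rmean_ge0 A phi : (forall P, P \in A -> 0 <= phi P) -> 0 <= rmean A phi.
Proof. by move=> phi0; rewrite mulr_ge0 ?invr_ge0 ?mass_ge0 ?rsum_ge0. Qed.

Lemma rsum_le A phi psi : (forall P, P \in A -> phi P <= psi P) ->
  rsum A phi <= rsum A psi.
Proof. by move=> h; apply: ler_sum => P PA; rewrite ler_wpM2l ?h. Qed.

Lemma rsum_subset A B phi : A \subset B -> (forall P, P \in B -> 0 <= phi P) ->
  rsum A phi <= rsum B phi.
Proof.
move=> AB phi0; rewrite /rsum [leRHS](big_setID A) /= (finset.setIidPr AB).
rewrite lerDl sumr_ge0// => P; rewrite inE => /andP[_ PB].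
by rewrite mulr_ge0 ?phi0.
Qed.

Lemma wsum0 (V : lmodType R) A (f : L -> V) : mass A = 0 -> wsum A f = 0.
Proof.
by move=> A0; rewrite /wsum big1// => P /(mass0 A0) ->; rewrite scale0r.
Qed.

Lemma rsum0 A phi : mass A = 0 -> rsum A phi = 0.
Proof. exact: (@wsum0 R^o). Qed.

Lemma mass_wmean (V : lmodType R) A (f : L -> V) : mass A *: wmean A f = wsum A f.
Proof.
have [A0|A0] := eqVneq (mass A) 0; first by rewrite A0 scale0r wsum0.
by rewrite /wmean scalerA mulfV// scale1r.
Qed.

Lemma mass_rmean A phi : mass A * rmean A phi = rsum A phi.
Proof. exact: (@mass_wmean R^o). Qed.

Lemma wsum_setID (V : lmodType R) A B (f : L -> V) :
  wsum A f = wsum (A :&: B) f + wsum (A :\: B) f.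
Proof. exact: big_setID. Qed.

Lemma rsum_setID A B phi : rsum A phi = rsum (A :&: B) phi + rsum (A :\: B) phi.
Proof. exact: big_setID. Qed.

(** The tangent line of [x ^ r] at the mean lies below the graph; Young's
    inequality says exactly that. *)
Lemma jensen_powR A phi (r : R) : 1 < r -> (forall P, P \in A -> 0 <= phi P) ->
  mass A * rmean A phi `^ r <= rsum A (fun P => phi P `^ r).
Proof.
move=> r1 phi0; have [A0|A0] := eqVneq (mass A) 0.
  by rewrite A0 mul0r rsum_ge0// => P _; rewrite powR_ge0.
have r0 : 0 < r by lra.
have rm1 : 0 < r - 1 by lra.
set m := rmean A phi; have m0 : 0 <= m by exact: rmean_ge0.
pose s := r / (r - 1).
have s0 : 0 < s by rewrite divr_gt0.
have rs : r^-1 + s^-1 = 1 by rewrite /s invf_div -{1}(div1r r) -mulrDl subrKC mulfV// gt_eqF.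
have ms : (m `^ (r - 1)) `^ s = m `^ r.
  by rewrite -powRrM /s mulrCA divff ?mulr1// gt_eqF.
have young P : P \in A -> w P * (phi P * m `^ (r - 1)) <=
    w P * (phi P `^ r / r + m `^ r / s).
  move=> PA; rewrite ler_wpM2l// -ms.
  by apply: conjugate_powR => //; rewrite ?powR_ge0 ?phi0.
have : \sum_(P in A) w P * (phi P * m `^ (r - 1)) <=
  \sum_(P in A) w P * (phi P `^ r / r + m `^ r / s) by exact: ler_sum.
have -> : \sum_(P in A) w P * (phi P * m `^ (r - 1)) = mass A * m `^ r.
  under eq_bigr do rewrite mulrA.
  by rewrite -mulr_suml -/(rsum A phi) -mass_rmean -/m -mulrA mulr_powRB1.
under eq_bigr do rewrite mulrDr !mulrA.
rewrite big_split /= -!mulr_suml -/(rsum A _) -/(mass A).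
have -> : s^-1 = 1 - r^-1 by rewrite -rs addrC addKr.
rewrite mulrBr mulr1 => h.
have {}h : mass A * m `^ r * r^-1 <= rsum A (fun P => phi P `^ r) * r^-1.
  by move: h; rewrite /rsum; lra.
by rewrite ler_pM2r ?invr_gt0 in h.
Qed.

Lemma rsum_powR_le A phi (r : R) : 1 < r -> (forall P, P \in A -> 0 <= phi P) ->
  rsum A phi `^ r <= mass A `^ (r - 1) * rsum A (fun P => phi P `^ r).
Proof.
move=> r1 phi0; rewrite -mass_rmean powRM ?mass_ge0 ?rmean_ge0//.
rewrite -(@mulr_powRB1 _ (mass A)) ?mass_ge0 ?(lt_trans _ r1)// (mulrC (mass A)) -mulrA.
by rewrite ler_wpM2l ?powR_ge0// jensen_powR.
Qed.

Lemma power_mean_down A phi (q c : R) n : 0 < q -> q < n%:R -> 0 <= c ->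
  (forall P, 0 <= phi P) -> rsum A (fun P => phi P ^+ n) <= c ^+ n * mass A ->
  rsum A (fun P => phi P `^ q) <= c `^ q * mass A.
Proof.
move=> q0 qn c0 phi0 hc.
have [A0|A0] := eqVneq (mass A) 0; first by rewrite rsum0// A0 mulr0.
have wA : 0 < mass A by rewrite lt_def A0 mass_ge0.
pose r := n%:R / q; have r1 : 1 < r by rewrite ltr_pdivlMr// mul1r.
have := @jensen_powR A (fun P => phi P `^ q) r r1 (fun P _ => powR_ge0 _ _).
have -> : rsum A (fun P => (phi P `^ q) `^ r) = rsum A (fun P => phi P ^+ n).
  apply: eq_bigr => P _; rewrite -powRrM /r mulrCA divff ?gt_eqF// mulr1.
  by rewrite powR_mulrn.
move=> /le_trans /(_ hc); rewrite mulrC ler_pM2r// => hr.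
rewrite -mass_rmean// mulrC ler_pM2r//.
set x := rmean A _ in hr *.
have x0 : 0 <= x by apply: rmean_ge0 => // P _; exact: powR_ge0.
rewrite leNgt; apply/negP => cx.
have : (c `^ q) `^ r < x `^ r.
  by rewrite gt0_ltr_powR ?nnegrE ?powR_ge0// (lt_trans _ r1).
rewrite -powRrM /r mulrCA divff ?gt_eqF// mulr1 powR_mulrn//.
by rewrite ltNge hr.
Qed.

Lemma chebyshev A phi (a k : R) : 0 <= a -> 0 < k -> (forall P, P \in A -> 0 <= phi P) ->
  rsum A phi <= a * mass A -> mass [set P in A | a / k < phi P]%SET <= k * mass A.
Proof.
move=> a0 k0 phi0 phia; set B := [set P in A | _]%SET.
have BA : B \subset A by apply/fintype.subsetP => P; rewrite inE => /andP[].
have hB : rsum B phi <= a * mass A by exact: le_trans (rsum_subset BA phi0) phia.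
have phiB0 P : P \in B -> 0 <= phi P by rewrite inE => /andP[/phi0].
have [az|an] := eqVneq a 0.
  have z : rsum B phi = 0.
    by apply/eqP; rewrite eq_le rsum_ge0// andbT (le_trans hB)// az mul0r.
  rewrite [mass B](_ : _ = 0) ?mulr_ge0 ?mass_ge0 ?(ltW k0)//.
  rewrite /mass big1// => P PB.
  have /eqP := psumr_eq0P (fun P PB => mulr_ge0 (w_ge0 P) (phiB0 P PB)) z PB.
  rewrite mulf_eq0 => /orP[/eqP//|].
  by move: PB; rewrite inE az mul0r => /andP[_] /gt_eqF ->.
have agt0 : 0 < a by rewrite lt_def an.
have lo : a * (k^-1 * mass B) <= rsum B phi.
  rewrite /mass !mulr_sumr; apply: ler_sum => P; rewrite inE => /andP[_ phiP].
  by rewrite mulrA mulrC ler_wpM2l// ltW.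
by have := le_trans lo hB; rewrite ler_pM2l// ler_pdivrMl.
Qed.

End weights.

Lemma powRD_le (R : realType) (a b r : R) : 1 < r -> 0 <= a -> 0 <= b ->
  (a + b) `^ r <= 2 `^ (r - 1) * (a `^ r + b `^ r).
Proof.
move=> r1 a0 b0; pose phi (i : bool) := if i then a else b.
have phi0 i : i \in [set: bool]%SET -> 0 <= phi i by case: i.
have := @rsum_powR_le R bool (fun=> 1) (fun=> ler01) [set: bool]%SET phi r r1 phi0.
rewrite /rsum /mass; under eq_bigl do rewrite inE.
under [in X in _ <= X * _]eq_bigl do rewrite inE.
under [in X in _ <= _ * X]eq_bigl do rewrite inE.
by rewrite !big_bool /= !mul1r.
Qed.

(** * Laminar families *)
Section laminar_families.
Variables (L : finType) (D : {set {set L}}).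
Implicit Types (A B F Q S Om : {set L}) (P : L).

Definition laminar := forall A B, A \in D -> B \in D ->
  [|| A \subset B, B \subset A | [disjoint A & B]].

Hypothesis D_laminar : laminar.
Hypothesis D_singletons : forall P, [set P]%SET \in D.

(** Stopping sets are encoded as subsets [Om] of the finite set. Their maximal
    members of [D] are the stopping cubes, named here by the points they contain; the
    singleton makes the choice possible. *)
Definition maxcube Om P : {set L} :=
  [arg max_(Q > [set P]%SET | [&& Q \in D, P \in Q & Q \subset Om]) #|Q|]%N.

Lemma laminar_mem A B P : A \in D -> B \in D -> P \in A -> P \in B ->
  (A \subset B) || (B \subset A).
Proof.
move=> AD BD PA PB; have := D_laminar AD BD; rewrite orbA => /orP[//|].
by move=> /pred0P /(_ P) /=; rewrite PA PB.
Qed.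

Lemma maxcubeP Om P : P \in Om ->
  [/\ maxcube Om P \in D, P \in maxcube Om P, maxcube Om P \subset Om &
    forall Q, Q \in D -> P \in Q -> Q \subset Om -> Q \subset maxcube Om P].
Proof.
move=> POm; rewrite /maxcube; case: arg_maxnP => [|M /and3P[MD PM MOm] maxM].
  by rewrite D_singletons finset.set11 finset.sub1set.
split=> // Q QD PQ QOm; have /orP[//|MQ] := laminar_mem QD MD PQ PM.
have := maxM Q; rewrite QD PQ QOm => /(_ isT) cQM.
by have /eqP -> : M == Q by rewrite finset.eqEcard MQ.
Qed.

Lemma maxcube_eq Om P P' : P \in Om -> P' \in maxcube Om P ->
  maxcube Om P' = maxcube Om P.
Proof.
move=> POm P'm; have [mD Pm mOm maxm] := maxcubeP POm.
have P'Om : P' \in Om by exact: (fintype.subsetP mOm).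
have [m'D P'm' m'Om maxm'] := maxcubeP P'Om.
have mm' := maxm' _ mD P'm mOm.
apply/eqP; rewrite finset.eqEsubset mm' andbT; apply: maxm => //.
exact: (fintype.subsetP mm').
Qed.

(** A cube that is not stopped cuts no stopping cube: those that it meets, it
    contains. *)
Lemma maxcube_setI Om Q P : Q \in D -> ~~ (Q \subset Om) -> P \in Q -> P \in Om ->
  maxcube (Q :&: Om) P = maxcube Om P.
Proof.
move=> QD QOm PQ POm; have [mD Pm mOm maxm] := maxcubeP POm.
have PI : P \in Q :&: Om by rewrite inE PQ.
have [m'D Pm' m'Om maxm'] := maxcubeP PI.
have mQ : maxcube Om P \subset Q.
  have /orP[//|Qm] := laminar_mem mD QD Pm PQ.
  by move: QOm; rewrite (fintype.subset_trans Qm mOm).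
apply/eqP; rewrite finset.eqEsubset maxm ?maxm' ?finset.subsetI ?mQ//.
by move: m'Om; rewrite finset.subsetI => /andP[].
Qed.

Lemma big_maxcube (V : nmodType) Om (F : L -> V) :
  \sum_(P in Om) F P = \sum_(S in maxcube Om @: Om) \sum_(P in S) F P.
Proof.
rewrite (partition_big_imset (maxcube Om)) /=; apply: eq_bigr => S.
move=> /finset.imsetP[P0 P0Om ->]; have [_ _ mOm _] := maxcubeP P0Om.
apply: eq_bigl => P; apply/andP/idP => [[POm /eqP <-]|Pm].
  by have [] := maxcubeP POm.
by split; [exact: (fintype.subsetP mOm)|apply/eqP; exact: maxcube_eq].
Qed.

(** Among the cubes containing [P] that meet the complement of [Om], the smallest
    one reaches a point outside [Om], which therefore lies in all of them. *)
Lemma good_chain Om F P : F \in D -> P \in F -> ~~ (F \subset Om) ->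
  exists2 P', P' \in F :\: Om & forall Q, Q \in D -> P \in Q -> Q \subset F ->
    ~~ (Q \subset Om) -> P' \in Q.
Proof.
move=> FD PF FOm.
pose good Q := [&& Q \in D, P \in Q, Q \subset F & ~~ (Q \subset Om)].
have gF : good F by rewrite /good FD PF FOm subxx.
case: (arg_minnP (fun Q => #|Q|) gF) => M /and4P[MD PM MF MOm] minM.
have /fintype.subsetPn[P' P'M P'Om] := MOm.
exists P'; first by rewrite inE P'Om (fintype.subsetP MF).
move=> Q QD PQ QF QOm; have := minM Q; rewrite /good QD PQ QF QOm => /(_ isT) cMQ.
have /orP[MQ|QM] := laminar_mem MD QD PM PQ; first exact: (fintype.subsetP MQ).
by have /eqP -> : Q == M by rewrite finset.eqEcard QM.
Qed.

Section weighted.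
Variables (R : realType) (w : L -> R).
Hypothesis w_ge0 : forall P, 0 <= w P.

(** Conditional expectation on the stopping cubes preserves the integral. *)
Lemma wsum_maxcube_mean (V : lmodType R) Om (f : L -> V) :
  wsum w Om (fun P => wmean w (maxcube Om P) f) = wsum w Om f.
Proof.
rewrite /wsum !big_maxcube; apply: eq_bigr => S /finset.imsetP[P0 P0Om ->].
rewrite -/(wsum w _ f) -(mass_wmean w_ge0) /mass scaler_suml.
by apply: eq_bigr => P Pm; rewrite (maxcube_eq P0Om).
Qed.

Lemma rsum_maxcube_mean Om phi :
  rsum w Om (fun P => rmean w (maxcube Om P) phi) = rsum w Om phi.
Proof. exact: (@wsum_maxcube_mean R^o). Qed.

Lemma rsum_maxcube_mono Om (a b : L -> R) :
  (forall S, S \in D -> S \subset Om -> (exists2 P, P \in Om & maxcube Om P = S) ->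
    rsum w S a <= rsum w S b) -> rsum w Om a <= rsum w Om b.
Proof.
move=> h; rewrite /rsum !big_maxcube; apply: ler_sum => S /finset.imsetP[P0 P0Om ->].
have [mD _ mOm _] := maxcubeP P0Om; apply: h => //; by exists P0.
Qed.

End weighted.
End laminar_families.

(** * Sparse stopping bounds the operator *)
Section sparse_bounds.
Variables (R : realType) (E : banachLatticeType R) (L : finType) (w : L -> R).
Hypothesis w_ge0 : forall P, 0 <= w P.
Variables (D : {set {set L}}) (Lam : {set L} -> {linear E -> E}).
Hypothesis D_laminar : laminar D.
Hypothesis D_singletons : forall P, [set P]%SET \in D.
Implicit Types (F Q S Om : {set L}) (P : L) (f h : L -> E).

(** For a cube [Om] this is the localized operator of the testing conditions, for a
    stopping set it is what the next stopping step has to deal with. *)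
Definition local_op Om f P : E :=
  \sum_(Q in D | (P \in Q) && (Q \subset Om)) Lam Q (wsum w Q f).

Definition good_op F Om f P : E :=
  \sum_(Q in D | [&& P \in Q, Q \subset F & ~~ (Q \subset Om)]) Lam Q (wsum w Q f).

(** The bound is required on all of [F]. At the points of [Om] it concerns the cubes
    that are too large to lie inside [Om]. *)
Definition sparse_stopping (eta C : R) f := forall F, F \in D ->
  exists Om, [/\ Om \subset F, mass w Om <= eta * mass w F &
    forall P, P \in F ->
      `|good_op F Om f P| <= C * rmean w F (fun P => `|f P|)].

Lemma sparse_stopping_le (eta C C' : R) f : C <= C' ->
  sparse_stopping eta C f -> sparse_stopping eta C' f.
Proof.
move=> CC' stop F FD; have [Om [OmF wOm good]] := stop F FD.
exists Om; split=> // P PF; apply: (le_trans (good P PF)).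
by rewrite ler_wpM2r// rmean_ge0.
Qed.

Lemma local_op_maxcube Om f P : P \in Om ->
  local_op Om f P = local_op (maxcube D Om P) f P.
Proof.
move=> POm; have [mD Pm mOm maxm] := maxcubeP D_laminar D_singletons POm.
apply: eq_bigl => Q; apply: andb_id2l => QD; apply: andb_id2l => PQ.
by apply/idP/idP => [|Qm]; [exact: maxm|exact: fintype.subset_trans mOm].
Qed.

Lemma local_op_split F Om f P : Om \subset F ->
  local_op F f P = good_op F Om f P + local_op Om f P.
Proof.
move=> OmF; rewrite /local_op (bigID (fun Q : {set L} => Q \subset Om)) /= addrC; congr +%R.
  by apply: eq_bigl => Q; rewrite !andbA.
apply: eq_bigl => Q; rewrite -!andbA; case: (Q \in D) (P \in Q) => -[] //=.
by apply/andP/idP => [[]//|QOm]; split=> //; exact: fintype.subset_trans OmF.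
Qed.

Lemma local_op0 Om f P : P \notin Om -> local_op Om f P = 0.
Proof.
move=> POm; rewrite /local_op big1// => Q /and3P[_ PQ QOm].
by move: POm; rewrite (fintype.subsetP QOm).
Qed.

(** One stopping step: the mass of the exceptional set is so small that the means
    over its maximal cubes absorb the mean over the whole cube. *)
Lemma mean_stopping (r eta : R) F Om (phi : L -> R) : 1 < r -> 0 < eta ->
  2 `^ r * eta `^ (r - 1) <= 1 -> (forall P, 0 <= phi P) -> Om \subset F ->
  mass w Om <= eta * mass w F ->
  2 * (mass w F * rmean w F phi `^ r) <= 2 `^ r * rsum w (F :\: Om) (fun P => phi P `^ r)
    + rsum w Om (fun P => rmean w (maxcube D Om P) phi `^ r).
Proof.
move=> r1 eta0 eta_small phi0 OmF wOm.
have r0 : 0 < r by lra.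
set a := rsum w (F :\: Om) _; set b := rsum w Om _.
have a0 : 0 <= a by apply: rsum_ge0 => // P _; rewrite powR_ge0.
have b0 : 0 <= b by apply: rsum_ge0 => // P _; rewrite powR_ge0.
have [F0|F0] := eqVneq (mass w F) 0.
  by rewrite F0 mul0r mulr0 addr_ge0// mulr_ge0// powR_ge0.
have {}F0 : 0 < mass w F by rewrite lt_def F0 mass_ge0.
set W := mass w F in F0 wOm *.
have Wr : 0 < W `^ (r - 1) by rewrite powR_gt0.
rewrite -(ler_pM2r Wr) (_ : 2 * _ * _ = 2 * rsum w F phi `^ r); last first.
  rewrite -mass_rmean// -/W powRM ?mass_ge0 ?rmean_ge0 ?(ltW F0)//.
  by rewrite -(@mulr_powRB1 _ W r) ?ltW//; ring.
rewrite (rsum_setID _ F Om) (finset.setIidPr OmF) -(rsum_maxcube_mean D_laminar)//.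
set x := rsum w Om _; set y := rsum w (F :\: Om) phi.
have x0 : 0 <= x by apply: rsum_ge0 => // P _; rewrite rmean_ge0.
have y0 : 0 <= y by exact: rsum_ge0.
have xb : x `^ r <= (eta * W) `^ (r - 1) * b.
  apply: (le_trans (rsum_powR_le w_ge0 r1 _)) => [P _|]; first by rewrite rmean_ge0.
  rewrite ler_wpM2r// ge0_ler_powR ?nnegrE ?mass_ge0//; first by lra.
  by rewrite mulr_ge0 ?ltW.
have ya : y `^ r <= W `^ (r - 1) * a.
  apply: (le_trans (rsum_powR_le w_ge0 r1 _)) => [P _//|].
  rewrite ler_wpM2r// ge0_ler_powR ?nnegrE ?mass_ge0//; first by lra.
  by rewrite mass_le// finset.subsetDl.
have -> : (2 `^ r * a + b) * W `^ (r - 1) = 2 `^ r * (W `^ (r - 1) * a) + W `^ (r - 1) * b by ring.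
have h2 : 2 * 2 `^ (r - 1) = 2 `^ r :> R by rewrite mulr_powRB1.
have := powRD_le r1 x0 y0 => /(@ler_wpM2l _ 2 (ler0n _ _)) /le_trans; apply.
rewrite [leLHS]mulrA h2 mulrDr addrC lerD ?ler_wpM2l ?powR_ge0//.
apply: (@le_trans _ _ (2 `^ r * ((eta * W) `^ (r - 1) * b))).
  by rewrite ler_wpM2l ?powR_ge0.
rewrite powRM ?(ltW eta0) ?(ltW F0)// !mulrA -[leRHS]mul1r -!mulrA mulrA.
by rewrite ler_wpM2r// mulr_ge0// ltW.
Qed.

Section duality.
Variables (p q eta C : R) (f : L -> E) (g : L -> R).
Hypotheses (p1 : 1 < p) (q1 : 1 < q) (pq : p^-1 + q^-1 = 1).
Hypotheses (eta0 : 0 < eta) (eta1 : eta < 1) (C0 : 0 <= C).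
Hypotheses (eta_p : 2 `^ p * eta `^ (p - 1) <= 1).
Hypotheses (eta_q : 2 `^ q * eta `^ (q - 1) <= 1).
Hypotheses (g0 : forall P, 0 <= g P) (stop : sparse_stopping eta C f).

Let phi P := `|f P|.
Let K : R := 2 `^ p + 2 `^ q.
Let energy P := phi P `^ p + g P `^ q.
Let top_energy Om P :=
  rmean w (maxcube D Om P) phi `^ p + rmean w (maxcube D Om P) g `^ q.

(** Induction over the stopping steps. The energy of the maximal cubes stands on
    the left because each step produces it twice, as the bound of the good part of
    the operator (by Young's inequality) and as the same energy on the large cube. *)
Lemma duality_bound Om :
  rsum w Om (fun P => `|local_op Om f P| * g P + C * top_energy Om P) <=
  rsum w Om (fun P => C * K * energy P).
Proof.
have phi0 P : 0 <= phi P by exact: normr_ge0.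
have e0 P : 0 <= energy P by rewrite addr_ge0 ?powR_ge0.
have K0 : 0 <= K by rewrite addr_ge0 ?powR_ge0.
(* the exceptional set of a cube inside Om has smaller mass, hence fewer points *)
move: {2}#|Om| (leqnn #|Om|) => n.
elim: n Om => [|n IHn] Om cOm.
  by move: cOm; rewrite leqn0 cards_eq0 => /eqP ->; rewrite /rsum !big_set0.
apply: (rsum_maxcube_mono D_laminar) => // F FD FOm [P0 P0Om P0F].
have P0F' : P0 \in F by rewrite -P0F; have [] := maxcubeP D_laminar D_singletons P0Om.
have onF P : P \in F -> maxcube D Om P = F.
  by rewrite -P0F; exact: maxcube_eq.
have [F0|F0] := eqVneq (mass w F) 0; first by rewrite !rsum0.
have Fgt0 : 0 < mass w F by rewrite lt_def F0 mass_ge0.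
have [Om' [Om'F wOm' good]] := stop FD.
have cOm' : (#|Om'| <= n)%N.
  rewrite -ltnS; apply: leq_trans (leq_trans (subset_leq_card FOm) cOm).
  apply: proper_card; rewrite properE Om'F; apply/negP => FOm'.
  have := le_trans (mass_le w_ge0 FOm') wOm'; rewrite leNgt => /negP; apply.
  by rewrite -[ltRHS]mul1r ltr_pM2r.
have {IHn} IH := IHn _ cOm'.
set A := rmean w F phi; set G := rmean w F g.
have A0 : 0 <= A by exact: rmean_ge0.
have G0 : 0 <= G by exact: rmean_ge0.
have lhs : rsum w F (fun P => `|local_op Om f P| * g P + C * top_energy Om P) <=
    2 * C * (mass w F * (A `^ p + G `^ q))
    + rsum w Om' (fun P => `|local_op Om' f P| * g P).
  have step : rsum w F (fun P => `|local_op Om f P| * g P + C * top_energy Om P) <=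
      rsum w F (fun P => C * A * g P + `|local_op Om' f P| * g P
        + C * (A `^ p + G `^ q)).
    apply: rsum_le => // P PF.
    rewrite local_op_maxcube ?(fintype.subsetP FOm)// /top_energy !onF// -/A -/G lerD2r.
    rewrite -mulrDl ler_wpM2r// (local_op_split f P Om'F).
    by rewrite (le_trans (ler_normD _ _))// lerD2r good.
  apply: (le_trans step).
  have -> : rsum w F (fun P => C * A * g P + `|local_op Om' f P| * g P
        + C * (A `^ p + G `^ q)) = C * A * rsum w F g
      + rsum w F (fun P => `|local_op Om' f P| * g P)
      + C * (mass w F * (A `^ p + G `^ q)).
    rewrite /rsum; under eq_bigr do rewrite !mulrDr; rewrite !big_split /=.
    congr (_ + _ + _); first by rewrite mulr_sumr; apply: eq_bigr => P _; ring.
    by rewrite -!mulr_suml /mass; ring.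
  have -> : rsum w F (fun P => `|local_op Om' f P| * g P) =
      rsum w Om' (fun P => `|local_op Om' f P| * g P).
    rewrite (rsum_setID _ F Om') (finset.setIidPr Om'F) [X in _ + X](_ : _ = 0) ?addr0//.
    rewrite /rsum big1// => P; rewrite inE => /andP[POm' _].
    by rewrite local_op0// normr0 mul0r mulr0.
  rewrite -(mass_rmean w_ge0) -/G.
  have young : A * G <= A `^ p + G `^ q.
    have p0 : 0 < p by exact: lt_trans p1.
    have q0 : 0 < q by exact: lt_trans q1.
    apply: (le_trans (conjugate_powR A0 G0 p0 q0 pq)); apply: lerD.
      by rewrite ler_pdivrMr// ler_peMr ?powR_ge0// ltW.
    by rewrite ler_pdivrMr// ler_peMr ?powR_ge0// ltW.
  set X := rsum w Om' _; set e := A `^ p + G `^ q in young *.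
  rewrite (_ : 2 * C * _ + X = C * mass w F * e + X + C * (mass w F * e)); last by ring.
  rewrite !lerD2r (_ : C * A * _ = C * mass w F * (A * G)); last by ring.
  by rewrite ler_wpM2l// mulr_ge0// ltW.
apply: (le_trans lhs).
have mp := mean_stopping p1 eta0 eta_p phi0 Om'F wOm'.
have mq := mean_stopping q1 eta0 eta_q g0 Om'F wOm'.
have pe : 2 `^ p * rsum w (F :\: Om') (fun P => phi P `^ p)
    + 2 `^ q * rsum w (F :\: Om') (fun P => g P `^ q) <=
    rsum w (F :\: Om') (fun P => K * energy P).
  rewrite /rsum !mulr_sumr -big_split /=; apply: ler_sum => P _.
  have := w_ge0 P; have := powR_ge0 (phi P) p; have := powR_ge0 (g P) q.
  rewrite /K /energy; have := powR_ge0 (2 : R) p; have := powR_ge0 (2 : R) q.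
  set u := phi P `^ p; set v := g P `^ q; set s := 2 `^ p; set t := 2 `^ q.
  move=> t0 s0 v0 u0 wP0.
  rewrite -subr_ge0 (_ : _ - _ = w P * (t * u) + w P * (s * v)); last by ring.
  by rewrite addr_ge0// mulr_ge0// mulr_ge0.
have te : rsum w Om' (fun P => rmean w (maxcube D Om' P) phi `^ p)
    + rsum w Om' (fun P => rmean w (maxcube D Om' P) g `^ q) =
    rsum w Om' (top_energy Om').
  by rewrite /rsum -big_split /=; apply: eq_bigr => P _; rewrite -mulrDr.
have : 2 * C * (mass w F * (A `^ p + G `^ q)) <=
    C * (rsum w (F :\: Om') (fun P => K * energy P) + rsum w Om' (top_energy Om')).
  rewrite (_ : 2 * C * _ = C * (2 * (mass w F * A `^ p) + 2 * (mass w F * G `^ q))).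
    apply: ler_wpM2l => //; apply: (le_trans (lerD mp mq)).
    by rewrite -te addrACA lerD2r.
  by ring.
have -> : rsum w F (fun P => C * K * energy P) =
    C * rsum w (F :\: Om') (fun P => K * energy P) + rsum w Om' (fun P => C * K * energy P).
  rewrite (rsum_setID _ F Om') (finset.setIidPr Om'F) addrC; congr +%R.
  by rewrite /rsum mulr_sumr; apply: eq_bigr => P _; ring.
move: IH; rewrite [in X in X -> _]/rsum.
under eq_bigr do rewrite mulrDr; rewrite big_split /= -/(rsum w Om' _).
have -> : \sum_(P in Om') w P * (C * top_energy Om' P) = C * rsum w Om' (top_energy Om').
  by rewrite /rsum mulr_sumr; apply: eq_bigr => P _; ring.
rewrite -/(rsum w Om' (fun P => C * K * energy P)) => h1 h2.
apply: (le_trans (lerD h2 (lexx _))).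
by rewrite mulrDr -addrA lerD2l addrC.
Qed.

End duality.

(** The fraction for which [mean_stopping] applies to both exponents. *)
Definition stop_ratio (p q : R) : R :=
  Num.min (2^-1) (Num.min ((2 `^ p) `^ (- (p - 1)^-1)) ((2 `^ q) `^ (- (q - 1)^-1))).

Lemma stop_ratioP (p q : R) : 1 < p -> 1 < q ->
  [/\ 0 < stop_ratio p q, stop_ratio p q < 1,
    2 `^ p * stop_ratio p q `^ (p - 1) <= 1 & 2 `^ q * stop_ratio p q `^ (q - 1) <= 1].
Proof.
move=> p1 q1; set e := stop_ratio p q.
have e0 : 0 < e.
  rewrite /e /stop_ratio 2!lt_min; apply/and3P; split; first by rewrite invr_gt0 ltr0n.
    by apply: powR_gt0; apply: powR_gt0; rewrite ltr0n.
  by apply: powR_gt0; apply: powR_gt0; rewrite ltr0n.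
have aux (r : R) : 1 < r -> e <= (2 `^ r) `^ (- (r - 1)^-1) -> 2 `^ r * e `^ (r - 1) <= 1.
  move=> r1 er.
  have r2 : 0 < r - 1 by lra.
  have : e `^ (r - 1) <= ((2 `^ r) `^ (- (r - 1)^-1)) `^ (r - 1).
    by rewrite ge0_ler_powR ?nnegrE ?powR_ge0// ltW.
  rewrite -powRrM mulNr mulVf ?gt_eqF// powR_inv1 ?powR_ge0// => h.
  by rewrite mulrC -ler_pdivlMr ?powR_gt0// div1r.
split=> //.
- by rewrite /e /stop_ratio gt_min invf_lt1 ?ltr0n// ltr1n.
- by apply: aux; [exact: p1|rewrite /e /stop_ratio 2!ge_min lexx orbT].
- by apply: aux; [exact: q1|rewrite /e /stop_ratio 2!ge_min lexx !orbT].
Qed.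

(** Sparse stopping bounds the operator: test [duality_bound] on a small multiple
    of the function [|T f| ^ (p - 1)] and absorb. *)
Lemma sparse_stopping_bound (p q C M : R) f : M = C * (2 `^ p + 2 `^ q) -> 1 < p -> 1 < q -> p^-1 + q^-1 = 1 ->
  0 < C -> sparse_stopping (stop_ratio p q) C f ->
  rsum w [set: L]%SET (fun P => `|local_op [set: L]%SET f P| `^ p) <=
  2 * M * (2 * M) `^ (p - 1) * rsum w [set: L]%SET (fun P => `|f P| `^ p).
Proof.
move=> MC p1 q1 pq C0 stop.
have [e0 e1 ep eq] := stop_ratioP p1 q1.
have M0 : 0 < M by rewrite MC mulr_gt0// addr_gt0// powR_gt0.
pose T P := `|local_op [set: L]%SET f P|.
pose s := (2 * M)^-1.
have s0 : 0 < s by rewrite invr_gt0 mulr_gt0.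
pose g P := (s * T P) `^ (p - 1).
have g0 P : 0 <= g P by exact: powR_ge0.
have T0 P : 0 <= T P by exact: normr_ge0.
have p0 : 0 < p by lra.
have q0 : 0 < q by lra.
have pq' : (p - 1) * q = p.
  have h : p + q = p * q.
    have : (p^-1 + q^-1) * (p * q) = p * q by rewrite pq mul1r.
    by rewrite mulrDl mulrA mulVf ?gt_eqF// mul1r mulrCA mulVf ?gt_eqF// mulr1 addrC.
  by rewrite mulrBl mul1r -h addrK.
have := @duality_bound p q _ C f g p1 q1 pq e0 e1 (ltW C0) ep eq g0 stop [set: L]%SET.
set lhs := rsum _ _ _ => h.
have lo : s `^ (p - 1) * rsum w [set: L]%SET (fun P => T P `^ p) <= lhs.
  rewrite /rsum mulr_sumr /lhs; apply: ler_sum => P _.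
  rewrite mulrCA ler_wpM2l// /g powRM ?(ltW s0)// mulrCA mulr_powRB1 ?(T0 P)//.
  by rewrite -/(T P) lerDl mulr_ge0 ?(ltW C0)// addr_ge0 ?powR_ge0.
have hi : rsum w [set: L]%SET (fun P => C * (2 `^ p + 2 `^ q) * (`|f P| `^ p + g P `^ q)) =
    M * rsum w [set: L]%SET (fun P => `|f P| `^ p)
    + M * s `^ p * rsum w [set: L]%SET (fun P => T P `^ p).
  rewrite /rsum !mulr_sumr -big_split /=; apply: eq_bigr => P _.
  by rewrite /g -powRrM pq' powRM ?(ltW s0)// MC; ring.
have := le_trans lo h; rewrite hi.
set X := rsum w _ (fun P => T P `^ p); set Y := rsum w _ _ => {lo hi h lhs} h.
have sp : M * s `^ p = s `^ (p - 1) / 2.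
  by rewrite -(@mulr_powRB1 _ s p) ?(ltW s0)// /s; field; rewrite gt_eqF.
rewrite sp in h.
have {}h : s `^ (p - 1) * X <= 2 * M * Y by lra.
rewrite /s -powR_inv1 ?mulr_ge0 ?(ltW M0)// -powRrM mulN1r powRN in h.
by rewrite ler_pdivrMl ?powR_gt0 ?mulr_gt0// mulrA (mulrC (_ `^ _)) in h.
Qed.

End sparse_bounds.

(** * Lattice suprema of finite families *)
Section big_join.
Variables (R : realType) (E : banachLatticeType R) (I : Type).
Implicit Types (r : seq I) (P : pred I) (F : I -> E) (x u : E).

Lemma bigjoin_lub r P F x u : x <= u -> (forall i, P i -> F i <= u) ->
  \big[Order.join/x]_(i <- r | P i) F i <= u.
Proof.
move=> xu Fu; apply: (big_ind (fun y : E => y <= u)) => // y z yu zu.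
by rewrite leUx yu zu.
Qed.

Lemma bigjoin_ge_idx r P F x : x <= \big[Order.join/x]_(i <- r | P i) F i.
Proof.
elim: r => [|i r IHr]; first by rewrite big_nil.
by rewrite big_cons; case: (P i) => //; exact: (le_trans IHr (leUr _ _)).
Qed.

End big_join.

Lemma bigjoin_ub (R : realType) (E : banachLatticeType R) (I : eqType)
    (r : seq I) (P : pred I) (F : I -> E) x i : i \in r -> P i ->
  F i <= \big[Order.join/x]_(i <- r | P i) F i.
Proof.
elim: r => [//|j r IHr]; rewrite inE big_cons => /orP[/eqP <- ->|ir Pi].
  exact: leUl.
by case: (P j); rewrite ?IHr//; exact: (le_trans (IHr ir Pi) (leUr _ _)).
Qed.

(** * Powers of sums with a packing condition *)
Section carleson.
Variables (R : realType) (L : finType) (w : L -> R).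
Hypothesis w_ge0 : forall P, 0 <= w P.
Variable alpha : {set L} -> R.
Hypothesis alpha_ge0 : forall S, 0 <= alpha S.

Lemma exprD_le (a x : R) n : 0 <= a -> 0 <= x ->
  (a + x) ^+ n.+1 <= n.+1%:R * (a * (a + x) ^+ n) + x ^+ n.+1.
Proof.
move=> a0 x0; elim: n => [|n IHn]; first by rewrite expr0 !expr1; lra.
have ax0 : 0 <= a + x by exact: addr_ge0.
rewrite exprS; apply: (le_trans (ler_wpM2l ax0 IHn)).
have xax : x ^+ n.+1 <= (a + x) ^+ n.+1 by rewrite lerXn2r ?nnegrE// lerDr.
have -> : n.+2%:R = n.+1%:R + 1 :> R by rewrite -[n.+2]addn1 natrD.
rewrite -subr_ge0 (_ : _ - _ = a * ((a + x) ^+ n.+1 - x ^+ n.+1)).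
  by rewrite mulr_ge0// subr_ge0.
by rewrite !exprS; ring.
Qed.

Lemma exprD_le2 (a b : R) n : 0 <= a -> 0 <= b ->
  (a + b) ^+ n <= 2 ^+ n * (a ^+ n + b ^+ n).
Proof.
wlog ab : a b / a <= b => [h a0 b0|a0 b0].
  by have [/h->//|/ltW/h] := leP a b; rewrite (addrC b) (addrC (b ^+ n)); exact.
apply: (@le_trans _ _ (2 ^+ n * b ^+ n)).
  by rewrite -exprMn lerXn2r ?nnegrE ?addr_ge0 ?mulr_ge0// mulr_natl mulr2n lerD2r.
by rewrite ler_wpM2l ?exprn_ge0// lerDr exprn_ge0.
Qed.

(** Expanding the power and grouping the products by their largest member, which
    the remaining factors are then below. *)
Lemma chain_power (C : {set {set L}}) n :
  (forall A B, A \in C -> B \in C -> (A \subset B) || (B \subset A)) ->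
  (\sum_(S in C) alpha S) ^+ n.+1 <=
  n.+1%:R * \sum_(S in C) alpha S * (\sum_(S' in C | S' \subset S) alpha S') ^+ n.
Proof.
move: {2}#|C| (erefl #|C|) => m; elim: m C => [|m IHm] C.
  by move=> /cards0_eq ->; rewrite !big_set0 expr0n mulr0.
move=> cC chain.
have /card_gt0P[M0 M0C] : (0 < #|C|)%N by rewrite cC.
case: (arg_maxnP (fun S : {set L} => #|S|) M0C) => M; rewrite -/(M \in C) => MC maxM.
have subM S : S \in C -> S \subset M.
  move=> SC; have /orP[//|MS] := chain _ _ SC MC.
  by have /eqP -> : M == S by rewrite finset.eqEcard MS /=; exact: maxM.
rewrite (big_setD1 M MC) /= [in leRHS](big_setD1 M MC) /=.
have -> : \sum_(S' in C | S' \subset M) alpha S' = alpha M + \sum_(S in C :\ M) alpha S.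
  rewrite -(big_setD1 M MC) /=; apply: eq_bigl => S.
  by case SC : (S \in C) => //=; rewrite subM.
have X0 : 0 <= \sum_(S in C :\ M) alpha S by exact: sumr_ge0.
apply: (le_trans (exprD_le n (alpha_ge0 M) X0)).
rewrite mulrDr lerD2l; have cC' : #|C :\ M| = m.
  by apply/eqP; rewrite -eqSS -cC (cardsD1 M C) MC.
apply: (le_trans (IHm _ cC' _)) => [A B|].
  by rewrite !inE => /andP[_ AC] /andP[_ BC]; exact: chain.
rewrite ler_wpM2l// ler_sum// => S _; rewrite ler_wpM2l//.
rewrite lerXn2r ?nnegrE ?sumr_ge0// [leRHS](bigID (mem (C :\ M))) /=.
rewrite -[leLHS]addr0 lerD ?sumr_ge0// le_eqVlt; apply/orP; left; apply/eqP.
by apply: eq_bigl => S'; rewrite !inE; case: (S' != M) (S' \in C) => -[]//=; rewrite ?andbF ?andbT.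
Qed.

Variable G : {set {set L}}.
Hypothesis G_laminar : laminar G.
Variable c : R.
Hypothesis c_ge0 : 0 <= c.
Hypothesis packing : forall S, S \in G ->
  \sum_(S' in G | S' \subset S) alpha S' * mass w S' <= c * mass w S.

Definition tail (S : {set L}) (P : L) : R :=
  \sum_(S' in G | (P \in S') && (S' \subset S)) alpha S'.

(** A packing bound on every cube self-improves to all powers, as in the inequality
    of John and Nirenberg: [chain_power] splits off one factor [alpha S], and what
    remains is the same sum localized to [S], one power lower. *)
Lemma carleson_power n S : S \in G ->
  rsum w S (fun P => tail S P ^+ n) <= n`!%:R * c ^+ n * mass w S.
Proof.
elim: n S => [|n IHn] S SG.
  by rewrite fact0 expr0 !mul1r /rsum; under eq_bigr do rewrite expr0 mulr1.
have tail0 S' P : 0 <= tail S' P by exact: sumr_ge0.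
have step P : P \in S -> tail S P ^+ n.+1 <=
    n.+1%:R * \sum_(S' in G | (P \in S') && (S' \subset S)) alpha S' * tail S' P ^+ n.
  move=> PS; pose C := [set S' in G | (P \in S') && (S' \subset S)]%SET.
  have CE a : \sum_(S' in G | (P \in S') && (S' \subset S)) a S' = \sum_(S' in C) a S' :> R.
    by apply: eq_bigl => S'; rewrite inE.
  rewrite /tail !CE; apply: (le_trans (chain_power n _)) => [A B|].
    rewrite !inE => /and3P[AG PA _] /and3P[BG PB _].
    have := laminar_mem G_laminar AG BG PA PB => h; exact h.
  rewrite ler_wpM2l// ler_sum// => S' /[!inE] /and3P[S'G PS' S'S]; rewrite ler_wpM2l//.
  rewrite le_eqVlt; apply/orP; left; apply/eqP; congr (_ ^+ _).
  apply: eq_bigl => S''; rewrite inE -!andbA; case: (S'' \in G) (P \in S'') => -[]//=.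
  by case S''S' : (S'' \subset S'); rewrite ?andbF// (fintype.subset_trans S''S').
apply: (le_trans (rsum_le w_ge0 step)).
have -> : rsum w S (fun P => n.+1%:R * \sum_(S' in G | (P \in S') && (S' \subset S))
      alpha S' * tail S' P ^+ n) =
    n.+1%:R * \sum_(S' in G | S' \subset S) alpha S' * rsum w S' (fun P => tail S' P ^+ n).
  rewrite /rsum; under eq_bigr do rewrite mulrCA; rewrite -mulr_sumr; congr (_ * _).
  under eq_bigr do rewrite mulr_sumr.
  rewrite (exchange_big_dep (fun S' => (S' \in G) && (S' \subset S))) /=; last first.
    by move=> P S' _ /and3P[-> _ ->].
  apply: eq_bigr => S' /andP[S'G S'S]; rewrite mulr_sumr.
  have -> : \sum_(P in S') alpha S' * (w P * tail S' P ^+ n) =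
      \sum_(P in S') w P * (alpha S' * tail S' P ^+ n).
    by apply: eq_bigr => P _; rewrite mulrCA.
  apply: eq_bigl => P; rewrite S'G S'S /= andbT.
  by case PS' : (P \in S'); rewrite ?andbF ?andbT// (fintype.subsetP S'S).
apply: (@le_trans _ _ (n.+1%:R * \sum_(S' in G | S' \subset S)
    n`!%:R * c ^+ n * (alpha S' * mass w S'))).
  rewrite ler_wpM2l// ler_sum// => S' /andP[S'G _].
  by rewrite mulrCA ler_wpM2l// IHn.
rewrite -mulr_sumr factS natrM exprSr !mulrA -!mulrA.
rewrite ler_wpM2l// ler_wpM2l// ler_wpM2l ?exprn_ge0//.
exact: packing.
Qed.

End carleson.

(** * Stopping sets from testing *)
Section stopping.
Variables (R : realType) (E : banachLatticeType R) (L : finType) (w : L -> R).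
Hypothesis w_ge0 : forall P, 0 <= w P.
Variables (D : {set {set L}}) (Lam : {set L} -> {linear E -> E}).
Hypothesis D_laminar : laminar D.
Hypothesis D_singletons : forall P, [set P]%SET \in D.
Hypothesis Lam_pos : forall Q, positive_operator (Lam Q).
Implicit Types (A F Q S Om : {set L}) (P : L) (f h : L -> E).

Notation good_op := (good_op w D Lam).
Notation local_op := (local_op w D Lam).

Lemma mass_setU A B : mass w (A :|: B) <= mass w A + mass w B.
Proof.
rewrite {1}/mass (big_setID A) /= finset.setUK lerD2l; apply: mass_le => //.
by rewrite finset.setDUl finset.setDv finset.set0U finset.subsetDl.
Qed.

Lemma wsum_ge0 A f : (forall P, P \in A -> 0 <= f P) -> 0 <= wsum w A f.
Proof. by move=> f0; apply: bl_sum_ge0 => P PA; rewrite bl_ge0Z ?f0. Qed.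

Lemma wmean_ge0 A f : (forall P, P \in A -> 0 <= f P) -> 0 <= wmean w A f.
Proof. by move=> f0; rewrite bl_ge0Z ?invr_ge0 ?mass_ge0 ?wsum_ge0. Qed.

Lemma norm_wsum A f : `|wsum w A f| <= rsum w A (fun P => `|f P|).
Proof.
apply: (le_trans (ler_norm_sum _ _ _)); apply: ler_sum => P _.
by rewrite normrZ ger0_norm.
Qed.

Lemma norm_wmean A f : `|wmean w A f| <= rmean w A (fun P => `|f P|).
Proof.
rewrite normrZ ger0_norm ?invr_ge0 ?mass_ge0// ler_wpM2l ?invr_ge0 ?mass_ge0//.
exact: norm_wsum.
Qed.

(** On the cubes not inside [Om], [h] stands in for [f]. The last bound is what
    testing gives for [h]. *)
Definition testing_majorant (eta C : R) f := forall F, F \in D ->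
  exists Om h, [/\ Om \subset F, mass w Om <= eta * mass w F, forall P, 0 <= h P,
    forall Q, Q \in D -> Q \subset F -> ~~ (Q \subset Om) -> wsum w Q f <= wsum w Q h &
    rsum w F (fun P => `|local_op F h P|) <= C * rmean w F (fun P => `|f P|) * mass w F].

Lemma good_op_ge0 F Om f P : (forall P, 0 <= f P) -> 0 <= good_op F Om f P.
Proof. by move=> f0; apply: bl_sum_ge0 => Q _; apply: Lam_pos; exact: wsum_ge0. Qed.

(** Chebyshev's inequality turns the integral bound on the good part into a
    pointwise bound outside a small set, which is then declared exceptional too. *)
Lemma testing_majorant_sparse (eta C : R) f : 0 < eta -> 0 <= C ->
  (forall P, 0 <= f P) -> testing_majorant eta C f ->
  sparse_stopping w D Lam (eta + eta) (C / eta) f.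
Proof.
move=> eta0 C0 f0 maj F FD; have [Om [h [OmF wOm h0 fh hT]]] := maj F FD.
set A := rmean w F _ in hT *.
have A0 : 0 <= A by exact: rmean_ge0.
pose Om2 := [set P in F | C / eta * A < `|good_op F Om f P|]%SET.
have Om2F : Om2 \subset F by apply/fintype.subsetP => P; rewrite inE => /andP[].
have gT P : `|good_op F Om f P| <= `|local_op F h P|.
  apply: bl_norm_le; first exact: good_op_ge0.
  apply: (@le_trans _ _ (good_op F Om h P)).
    apply: bl_ler_sum => Q /and4P[QD _ QF QOm].
    by apply: positive_le => //; exact: fh.
  apply: bl_sum_subset => [Q _|Q /and4P[-> -> -> _]//].
  by apply: Lam_pos; exact: wsum_ge0.
have wOm2 : mass w Om2 <= eta * mass w F.
  rewrite /Om2 (mulrAC C); apply: chebyshev => //; first exact: mulr_ge0.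
  by apply: le_trans hT; apply: rsum_le => // P _; exact: gT.
exists (Om :|: Om2); split.
- by rewrite finset.subUset OmF.
- rewrite mulrDl; apply: le_trans (lerD wOm wOm2).
  exact: mass_setU.
move=> P PF; have [FOm|FOm] := boolP (F \subset Om :|: Om2).
  rewrite [good_op _ _ _ _]big1; first by rewrite normr0 mulr_ge0// divr_ge0// ltW.
  by move=> Q /and4P[_ _ QF]; rewrite (fintype.subset_trans QF FOm).
have [P' P'F chain] := good_chain D_laminar FD PF FOm.
move: P'F; rewrite !inE negb_or -andbA => /and3P[P'Om P'Om2 P'F].
rewrite P'F /= -leNgt in P'Om2; apply: le_trans P'Om2.
apply: bl_norm_le; first exact: good_op_ge0.
apply: bl_sum_subset => [Q _|Q /and4P[QD PQ QF QOm]].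
  by apply: Lam_pos; exact: wsum_ge0.
rewrite QD QF chain//=; apply: contra QOm => /fintype.subset_trans; apply.
exact: finset.subsetUl.
Qed.

Section heavy_cubes.
Variables (f : L -> E) (kappa : R) (F : {set L}).
Hypotheses (f_ge0 : forall P, 0 <= f P) (kappa1 : 1 < kappa) (FD : F \in D).

Let phi P := `|f P|.
Let A := rmean w F phi.

Definition heavy := [set Q in D | (Q \subset F) && (kappa * A < rmean w Q phi)]%SET.

Definition heavy_union : {set L} := finset.cover heavy.

Let phi0 P : 0 <= phi P. Proof. exact: normr_ge0. Qed.
Let A0 : 0 <= A. Proof. exact: rmean_ge0. Qed.
Let kA0 : 0 <= kappa * A. Proof. by rewrite mulr_ge0// (le_trans ler01)// ltW. Qed.

Lemma heavy_union_sub : heavy_union \subset F.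
Proof. by apply/finset.bigcupsP => Q; rewrite inE => /and3P[]. Qed.

(** The maximal heavy cubes are disjoint and each carries more than its share of the
    integral of [f]. Maximality refers to the family of heavy cubes and singletons,
    as a maximal cube of [D] inside the union need not be heavy. *)
Lemma heavy_union_mass : mass w heavy_union <= kappa^-1 * mass w F.
Proof.
have k0 : 0 < kappa by exact: lt_trans kappa1.
have Hrsum Q : Q \in heavy -> kappa * A * mass w Q <= rsum w Q phi.
  rewrite inE => /and3P[_ _ kQ]; rewrite -mass_rmean// mulrC.
  by rewrite ler_wpM2l ?mass_ge0// ltW.
have [A_eq0|A_neq0] := eqVneq A 0.
  rewrite [heavy_union](_ : _ = finset.set0).
    by rewrite /mass big_set0 mulr_ge0 ?mass_ge0 ?invr_ge0 ?(ltW k0).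
  rewrite /heavy_union /finset.cover big1// => Q; rewrite inE => /and3P[_ QF].
  rewrite A_eq0 mulr0 => /lt_geF; rewrite (_ : rmean w Q phi = 0) ?lexx//.
  apply/eqP; rewrite eq_le rmean_ge0// andbT /rmean.
  rewrite [X in _ * X](_ : _ = 0) ?mulr0//; apply/eqP.
  rewrite eq_le rsum_ge0// andbT (le_trans (rsum_subset w_ge0 QF _))//.
  by rewrite -mass_rmean// -/A A_eq0 mulr0.
have Agt0 : 0 < A by rewrite lt_def A_neq0.
pose D' := heavy :|: [set [set P] | P : L]%SET.
have D'D Q : Q \in D' -> Q \in D.
  by rewrite inE => /orP[|/finset.imsetP[P _ ->//]]; rewrite inE => /andP[].
have D'_laminar : laminar D' by move=> Q Q' /D'D QD /D'D; exact: D_laminar.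
have D'_singletons P : [set P]%SET \in D'.
  by rewrite inE; apply/orP; right; apply/finset.imsetP; exists P.
have : kappa * A * mass w heavy_union <= A * mass w F.
  rewrite (mulrC A) mass_rmean//; apply: le_trans (rsum_subset w_ge0 heavy_union_sub _) => //.
  rewrite (_ : _ * mass w _ = rsum w heavy_union (fun=> kappa * A)); last first.
    by rewrite /rsum -mulr_suml mulrC.
  apply: (rsum_maxcube_mono D'_laminar) => // S SD' SOm [P POm PS].
  have [Q Qh PQ] := finset.bigcupP POm.
  have QOm : Q \subset heavy_union by exact: finset.bigcup_sup.
  have QD' : Q \in D' by rewrite inE Qh.
  have [_ PS' _ maxS] := maxcubeP D'_laminar D'_singletons POm.
  rewrite PS in PS' maxS; have QS := maxS Q QD' PQ QOm.
  have Sh : S \in heavy.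
    move: SD'; rewrite inE => /orP[//|/finset.imsetP[P1 _ SP1]].
    suff -> : S = Q by [].
    apply/eqP; rewrite finset.eqEsubset QS andbT SP1 finset.sub1set.
    by move: PS'; rewrite SP1 inE => /eqP <-.
  by rewrite /rsum -mulr_suml mulrC; exact: Hrsum.
by rewrite (mulrC kappa) -mulrA ler_pM2l// ler_pdivlMl.
Qed.

Lemma light_mean Q : Q \in D -> Q \subset F -> ~~ (Q \subset heavy_union) ->
  rmean w Q phi <= kappa * A.
Proof.
move=> QD QF; apply: contraNT; rewrite -ltNge => kQ.
by apply: finset.bigcup_sup; rewrite inE QD QF.
Qed.

Lemma light_point P : P \in F -> P \notin heavy_union -> w P != 0 ->
  phi P <= kappa * A.
Proof.
move=> PF PH wP; have := @light_mean [set P]%SET (D_singletons P).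
rewrite !finset.sub1set => /(_ PF PH).
by rewrite /rmean /mass /rsum !big_set1 mulrA mulVf// mul1r.
Qed.

(** The heavy cubes are too small to cover [F]. If [F] has mass zero all means are
    zero, being divided by zero, and there are no heavy cubes. *)
Lemma top_light P : P \in F -> ~~ (F \subset heavy_union).
Proof.
move=> PF; apply/negP => FH.
have k0 : 0 < kappa by exact: lt_trans kappa1.
have [F0|F0] := eqVneq (mass w F) 0.
  have /finset.bigcupP[Q] := fintype.subsetP FH _ PF; rewrite inE => /and3P[_ QF].
  have Q0 : mass w Q = 0.
    by apply/eqP; rewrite eq_le mass_ge0// andbT -F0 mass_le.
  by rewrite /A /rmean Q0 F0 invr0 !mul0r mulr0 ltxx.
have := le_trans (mass_le w_ge0 FH) heavy_union_mass.
rewrite leNgt => /negP; apply; rewrite -[ltRHS]mul1r ltr_pM2r ?invf_lt1//.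
by rewrite lt_def F0 mass_ge0.
Qed.

Definition light := [set Q in D | (Q \subset F) && ~~ (Q \subset heavy_union)]%SET.

Definition light_hull P : {set L} := [arg min_(Q < F | (Q \in light) && (P \in Q)) #|Q|]%N.

Lemma light_hullP P : P \in F -> [/\ light_hull P \in light, P \in light_hull P &
  forall Q, Q \in light -> P \in Q -> light_hull P \subset Q].
Proof.
move=> PF; rewrite /light_hull; case: arg_minnP => [|M /andP[Ml PM] minM].
  by rewrite inE FD subxx PF (top_light PF).
split=> // Q Ql PQ; have MD : M \in D by move: Ml; rewrite inE => /and3P[].
have QD : Q \in D by move: Ql; rewrite inE => /and3P[].
have /orP[//|QM] := laminar_mem D_laminar MD QD PM PQ.
have := minM Q; rewrite Ql PQ => /(_ isT) cMQ.
by have /eqP -> : Q == M by rewrite finset.eqEcard QM.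
Qed.

(** The mass of [f] on the heavy cubes, pushed up to their light parents. On a
    non-doubling measure the parents' means are the only ones under control. *)
Definition parent_mean S : E :=
  (mass w S)^-1 *: \sum_(P in heavy_union | light_hull P == S) w P *: f P.

Definition light_majorant P : E :=
  (if P \in heavy_union then 0 else f P) + \sum_(S in light | P \in S) parent_mean S.

Lemma parent_mean_ge0 S : 0 <= parent_mean S.
Proof.
rewrite bl_ge0Z ?invr_ge0 ?mass_ge0//; apply: bl_sum_ge0 => P _.
by rewrite bl_ge0Z.
Qed.

Lemma light_majorant_ge0 P : 0 <= light_majorant P.
Proof.
rewrite -(addr0 0); apply: bl_leD; first by case: ifP.
by apply: bl_sum_ge0 => S _; exact: parent_mean_ge0.
Qed.

Lemma mass_parent_mean S : S \in light ->
  mass w S *: parent_mean S = \sum_(P in heavy_union | light_hull P == S) w P *: f P.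
Proof.
move=> Sl; have [S0|S0] := eqVneq (mass w S) 0; last first.
  by rewrite scalerA mulfV// scale1r.
rewrite S0 scale0r big1// => P /andP[PH /eqP PS].
have [_ PP _] := light_hullP (fintype.subsetP heavy_union_sub _ PH).
by rewrite (mass0 w_ge0 S0) ?scale0r// -PS.
Qed.

(** A light cube contains the light hulls of all its points, so the mass that is
    moved up stays inside it. *)
Lemma light_majorantP Q : Q \in light -> wsum w Q f <= wsum w Q light_majorant.
Proof.
move=> Ql; rewrite /wsum; under [leRHS]eq_bigr do rewrite scalerDr.
rewrite big_split /= (big_setID heavy_union) /= [leLHS]addrC; apply: bl_leD.
  rewrite [leRHS](big_setID heavy_union) /= [X in _ <= X + _]big1 ?add0r.
    by apply: bl_ler_sum => P; rewrite inE => /andP[/negbTE ->].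
  by move=> P; rewrite inE => /andP[_ ->]; rewrite scaler0.
have QF : Q \subset F by move: Ql; rewrite inE => /and3P[].
apply: (@le_trans _ _ (\sum_(S in light | S \subset Q) mass w S *: parent_mean S)).
  rewrite (eq_bigr (fun S => \sum_(P in heavy_union | light_hull P == S) w P *: f P)); last first.
    by move=> S /andP[Sl _]; exact: mass_parent_mean.
  rewrite (exchange_big_dep (mem heavy_union)) /=; last by move=> S P _ /andP[].
  rewrite [leRHS](bigID (mem Q)) /= -[leLHS]addr0; apply: bl_leD; last first.
    by apply: bl_sum_ge0 => P _; apply: bl_sum_ge0 => S _; rewrite bl_ge0Z.
  rewrite (eq_bigl (fun P => (P \in heavy_union) && (P \in Q))); last first.
    by move=> P; rewrite inE andbC.
  apply: bl_ler_sum => P /andP[PH PQ].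
  have [hl Ph hmin] := light_hullP (fintype.subsetP QF _ PQ).
  rewrite (bigD1 (light_hull P)) /=; last by rewrite hl hmin// PH eqxx.
  rewrite -[leLHS]addr0; apply: bl_leD => //.
  by apply: bl_sum_ge0 => S _; rewrite bl_ge0Z.
under [leRHS]eq_bigr do rewrite scaler_sumr.
rewrite (exchange_big_dep (mem light)) /=; last by move=> P S _ /andP[].
rewrite [leRHS](bigID (fun S : {set L} => S \subset Q)) /= -[leLHS]addr0; apply: bl_leD; last first.
  by apply: bl_sum_ge0 => S _; apply: bl_sum_ge0 => P _; rewrite bl_ge0Z ?parent_mean_ge0.
apply: bl_ler_sum => S /andP[Sl SQ]; rewrite /mass scaler_suml.
rewrite le_eqVlt; apply/orP; left; apply/eqP; apply: eq_bigl => P.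
by rewrite Sl /=; case PS : (P \in S); rewrite ?andbF// (fintype.subsetP SQ).
Qed.

Lemma light_laminar : laminar light.
Proof.
move=> Q Q'; rewrite 2!inE => /andP[QD _] /andP[Q'D _]; exact: D_laminar.
Qed.

Let alpha S := `|parent_mean S|.

(** Each point gives its mass to one cube only, and the mass received inside a light
    cube [S] comes from [S], where the mean of [f] is controlled. *)
Lemma parent_mean_packing S : S \in light ->
  \sum_(S' in light | S' \subset S) alpha S' * mass w S' <= kappa * A * mass w S.
Proof.
move=> Sl; have /and3P[SD SF SH] : [&& S \in D, S \subset F & ~~ (S \subset heavy_union)].
  by move: Sl; rewrite inE.
apply: (@le_trans _ _ (\sum_(S' in light | S' \subset S)
    \sum_(P in heavy_union | light_hull P == S') w P * phi P)).
  apply: ler_sum => S' /andP[S'l _].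
  have -> : alpha S' * mass w S' = `|mass w S' *: parent_mean S'|.
    by rewrite normrZ ger0_norm ?mass_ge0// mulrC.
  rewrite mass_parent_mean//; apply: (le_trans (ler_norm_sum _ _ _)).
  by apply: ler_sum => P _; rewrite normrZ ger0_norm.
have -> : \sum_(S' in light | S' \subset S)
    \sum_(P in heavy_union | light_hull P == S') w P * phi P =
    \sum_(P in heavy_union | (light_hull P \in light) && (light_hull P \subset S)) w P * phi P.
  rewrite (exchange_big_dep (fun P => (P \in heavy_union) &&
    ((light_hull P \in light) && (light_hull P \subset S)))) /=; last first.
    by move=> S' P /andP[S'l S'S] /andP[-> /eqP ->]; rewrite S'l S'S.
  apply: eq_bigr => P /and3P[PH hl hS]; rewrite (big_pred1 (light_hull P))// => S'.
  rewrite /= PH /= eq_sym; by case: eqP => [->|]; rewrite ?andbF// hl hS.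
apply: (@le_trans _ _ (rsum w S phi)).
  rewrite /rsum [leRHS](bigID (fun P => [&& P \in heavy_union, light_hull P \in light
    & light_hull P \subset S])) /= -[leLHS]addr0 lerD ?sumr_ge0//; last first.
    by move=> P _; rewrite mulr_ge0.
  rewrite le_eqVlt; apply/orP; left; apply/eqP; apply: eq_bigl => P.
  case H : [&& _, _ & _]; rewrite ?andbF// andbT.
  move: H => /and3P[PH hl hS]; symmetry.
  have [_ PP _] := light_hullP (fintype.subsetP heavy_union_sub _ PH).
  by apply/idP; exact: (fintype.subsetP hS).
by rewrite -mass_rmean// mulrC ler_wpM2r ?mass_ge0// light_mean.
Qed.

(** An upper bound for the [n]-th root of the constant [2 ^ n (1 + n!)] that the
    proof below produces. *)
Definition power_const n : R := 2 * (1 + n`!%:R).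

(** The light majorant is bounded up to a sum with the packing property, hence lies
    in every [L^n] with norm controlled by the mean of [f]. *)
Lemma light_majorant_power n : (0 < n)%N ->
  rsum w F (fun P => `|light_majorant P| ^+ n) <=
  (power_const n * kappa * A) ^+ n * mass w F.
Proof.
move=> n0; have [F0|/set0Pn[P0 P0F]] := eqVneq F finset.set0.
  by rewrite {1}F0 /rsum big_set0 mulr_ge0 ?mass_ge0// exprn_ge0// -mulrA mulr_ge0// mulr_ge0// addr_ge0.
have Fl : F \in light by rewrite inE FD subxx (top_light P0F).
have alpha0 S : 0 <= alpha S by exact: normr_ge0.
have tail0 P : 0 <= tail alpha light F P by exact: sumr_ge0.
have pw P : P \in F -> w P * `|light_majorant P| ^+ n <=
    2 ^+ n * (kappa * A) ^+ n * w P + 2 ^+ n * (w P * tail alpha light F P ^+ n).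
  move=> PF; have [->|wP] := eqVneq (w P) 0; first by rewrite !mul0r !mulr0 addr0.
  have lm : `|light_majorant P| <= kappa * A + tail alpha light F P.
    apply: (le_trans (ler_normD _ _)); apply: lerD.
      by case: ifPn => PH; rewrite ?normr0//; exact: light_point.
    apply: (le_trans (ler_norm_sum _ _ _)).
    rewrite le_eqVlt; apply/orP; left; apply/eqP; apply: eq_bigl => S.
    by rewrite inE; case: (S \subset F); rewrite /= ?andbF ?andbT.
  rewrite (_ : _ + _ = w P * (2 ^+ n * (kappa * A) ^+ n + 2 ^+ n * tail alpha light F P ^+ n)); last by ring.
  rewrite ler_wpM2l//; apply: (@le_trans _ _ ((kappa * A + tail alpha light F P) ^+ n)).
    by rewrite lerXn2r ?nnegrE ?addr_ge0.
  by rewrite -mulrDr exprD_le2.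
apply: (le_trans (ler_sum _ pw)); rewrite big_split /= -!mulr_sumr -/(mass w F).
have := carleson_power w_ge0 alpha0 light_laminar kA0 parent_mean_packing n Fl.
rewrite -/(rsum w F _) => ct.
apply: (@le_trans _ _ (2 ^+ n * (kappa * A) ^+ n * mass w F
    + 2 ^+ n * (n`!%:R * (kappa * A) ^+ n * mass w F))).
  by rewrite lerD2l ler_wpM2l// exprn_ge0.
rewrite (_ : _ + _ = 2 ^+ n * (1 + n`!%:R) * ((kappa * A) ^+ n * mass w F)); last by ring.
rewrite -[_ * kappa * A]mulrA [(_ * (kappa * A)) ^+ n]exprMn -[leRHS]mulrA.
rewrite ler_wpM2r ?mulr_ge0 ?mass_ge0 ?exprn_ge0//.
rewrite exprMn ler_wpM2l ?exprn_ge0// -[leLHS]expr1 ler_weXn2l//.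
by rewrite lerDl.
Qed.

End heavy_cubes.

Lemma heavy_union_mass_inv f eta F : 1 < eta^-1 ->
  mass w (heavy_union f eta^-1 F) <= eta * mass w F.
Proof. by move=> eta1; rewrite -{2}(invrK eta); exact: heavy_union_mass. Qed.

(** The discrete testing conditions, for functions with [L^n] mean at most [c] and
    for functions bounded by [c]. The exponent is a natural number because packing
    sums are estimated by expanding their powers. *)
Definition power_testing n (B : R) := forall F h c, F \in D -> (forall P, 0 <= h P) ->
  0 <= c -> rsum w F (fun P => `|h P| ^+ n) <= c ^+ n * mass w F ->
  rsum w F (fun P => `|local_op F h P|) <= B * c * mass w F.

Definition bounded_testing (B : R) := forall F h c, F \in D -> (forall P, 0 <= h P) ->
  0 <= c -> (forall P, P \in F -> `|h P| <= c) ->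
  rsum w F (fun P => `|local_op F h P|) <= B * c * mass w F.

(** The larger cube [Q'] takes the place of the dyadic parent, which the family of
    sets alone does not determine. *)
Definition parent_doubling (K : R) := forall Q F, Q \in D -> F \in D -> Q \subset F ->
  Q != F -> exists Q', [/\ Q' \in D, Q \subset Q', Q' \subset F, Q' != Q &
    mass w Q' <= K * mass w Q].

Definition lattice_maximal F h P : E :=
  \big[Order.join/0]_(Q in D | (P \in Q) && (Q \subset F)) wmean w Q h.

(** A weak-type estimate at the single level that the stopping argument uses. *)
Definition maximal_weak_bound n (eta s : R) := forall F h c, F \in D ->
  (forall P, 0 <= h P) -> 0 <= c ->
  rsum w F (fun P => `|h P| ^+ n) <= c ^+ n * mass w F ->
  mass w [set P in F | s * c < `|lattice_maximal F h P|]%SET <= eta * mass w F.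

Lemma power_const_gt0 n : 0 < power_const n.
Proof. by rewrite /power_const mulr_gt0// ltr_pwDl. Qed.

(** The light majorant satisfies the hypothesis of testing as it is. *)
Lemma power_testing_majorant n B eta f : (0 < n)%N -> 0 < eta < 1 ->
  (forall P, 0 <= f P) -> power_testing n B ->
  testing_majorant eta (B * (power_const n / eta)) f.
Proof.
move=> n0 /andP[eta0 eta1] f0 test F FD.
have k1 : 1 < eta^-1 by rewrite invf_gt1.
exists (heavy_union f eta^-1 F), (light_majorant f eta^-1 F).
split.
- exact: heavy_union_sub.
- exact: heavy_union_mass_inv.
- by move=> P; exact: light_majorant_ge0.
- by move=> Q QD QF QH; apply: light_majorantP => //; rewrite inE QD QF.
rewrite -[B * _ * _]mulrA; apply: test => //.
- by move=> P; exact: light_majorant_ge0.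
- by rewrite mulr_ge0 ?rmean_ge0// divr_ge0 ?(ltW eta0)// ltW// power_const_gt0.
exact: light_majorant_power.
Qed.

(** The function is averaged over the maximal cubes inside the heavy union. Each of
    them lies in a light cube of comparable mass, which bounds its mean. *)
Lemma doubling_majorant K B eta f : 0 < eta < 1 -> 1 <= K ->
  (forall P, 0 <= f P) -> parent_doubling K -> bounded_testing B ->
  testing_majorant eta (B * (K / eta)) f.
Proof.
move=> /andP[eta0 eta1] K1 f0 par test F FD.
have k1 : 1 < eta^-1 by rewrite invf_gt1.
have K0 : 0 <= K by exact: le_trans K1.
set Om := heavy_union f eta^-1 F; set A := rmean w F _.
have A0 : 0 <= A by exact: rmean_ge0.
have KA0 : 0 <= K / eta * A by rewrite mulr_ge0// divr_ge0// ltW.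
(* points of mass zero carry no bound on f but must satisfy the bound on h *)
pose h P := if P \in Om then wmean w (maxcube D Om P) f else if w P == 0 then 0 else f P.
have h0 P : 0 <= h P.
  rewrite /h; case: ifP => _; last by case: ifP.
  by apply: wmean_ge0.
exists Om, h; split => //.
- exact: heavy_union_sub.
- exact: heavy_union_mass_inv.
- move=> Q QD QF QOm; rewrite le_eqVlt; apply/orP; left; apply/eqP.
  rewrite (wsum_setID _ Q Om) [RHS](wsum_setID _ Q Om); congr +%R; last first.
    apply: eq_bigr => P; rewrite inE /h => /andP[/negbTE -> _].
    by case: eqP => // ->; rewrite !scale0r.
  rewrite -(wsum_maxcube_mean D_laminar)//; apply: eq_bigr => P; rewrite inE => /andP[PQ POm].
  by rewrite /h POm (maxcube_setI D_laminar).
rewrite -[B * _ * _]mulrA; apply: test => //.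
move=> P PF; rewrite /h; case: ifPn => POm; last first.
  have lo : eta^-1 * A <= K / eta * A.
    by rewrite -mulrA ler_peMl// mulr_ge0// ltW// invr_gt0.
  case: eqP => [_|/eqP wP]; first by rewrite normr0 mulr_ge0// divr_ge0// ltW.
  by apply: le_trans lo; exact: light_point.
have [SD PS SOm maxS] := maxcubeP D_laminar D_singletons POm.
set S := maxcube D Om P in SD PS SOm maxS *.
have FOm : ~~ (F \subset Om) by exact: top_light PF.
have SF : S \subset F by exact: fintype.subset_trans SOm (heavy_union_sub _ _ _).
have SneF : S != F by apply: contra FOm => /eqP <-.
have [Q' [Q'D SQ' Q'F Q'S wQ']] := par S F SD FD SF SneF.
have Q'Om : ~~ (Q' \subset Om).
  apply: contra Q'S => Q'Om; rewrite finset.eqEsubset SQ' andbT.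
  by apply: maxS => //; exact: (fintype.subsetP SQ').
apply: (le_trans (norm_wmean _ _)).
have [S0|S0] := eqVneq (mass w S) 0.
  by rewrite /rmean S0 invr0 mul0r.
have Sgt0 : 0 < mass w S by rewrite lt_def S0 mass_ge0.
rewrite /rmean ler_pdivrMl//.
apply: (le_trans (rsum_subset w_ge0 SQ' _)) => [P' _|]; first exact: normr_ge0.
rewrite -mass_rmean// (_ : mass w S * _ = K * mass w S * (eta^-1 * A)); last by ring.
apply: ler_pM => //; [exact: mass_ge0|by apply: rmean_ge0|].
exact: light_mean.
Qed.

(** The supremum of the means of the light majorant over the cubes that are not
    stopped has at least their integral over each of these cubes. It is bounded by
    the value of the maximal function at a point outside the exceptional set. *)
Lemma maximal_majorant n B eta s f : (0 < n)%N -> 0 < eta < 1 -> 0 <= s ->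
  (forall P, 0 <= f P) -> maximal_weak_bound n eta s -> bounded_testing B ->
  testing_majorant (eta + eta) (B * (s * (power_const n / eta))) f.
Proof.
move=> n0 /andP[eta0 eta1] s0 f0 weak test F FD.
have k1 : 1 < eta^-1 by rewrite invf_gt1.
set A := rmean w F _.
have A0 : 0 <= A by exact: rmean_ge0.
set Om1 := heavy_union f eta^-1 F; set h0 := light_majorant f eta^-1 F.
pose c := power_const n * eta^-1 * A.
have c0 : 0 <= c.
  by rewrite mulr_ge0// divr_ge0 ?(ltW eta0)// ltW// power_const_gt0.
have h00 P : 0 <= h0 P by exact: light_majorant_ge0.
have hc : rsum w F (fun P => `|h0 P| ^+ n) <= c ^+ n * mass w F.
  exact: light_majorant_power.
pose Om2 := [set P in F | s * c < `|lattice_maximal F h0 P|]%SET.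
have wOm2 : mass w Om2 <= eta * mass w F by exact: weak.
have wOm1 : mass w Om1 <= eta * mass w F.
  exact: heavy_union_mass_inv.
pose Om := Om1 :|: Om2.
pose h P : E := \big[Order.join/0]_(Q in D | [&& P \in Q, Q \subset F & ~~ (Q \subset Om)])
  wmean w Q h0.
have hpos P : 0 <= h P by exact: bigjoin_ge_idx.
exists Om, h; split => //.
- rewrite finset.subUset heavy_union_sub.
  by apply/fintype.subsetP => P; rewrite inE => /andP[].
- rewrite mulrDl; apply: le_trans (lerD wOm1 wOm2).
  exact: mass_setU.
- move=> Q QD QF QOm; apply: (@le_trans _ _ (wsum w Q h0)).
    apply: light_majorantP => //; rewrite inE QD QF.
    by apply: contra QOm => /fintype.subset_trans; apply; exact: finset.subsetUl.
  rewrite -(mass_wmean w_ge0) /mass scaler_suml; apply: bl_ler_sum => P PQ.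
  apply: bl_leZ => //; rewrite /h.
  apply: (@bigjoin_ub R E _ _ _ (fun Q => wmean w Q h0) 0 Q); first exact: mem_index_enum.
  by rewrite QD PQ QF.
have -> : B * (s * (power_const n / eta)) * A * mass w F = B * (s * c) * mass w F.
  by rewrite /c; ring.
apply: test => //; first exact: mulr_ge0.
move=> P PF; have [FOm|FOm] := boolP (F \subset Om).
  rewrite /h big_pred0; first by rewrite normr0 mulr_ge0.
  move=> Q; apply/negbTE/negP => /and4P[_ _ QF].
  by rewrite (fintype.subset_trans QF FOm).
have [P' P'F chain] := good_chain D_laminar FD PF FOm.
move: P'F; rewrite !inE negb_or -andbA => /and3P[P'Om1 P'Om2 P'F].
rewrite P'F /= -leNgt in P'Om2; apply: le_trans P'Om2.
apply: bl_norm_le => //; apply: bigjoin_lub; first exact: bigjoin_ge_idx.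
move=> Q /and4P[QD PQ QF QOm].
apply: (@bigjoin_ub R E _ _ _ (fun Q => wmean w Q h0) 0 Q); first exact: mem_index_enum.
by rewrite QD QF chain.
Qed.

End stopping.

(** * Maximal inequalities for general measures *)
Section trees.
Variables (R : realType) (E : banachLatticeType R) (b : nat).
Hypothesis b_gt1 : (1 < b)%N.

(** Step functions on a dyadic cube whose [b] children have equal volume: constant,
    or given on each child. *)
Inductive tree := Leaf of E | Node of ('I_b -> tree).

Fixpoint nonneg t : Prop :=
  match t with Leaf v => 0 <= v | Node c => forall i, nonneg (c i) end.

Fixpoint tavg t : E :=
  match t with Leaf v => v | Node c => b%:R^-1 *: \sum_(i < b) tavg (c i) end.

Fixpoint tmean (phi : E -> R) t : R :=
  match t with
  | Leaf v => phi v
  | Node c => b%:R^-1 * \sum_(i < b) tmean phi (c i)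
  end.

Variable q : R.
Hypothesis q1 : 1 < q.

(** The mean of the [q]-th power of the maximal function, joined with [u]. *)
Fixpoint tmax t (u : E) : R :=
  match t with
  | Leaf v => `|Order.join u v| `^ q
  | Node c => b%:R^-1 * \sum_(i < b) tmax (c i) (Order.join u (tavg t))
  end.

Definition tree_maximal_bound C := forall t, nonneg t ->
  tmax t 0 <= C * tmean (fun v => `|v| `^ q) t.

Fixpoint tscale (k : R) t :=
  match t with Leaf v => Leaf (k *: v) | Node c => Node (fun i => tscale k (c i)) end.

Let q0 : 0 < q. Proof. exact: lt_trans q1. Qed.

Let b0 : 0 < b%:R :> R. Proof. by rewrite ltr0n (ltn_trans _ b_gt1). Qed.

Let b0' : 0 <= b%:R^-1 :> R. Proof. by rewrite invr_ge0 ltW. Qed.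

Lemma norm_powR_mono (x y : E) : 0 <= x -> x <= y -> `|x| `^ q <= `|y| `^ q.
Proof.
move=> x0 xy; apply: ge0_ler_powR; rewrite ?nnegrE//; first exact: ltW.
exact: bl_norm_le.
Qed.

Lemma tavg_ge0 t : nonneg t -> 0 <= tavg t.
Proof.
elim: t => //= c IH c0; apply: bl_ge0Z => //; apply: bl_sum_ge0 => i _.
exact: IH.
Qed.

Lemma nonneg_tscale k t : 0 <= k -> nonneg t -> nonneg (tscale k t).
Proof. by move=> k0; elim: t => [v|c IH] /= h; [exact: bl_ge0Z|move=> i; exact: IH]. Qed.

Lemma tavg_tscale k t : tavg (tscale k t) = k *: tavg t.
Proof.
elim: t => //= c IH; rewrite scalerA mulrC -scalerA; congr (_ *: _).
by rewrite scaler_sumr; apply: eq_bigr => i _.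
Qed.

Lemma tmean_tscale k t : 0 <= k ->
  tmean (fun v => `|v| `^ q) (tscale k t) = k `^ q * tmean (fun v => `|v| `^ q) t.
Proof.
move=> k0; elim: t => [v|c IH] /=; first by rewrite normrZ ger0_norm// powRM.
by rewrite mulrCA; congr (_ * _); rewrite mulr_sumr; apply: eq_bigr => i _.
Qed.

Lemma tmax_ge0 t u : 0 <= tmax t u.
Proof.
elim: t u => [v|c IH] u /=; first exact: powR_ge0.
by rewrite mulr_ge0// sumr_ge0.
Qed.

Lemma tmax_mono t u u' : 0 <= u -> u <= u' -> tmax t u <= tmax t u'.
Proof.
elim: t u u' => [v|c IH] u u' u0 uu' /=.
  apply: norm_powR_mono; first exact: le_trans u0 (leUl _ _).
  exact: leU2.
rewrite ler_wpM2l// ler_sum// => i _; apply: IH; last exact: leU2.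
exact: le_trans u0 (leUl _ _).
Qed.

(** Scaling up does not decrease the maximal function. In [simulation] it makes up
    for proportions that have been rounded down. *)
Lemma tmax_tscale k t u : 1 <= k -> nonneg t -> 0 <= u -> tmax t u <= tmax (tscale k t) u.
Proof.
move=> k1; have scale (v : E) : 0 <= v -> v <= k *: v.
  by move=> v0; rewrite -{1}[v]scale1r; exact: bl_leZr.
elim: t u => [v|c IH] u /= t0 u0.
  apply: norm_powR_mono; first exact: le_trans u0 (leUl _ _).
  by apply: leU2 => //; exact: scale.
rewrite ler_wpM2l// ler_sum// => i _.
set a := b%:R^-1 *: _; set a' := b%:R^-1 *: _.
have aa' : a <= a'.
  apply: bl_leZ => //; apply: bl_ler_sum => j _.
  by rewrite tavg_tscale scale//; exact: tavg_ge0.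
have ua0 : 0 <= Order.join u a by exact: le_trans u0 (leUl _ _).
apply: (le_trans (IH i _ (t0 i) ua0)); apply: tmax_mono => //; exact: leU2.
Qed.

Lemma tmax_avg t u : tmax t (Order.join u (tavg t)) = tmax t u.
Proof.
by case: t => [v|c] /=; [rewrite -joinA joinxx|under eq_bigr do rewrite -joinA joinxx].
Qed.

Lemma sum_blocks (V : nmodType) (T : Type) (F : T -> V) m n (l : seq T) :
  size l = (n * m)%N ->
  \sum_(s <- l) F s = \sum_(i < n) \sum_(s <- take m (drop (i * m) l)) F s.
Proof.
elim: n l => [|n IHn] l.
  by rewrite mul0n => /size0nil ->; rewrite big_nil big_ord0.
rewrite mulSn => sl; rewrite -{1}(cat_take_drop m l) big_cat big_ord_recl /=.
rewrite mul0n drop0; congr (_ + _).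
rewrite IHn; last by rewrite size_drop sl addKn.
by apply: eq_bigr => i _; rewrite drop_drop /bump /= mulnDl mul1n addnC.
Qed.

(** Spreading a list of trees over all the descendants of one generation. The
    intermediate cubes can only enlarge the maximal function. *)
Lemma spread_trees N (l : seq tree) : size l = (b ^ N)%N ->
  (forall s, List.In s l -> nonneg s) ->
  exists t, [/\ nonneg t, tavg t = (b ^ N)%:R^-1 *: \sum_(s <- l) tavg s,
    forall phi, tmean phi t = (b ^ N)%:R^-1 * \sum_(s <- l) tmean phi s &
    forall u : E, 0 <= u ->
      (b ^ N)%:R^-1 * \sum_(s <- l) tmax s (Order.join u (tavg t)) <= tmax t u].
Proof.
elim: N l => [|N IHN] l.
  rewrite expn0; case: l => [//|s [|//]] _ s0.
  exists s; rewrite !big_seq1 invr1 scale1r; split=> // [|phi|u _].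
  - by apply: s0; left.
  - by rewrite big_seq1 mul1r.
  - by rewrite big_seq1 mul1r tmax_avg.
rewrite expnS => sl l0.
have block (i : 'I_b) : exists t, [/\ nonneg t,
    tavg t = (b ^ N)%:R^-1 *: \sum_(s <- take (b ^ N) (drop (i * b ^ N) l)) tavg s,
    forall phi, tmean phi t =
      (b ^ N)%:R^-1 * \sum_(s <- take (b ^ N) (drop (i * b ^ N) l)) tmean phi s &
    forall u : E, 0 <= u -> (b ^ N)%:R^-1 * \sum_(s <- take (b ^ N) (drop (i * b ^ N) l))
      tmax s (Order.join u (tavg t)) <= tmax t u].
  apply: IHN => [|s sb].
    rewrite size_takel// size_drop sl -mulnBl leq_pmull// subn_gt0 ltn_ord//.
  apply: l0; rewrite -(cat_take_drop (i * b ^ N) l); apply: List.in_or_app; right.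
  rewrite -(cat_take_drop (b ^ N) (drop _ l)); apply: List.in_or_app; by left.
have {block}[c cP] := choice block.
exists (Node c); have avgE : tavg (Node c) = (b * b ^ N)%:R^-1 *: \sum_(s <- l) tavg s.
  rewrite /= natrM invfM -scalerA (sum_blocks _ sl); congr (_ *: _).
  by rewrite scaler_sumr; apply: eq_bigr => i _; have [_ ->] := cP i.
split=> // [i|phi|u u0].
- by have [] := cP i.
- rewrite /= natrM invfM -mulrA (sum_blocks _ sl); congr (_ * _).
  by rewrite mulr_sumr; apply: eq_bigr => i _; have [_ _ ->] := cP i.
rewrite [leRHS]/= -/(tavg (Node c)) natrM invfM -mulrA (sum_blocks _ sl) mulr_sumr.
rewrite ler_wpM2l// ler_sum// => i _; have [_ _ _ h] := cP i.
have ua0 : 0 <= Order.join u (tavg (Node c)) by exact: le_trans u0 (leUl _ _).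
apply: le_trans (h _ ua0); rewrite ler_wpM2l ?invr_ge0//.
by apply: ler_sum => s _; apply: tmax_mono => //; exact: leUl.
Qed.

Section simulation.
Variables (L : finType) (w : L -> R).
Hypothesis w_ge0 : forall P, 0 <= w P.
Variable D : {set {set L}}.
Hypothesis D_laminar : laminar D.
Hypothesis D_singletons : forall P, [set P]%SET \in D.
Variable h : L -> E.
Hypothesis h_ge0 : forall P, 0 <= h P.
Implicit Types (F S Q : {set L}) (P : L).

Notation M := (lattice_maximal w D).

Lemma lattice_maximal_ge0 F P : 0 <= M F h P.
Proof. exact: bigjoin_ge_idx. Qed.

Lemma lattice_maximal_step F S P : F \in D ->
  (forall Q, Q \in D -> P \in Q -> Q \subset F -> Q != F -> Q \subset S) ->
  M F h P <= Order.join (wmean w F h) (M S h P).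
Proof.
move=> FD FS; apply: bigjoin_lub => [|Q /and3P[QD PQ QF]].
  exact: le_trans (lattice_maximal_ge0 S P) (leUr _ _).
have [->|QF'] := eqVneq Q F; first exact: leUl.
apply: le_trans (leUr _ _).
apply: (@bigjoin_ub R E _ _ _ (fun Q => wmean w Q h) 0 Q); first exact: mem_index_enum.
by rewrite QD PQ FS.
Qed.

(** The inequality for the maximal function has to be localized by [u], the supremum
    of the averages over the larger cubes. *)
Definition simulates c F t := [/\ nonneg t, wmean w F h <= tavg t,
  tmean (fun v => `|v| `^ q) t <= c * rmean w F (fun P => `|h P| `^ q) &
  forall u : E, 0 <= u ->
    rmean w F (fun P => `|Order.join u (M F h P)| `^ q) <= c * tmax t u].

(** Multiplicities of the children in [b ^ N] slots, rounded down from the exact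
    proportions, and the slots that this leaves over. *)
Lemma proportions (K : finType) (A : {set K}) (r : K -> R) (k : R) : 1 < k ->
  (forall i, i \in A -> 0 < r i) -> \sum_(i in A) r i <= 1 ->
  exists (N : nat) (n : K -> nat), (\sum_(i in A) n i <= b ^ N)%N /\
    forall i, i \in A ->
      (n i)%:R / (b ^ N)%:R <= r i /\ r i <= k * ((n i)%:R / (b ^ N)%:R).
Proof.
move=> k1 r0 r1; have k0 : 0 < k by exact: lt_trans k1.
pose X := \sum_(i in A) (r i * (1 - k^-1))^-1.
have k' : 0 < 1 - k^-1 by rewrite subr_gt0 invf_lt1.
have X0 i : i \in A -> 0 <= (r i * (1 - k^-1))^-1.
  by move=> iA; rewrite invr_ge0 mulr_ge0 ?ltW ?r0.
pose N := (Num.truncn X).+1.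
have XN : X <= (b ^ N)%:R.
  apply: ltW; apply: lt_le_trans (truncnS_gt _) _.
  by rewrite ler_nat; apply: ltnW; exact: ltn_expl.
have bN0 : 0 < (b ^ N)%:R :> R by rewrite ltr0n expn_gt0 (ltn_trans _ b_gt1).
exists N, (fun i => Num.truncn ((b ^ N)%:R * r i)).
have lo i : i \in A -> (Num.truncn ((b ^ N)%:R * r i))%:R <= (b ^ N)%:R * r i.
  by move=> iA; rewrite truncn_le mulr_ge0// ltW// r0.
split.
  rewrite -(ler_nat R) natr_sum; apply: le_trans (ler_sum _ lo) _.
  by rewrite -mulr_sumr ler_piMr// ltW.
move=> i iA; split; first by rewrite ler_pdivrMr// [leRHS]mulrC; exact: lo.
rewrite mulrA ler_pdivlMr// -ler_pdivrMl//.
have hi := truncnS_gt ((b ^ N)%:R * r i); set n := Num.truncn _ in hi *.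
have ri : 1 <= (b ^ N)%:R * (r i * (1 - k^-1)).
  rewrite -ler_pdivrMr ?mul1r ?mulr_gt0 ?r0//; apply: le_trans XN.
  by rewrite /X (bigD1 i) //= lerDl sumr_ge0// => j /andP[/X0].
rewrite -natr1 in hi.
have -> : k^-1 * (r i * (b ^ N)%:R) = (b ^ N)%:R * r i - (b ^ N)%:R * (r i * (1 - k^-1)) by ring.
by rewrite lerBlDr; apply: ltW; apply: lt_le_trans hi _; rewrite lerD2l.
Qed.

(** By induction, the maximal proper subcubes of [F] have simulating trees. These are
    repeated with multiplicities proportional to the masses and scaled up to make
    the averages large enough; the remaining slots are zero. *)
Lemma simulation c F : 1 < c -> F \in D -> 0 < mass w F -> exists t, simulates c F t.
Proof.
move: {2}#|F| (leqnn #|F|) => n; elim: n F c => [|n IHn] F c cF c1 FD wF.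
  move: cF; rewrite leqn0 cards_eq0 => /eqP F0.
  by move: wF; rewrite F0 /mass big_set0 ltxx.
have c0 : 0 < c by exact: lt_trans c1.
have [[P FP]|Fne] := pselect (exists P, F = [set P]%SET).
  have wP : 0 < w P by move: wF; rewrite FP /mass big_set1.
  have mE (phi : L -> R) : rmean w F phi = phi P.
    by rewrite /rmean /mass /rsum FP !big_set1 mulrA mulVf ?mul1r// gt_eqF.
  have hE : wmean w F h = h P.
    by rewrite /wmean /mass /wsum FP !big_set1 scalerA mulVf ?scale1r// gt_eqF.
  have le1 (x : R) : 0 <= x -> x <= c * x by move=> x0; rewrite ler_peMl// ltW.
  exists (Leaf (h P)); split=> //=; first by rewrite hE.
    by rewrite mE le1 ?powR_ge0.
  move=> u u0; rewrite mE; apply: le_trans (le1 _ (powR_ge0 _ _)).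
  apply: norm_powR_mono; first exact: le_trans u0 (leUl _ _).
  apply: leU2 => //; apply: bigjoin_lub => // Q /and3P[QD PQ].
  rewrite FP subset1 => /orP[/eqP ->|/eqP Q0]; first by rewrite -FP hE.
  by rewrite Q0 inE in PQ.
(* one factor k is spent on the subcubes by induction, one on rounding the
   proportions, and scaling by k costs its power of exponent q in the energy *)
pose k := c `^ (q + 1)^-1.
have q1' : 0 < q + 1 by rewrite addr_gt0.
have kc : k `^ (q + 1) = c by rewrite /k -powRrM mulVf ?powRr1 ?gt_eqF// ltW.
have k0 : 0 < k by rewrite powR_gt0.
have k1 : 1 < k.
  rewrite ltNge; apply/negP => k1; move: c1; rewrite -kc ltNge => /negP; apply.
  have e1 : (1 : R) `^ (q + 1) = 1 by rewrite powR1.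
  by rewrite -[leRHS]e1 ge0_ler_powR ?nnegrE// ltW.
have kkq : k * k `^ q = c.
  by have := mulr_powRB1 (ltW k0) q1'; rewrite addrK kc.
have kkc : k * k <= c.
  rewrite -kkq ler_pM2l// -{1}(powRr1 (ltW k0)) ler_powR//; exact: ltW.
pose D' := D :\ F.
have D'_laminar : laminar D'.
  by move=> A B; rewrite 2!inE => /andP[_ AD] /[!inE] /andP[_ BD]; exact: D_laminar.
have D'_singletons P : [set P]%SET \in D'.
  by rewrite !inE D_singletons andbT; apply/eqP => PF; apply: Fne; exists P.
pose children := [set S in maxcube D' F @: F | 0 < mass w S]%SET.
have childP S : S \in maxcube D' F @: F -> [/\ S \in D, S \subset F, S != F & forall P,
    P \in S -> forall Q, Q \in D -> P \in Q -> Q \subset F -> Q != F -> Q \subset S].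
  move=> /finset.imsetP[P0 P0F ->].
  have [mD' Pm mF _] := maxcubeP D'_laminar D'_singletons P0F.
  move: (mD'); rewrite !inE => /andP[-> mD]; split => // P PS Q QD PQ QF QneF.
  have PF : P \in F by exact: (fintype.subsetP mF).
  have [_ _ _ maxm] := maxcubeP D'_laminar D'_singletons PF.
  rewrite -(maxcube_eq D'_laminar D'_singletons P0F PS); apply: maxm => //.
  by rewrite !inE QneF.
have sumF (V : lmodType R) (f : L -> V) :
    wsum w F f = \sum_(S in children) mass w S *: wmean w S f.
  rewrite /wsum (big_maxcube D'_laminar D'_singletons).
  rewrite (bigID (fun S => 0 < mass w S)) /= [X in _ + X]big1 ?addr0.
    rewrite (eq_bigl (mem children)); last by move=> S; rewrite !inE.
    by apply: eq_bigr => S _; rewrite mass_wmean.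
  move=> S /andP[_ Sm]; apply: wsum0 => //.
  by apply/eqP; rewrite eq_le mass_ge0// andbT leNgt.
have childW S : S \in children -> 0 < mass w S by rewrite inE => /andP[].
have childI S : S \in children -> S \in maxcube D' F @: F by rewrite inE => /andP[].
have sub S : exists t, S \in children -> simulates k S t.
  have [Sc|Sc] := boolP (S \in children); last by exists (Leaf 0).
  have [SD SF SneF _] := childP S (childI S Sc).
  have cS : (#|S| <= n)%N.
    rewrite -ltnS; apply: leq_trans cF; apply: proper_card.
    by rewrite finset.properEneq SneF.
  by have [t tP] := IHn S k cS k1 SD (childW S Sc); exists t.
have {sub}[T TP] := choice sub.
pose r (S : {set L}) : R := mass w S / mass w F.
have [N [m [mN mr]]] : exists (N : nat) (m : {set L} -> nat),
    (\sum_(S in children) m S <= b ^ N)%N /\ forall S, S \in children ->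
    (m S)%:R / (b ^ N)%:R <= r S /\ r S <= k * ((m S)%:R / (b ^ N)%:R).
  apply: proportions => // [S Sc|]; first by rewrite divr_gt0//; exact: childW.
  rewrite -mulr_suml ler_pdivrMr// mul1r.
  have := sumF R^o (fun=> 1); rewrite /wsum.
  have -> : \sum_(P in F) w P *: (1 : R^o) = mass w F.
    by apply: eq_bigr => P _; exact: mulr1.
  move=> ->; rewrite le_eqVlt; apply/orP; left; apply/eqP.
  apply: eq_bigr => S Sc; rewrite -[LHS]mulr1; congr (_ * _).
  rewrite /wmean /wsum (_ : \sum_(P in S) _ = mass w S); last first.
    by apply: eq_bigr => P _; exact: mulr1.
  by rewrite [RHS]mulVf// gt_eqF// childW.
have bN0 : 0 < (b ^ N)%:R :> R by rewrite ltr0n expn_gt0 (ltn_trans _ b_gt1).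
pose l := flatten [seq nseq (m C) (tscale k (T C)) | C <- enum children]
  ++ nseq (b ^ N - \sum_(S in children) m S) (Leaf 0).
have sum_l (V : lmodType R) (G : tree -> V) : \sum_(s <- l) G s =
    \sum_(S in children) (m S)%:R *: G (tscale k (T S))
    + (b ^ N - \sum_(S in children) m S)%:R *: G (Leaf 0).
  rewrite /l big_cat big_flatten big_map big_enum big_nseq /= iter_addr_0 scaler_nat.
  congr (_ + _); apply: eq_bigr => S _.
  by rewrite big_nseq iter_addr_0 scaler_nat.
have sum_lR (G : tree -> R) : \sum_(s <- l) G s =
    \sum_(S in children) (m S)%:R * G (tscale k (T S))
    + (b ^ N - \sum_(S in children) m S)%:R * G (Leaf 0).
  exact: (sum_l R^o).
have sl : size l = (b ^ N)%N.
  rewrite size_cat size_nseq size_flatten /shape -map_comp sumnE big_map big_enum /=.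
  under eq_bigr do rewrite size_nseq.
  by rewrite subnKC.
have K0 : 0 <= k by exact: ltW.
have l0 s : List.In s l -> nonneg s.
  move=> /(@List.in_app_or _ _ _ _)[|].
    have : all (mem children) (enum children) by apply/allP => S; rewrite mem_enum.
    elim: (enum _) => [//|S e IHe] /= /andP[Sc ec] /(@List.in_app_or _ _ _ _)[|]; last exact: IHe.
    elim: (m S) => [//|j IHj] /= [<-|//]; apply: nonneg_tscale => //.
    by have [] := TP S Sc.
  elim: (_ - _)%N => [//|j IHj] /= [<-|]; [exact: (lexx (0 : E))|exact: IHj].
have [t [t0 tavgE tmeanE tmaxE]] := spread_trees sl l0.
have rF S : S \in children -> 0 <= r S by move=> Sc; rewrite divr_ge0// mass_ge0.
have meanF (V : lmodType R) (f : L -> V) :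
    wmean w F f = \sum_(S in children) r S *: wmean w S f.
  rewrite [LHS]/wmean sumF scaler_sumr; apply: eq_bigr => S Sc.
  by rewrite scalerA mulrC.
have rmeanF (f : L -> R) : rmean w F f = \sum_(S in children) r S * rmean w S f.
  exact: (meanF R^o).
have avgt : wmean w F h <= tavg t.
  rewrite tavgE sum_l meanF /= !scaler0 addr0 scaler_sumr; apply: bl_ler_sum => S Sc.
  have [Ti0 Tavg _ _] := TP S Sc; have [_ ri] := mr S Sc.
  rewrite [leRHS](_ : _ = (k * ((m S)%:R / (b ^ N)%:R)) *: tavg (T S)); last first.
    by rewrite tavg_tscale !scalerA; congr (_ *: _); ring.
  apply: (@le_trans _ _ (r S *: tavg (T S))).
    by apply: bl_leZ => //; exact: rF.
  by apply: bl_leZr => //; exact: tavg_ge0.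
exists t; split=> //.
  rewrite tmeanE sum_lR /= normr0 powR0 ?gt_eqF// mulr0 addr0 mulr_sumr rmeanF mulr_sumr.
  apply: ler_sum => S Sc; have [Ti0 _ Ten _] := TP S Sc; have [ri _] := mr S Sc.
  set tm := tmean (fun v => `|v| `^ q) (T S) in Ten.
  have tm0 : 0 <= tm.
    rewrite /tm; elim: (T S) => [v|cc IH] /=; first exact: powR_ge0.
    by rewrite mulr_ge0// sumr_ge0.
  rewrite tmean_tscale// -/tm -kkq.
  set rm := rmean w S _ in Ten *.
  rewrite [leLHS](_ : _ = (m S)%:R / (b ^ N)%:R * (k `^ q * tm)); last by ring.
  rewrite [leRHS](_ : _ = r S * (k `^ q * (k * rm))); last by ring.
  apply: ler_pM; [by rewrite divr_ge0|by rewrite mulr_ge0 ?powR_ge0|exact: ri|].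
  by rewrite ler_wpM2l ?powR_ge0.
move=> u u0; have uF0 : 0 <= Order.join u (wmean w F h) by exact: le_trans u0 (leUl _ _).
have ut0 : 0 <= Order.join u (tavg t) by exact: le_trans u0 (leUl _ _).
apply: (@le_trans _ _ (c * ((b ^ N)%:R^-1 * \sum_(s <- l) tmax s (Order.join u (tavg t))))); last first.
  by rewrite ler_pM2l//; exact: tmaxE.
rewrite sum_lR mulrDr mulrDr.
rewrite -[leLHS]addr0; apply: lerD; last first.
  by rewrite !mulr_ge0 ?powR_ge0 ?invr_ge0// ltW.
rewrite rmeanF !mulr_sumr; apply: ler_sum => S Sc.
have [Ti0 _ _ Tmax] := TP S Sc; have [_ ri] := mr S Sc.
have [SD SF SneF Sch] := childP _ (childI _ Sc).
have step : rmean w S (fun P => `|Order.join u (M F h P)| `^ q) <=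
    k * tmax (T S) (Order.join u (wmean w F h)).
  apply: le_trans (Tmax _ uF0); rewrite /rmean ler_wpM2l ?invr_ge0 ?mass_ge0//.
  apply: rsum_le => // P PS; apply: norm_powR_mono; first exact: le_trans u0 (leUl _ _).
  rewrite -joinA; apply: leU2 => //; apply: lattice_maximal_step => // Q; exact: Sch.
apply: (@le_trans _ _ (r S * (k * tmax (T S) (Order.join u (wmean w F h))))).
  by rewrite ler_wpM2l// rF.
apply: (@le_trans _ _ (k * ((m S)%:R / (b ^ N)%:R) * (k * tmax (T S) (Order.join u (wmean w F h))))).
  by rewrite ler_wpM2r// mulr_ge0// tmax_ge0.
rewrite [leLHS](_ : _ = k * k * ((m S)%:R / (b ^ N)%:R * tmax (T S) (Order.join u (wmean w F h)))); last by ring.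
apply: ler_pM => //; [exact: mulr_ge0|by rewrite mulr_ge0 ?tmax_ge0// divr_ge0|].
rewrite mulrA (mulrC _^-1) ler_wpM2l ?divr_ge0//.
apply: (@le_trans _ _ (tmax (T S) (Order.join u (tavg t)))); last first.
  by apply: tmax_tscale => //; exact: ltW.
by apply: tmax_mono => //; exact: leU2.
Qed.

End simulation.

(** A simulation up to the factor two, which enters the energy and the maximal
    function, turns the inequality for trees into one for [w], with constant
    [4 * C]. Chebyshev's inequality gives the weak form. *)
Lemma maximal_transfer C (L : finType) (w : L -> R) (D : {set {set L}}) n (eta : R) :
  0 <= C -> tree_maximal_bound C -> q < n%:R -> 0 < eta ->
  (forall P, 0 <= w P) -> laminar D -> (forall P, [set P]%SET \in D) ->
  maximal_weak_bound E w D n eta ((4 * C / eta) `^ q^-1).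
Proof.
move=> C0 tC qn eta0 w0 Dlam Dsing F h c FD h0 c0 hc.
have [wF|wF] := eqVneq (mass w F) 0.
  rewrite wF mulr0 -wF; apply: mass_le => //.
  by apply/fintype.subsetP => P; rewrite inE => /andP[].
have {}wF : 0 < mass w F by rewrite lt_def wF mass_ge0.
set s := (4 * C / eta) `^ q^-1; set MF := lattice_maximal w D F h.
have strong : rsum w F (fun P => `|MF P| `^ q) <= 4 * C * rsum w F (fun P => `|h P| `^ q).
  have [|t [t0 _ ten tmx]] := simulation w0 Dlam Dsing h0 _ FD wF (c := 2).
    by rewrite ltr1n.
  have := tmx 0 (lexx _); rewrite (_ : rmean _ _ _ = rmean w F (fun P => `|MF P| `^ q)); last first.
    congr (_ * _); apply: eq_bigr => P _; congr (_ * (`|_| `^ _)).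
    by apply: join_r; exact: lattice_maximal_ge0.
  move=> h1; have h2 := tC t t0.
  rewrite -!mass_rmean// [leRHS]mulrCA ler_pM2l//; apply: (le_trans h1).
  have := ler_wpM2l C0 ten; move: h2; clear; set x := tmax t 0; set y := tmean _ t.
  set z := rmean w F _; lra.
have hq : rsum w F (fun P => `|h P| `^ q) <= c `^ q * mass w F.
  exact: power_mean_down hc.
have a0 : 0 <= 4 * C * c `^ q by rewrite mulr_ge0 ?powR_ge0// mulr_ge0.
have hM : rsum w F (fun P => `|MF P| `^ q) <= 4 * C * c `^ q * mass w F.
  by rewrite -mulrA; apply: (le_trans strong); rewrite ler_wpM2l ?mulr_ge0.
apply: le_trans (chebyshev w0 a0 eta0 _ hM); last by move=> P _; exact: powR_ge0.
apply: mass_le => //; apply/fintype.subsetP => P; rewrite !inE => /andP[-> /= sM].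
have s0 : 0 <= s by exact: powR_ge0.
have : (s * c) `^ q < `|MF P| `^ q by rewrite gt0_ltr_powR ?nnegrE ?mulr_ge0.
rewrite powRM// /s -powRrM mulVf ?gt_eqF// powRr1; last by rewrite divr_ge0 ?(ltW eta0) ?mulr_ge0.
by rewrite (mulrAC _ eta^-1).
Qed.

End trees.

(** * Simple functions and Bochner integrals *)
Lemma fine_sum (R : realType) (I : Type) (r : seq I) (P : pred I) (F : I -> \bar R) :
  (forall i, P i -> F i \is a fin_num) ->
  fine (\sum_(i <- r | P i) F i) = \sum_(i <- r | P i) fine (F i).
Proof.
move=> fF; rewrite (eq_bigr (fun i => (fine (F i))%:E)); first by rewrite sumEFin.
by move=> i /fF /fineK ->.
Qed.

Lemma cvgn_sum (R : realType) (E : normedModType R) (I : Type) (r : seq I) (P : pred I)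
    (F : I -> nat -> E) (l : I -> E) :
  (forall i, P i -> F i n @[n --> \oo] --> l i) ->
  (\sum_(i <- r | P i) F i n) @[n --> \oo] --> \sum_(i <- r | P i) l i.
Proof.
move=> Fl; elim: r => [|i r IHr].
  rewrite big_nil (_ : (fun n => _) = fun=> 0); first exact: cvg_cst.
  by apply/funext => n; rewrite big_nil.
rewrite big_cons (_ : (fun n => _) = fun n => if P i then F i n + \sum_(j <- r | P j) F j n
  else \sum_(j <- r | P j) F j n); last by apply/funext => n; rewrite big_cons.
by case Pi : (P i) => //; apply: cvgD => //; exact: Fl.
Qed.

Section simple_function_theory.
Context d (T : measurableType d) (R : realType) (E : completeNormedModType R).
Implicit Types (s : T -> E) (A : set T).

Lemma simple_measurable2 s s' (Z : set (E * E)) :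
  simple_function s -> simple_function s' -> measurable [set x | Z (s x, s' x)].
Proof.
move=> [fs ms] [fs' ms'].
pose I := (range s `*` range s') `&` Z.
have -> : [set x | Z (s x, s' x)] =
    \bigcup_(p in I) (s @^-1` [set p.1] `&` s' @^-1` [set p.2]).
  apply/seteqP; split => [x /= Zx|x [[y y'] [/= _ Zy] [/= -> ->]]//].
  by exists (s x, s' x) => //; split => //; split => /=; exists x.
apply: fin_bigcup_measurable; last by move=> p _; exact: measurableI.
by apply: finite_setIl; exact: finite_setX.
Qed.

Lemma simple_measurable_fun2 s s' (phi : E -> E -> R) A : measurable A ->
  simple_function s -> simple_function s' ->
  measurable_fun A (fun x => phi (s x) (s' x)).
Proof.
move=> mA ss ss' _ Y mY; apply: measurableI => //.
exact: (simple_measurable2 (fun p => Y (phi p.1 p.2))).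
Qed.

Lemma simple_cst (v : E) : simple_function (fun _ : T => v).
Proof.
split=> [|y]; first exact: (sub_finite_set (B := [set v])) (fun _ '(ex_intro2 _ _ e) => esym e) (finite_set1 v).
have [->|yv] := pselect (v = y); first by rewrite (_ : _ @^-1` _ = setT)//; apply/seteqP.
by rewrite (_ : _ @^-1` _ = set0)//; apply/seteqP; split=> x.
Qed.

Lemma simple_map2 s s' (phi : E -> E -> E) :
  simple_function s -> simple_function s' -> simple_function (fun x => phi (s x) (s' x)).
Proof.
move=> ss ss'; split=> [|y]; last exact: (simple_measurable2 (fun p => phi p.1 p.2 = y)).
apply: (sub_finite_set _ (finite_image2 phi ss.1 ss'.1)) => _ [x _ <-].
by exists (s x); [exists x|exists (s' x) => //; exists x].
Qed.

Lemma simple_indicZ s A : measurable A -> simple_function s ->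
  simple_function (fun x => \1_A x *: s x).
Proof.
move=> mA ss; split=> [|y].
  apply: (@sub_finite_set _ _ (range s `|` [set 0])).
    move=> _ [x _ <-]; rewrite indicE; case: (x \in A); rewrite ?scale1r ?scale0r; last by right.
    by left; exists x.
  by rewrite finite_setU; split; [exact: ss.1|exact: finite_set1].
have -> : (fun x => \1_A x *: s x) @^-1` [set y] =
    (A `&` s @^-1` [set y]) `|` (~` A `&` [set x | 0 = y]).
  apply/seteqP; split=> x /=; rewrite indicE.
    have [xA|xA] := boolP (x \in A); first by rewrite scale1r => <-; left; split=> //; rewrite -in_setE.
    by rewrite scale0r => <-; right; split=> //; move/negP: xA; rewrite in_setE.
  move=> [[Ax <-]|[Ax <-]]; first by rewrite mem_set// scale1r.
  by rewrite memNset// scale0r.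
apply: measurableU; first by apply: measurableI => //; exact: ss.2.
apply: measurableI; first exact: measurableC.
have [->|yv] := pselect (0 = y); first by rewrite (_ : [set x | _] = setT)//; apply/seteqP.
by rewrite (_ : [set x | _] = set0)//; apply/seteqP; split=> x.
Qed.

Lemma simple_sum (I : Type) (r : seq I) (P : pred I) (F : I -> T -> E) :
  (forall i, P i -> simple_function (F i)) ->
  simple_function (fun x => \sum_(i <- r | P i) F i x).
Proof.
move=> sF; elim: r => [|i r IHr].
  by under eq_fun do rewrite big_nil; exact: simple_cst.
under eq_fun do rewrite big_cons; case Pi : (P i); last exact: IHr.
by apply: (simple_map2 +%R) => //; exact: sF.
Qed.

Lemma simple_strongly_measurable s A : simple_function s -> strongly_measurable A s.
Proof. by move=> ss; exists (fun=> s) => // x _; exact: cvg_cst. Qed.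

Lemma strongly_measurable_norm (f : T -> E) s A : measurable A -> strongly_measurable A f ->
  simple_function s -> measurable_fun A (fun x => `|f x - s x|).
Proof.
move=> mA [u su uf] ss.
apply: (@measurable_fun_cvg _ _ _ A (fun n x => `|u n x - s x|)) => [n|x Ax].
  exact: (simple_measurable_fun2 (fun a b => `|a - b|)).
by apply: cvg_norm; apply: cvgB; [exact: uf|exact: cvg_cst].
Qed.

Lemma strongly_measurable_norm0 (f : T -> E) A : measurable A -> strongly_measurable A f ->
  measurable_fun A (fun x => `|f x|).
Proof.
move=> mA mf; have := strongly_measurable_norm mA mf (simple_cst 0).
by under eq_fun do rewrite subr0.
Qed.

Lemma strongly_measurable_subset (f : T -> E) A B : B `<=` A -> strongly_measurable A f ->
  strongly_measurable B f.
Proof. by move=> BA [u su uf]; exists u => // x /BA; exact: uf. Qed.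

End simple_function_theory.
Arguments simple_cst {d T R E} v.

Section cells.
Context d (T : measurableType d) (R : realType) (mu : {measure set T -> \bar R}).
Variables (I : finType) (Y : I -> set T) (P : pred I).
Hypothesis mY : forall i, measurable (Y i).
Hypothesis tY : trivIset setT Y.

Let A := \bigcup_(i in [set i | P i]) Y i.

Lemma measurable_cells : measurable A.
Proof. by apply: fin_bigcup_measurable => //; exact: finite_finset. Qed.

Let fP : finite_set [set i | P i]. Proof. exact: finite_finset. Qed.

Lemma measure_cells : mu A = (\sum_(i | P i) mu (Y i))%E.
Proof.
rewrite measure_fin_bigcup//; last exact: sub_trivIset tY.
rewrite fsbig_finite//=; transitivity (\sum_(i <- enum P) mu (Y i))%E; last first.
  by rewrite big_enum.
apply: perm_big; apply: uniq_perm => [||i]; [exact: fset_uniq|exact: enum_uniq|].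
by rewrite mem_enum in_fset_set//; apply/idP/idP => [/set_mem//|Pi]; exact: mem_set.
Qed.

Lemma integral_cells (g : T -> R) (c : I -> R) : (forall i, P i -> 0 <= c i) ->
  (forall i x, P i -> Y i x -> g x = c i) ->
  (\int[mu]_(x in A) (g x)%:E = \sum_(i | P i) (c i)%:E * mu (Y i))%E.
Proof.
move=> c0 gc; pose c' i := if P i then c i else 0.
have c'0 i : 0 <= c' i by rewrite /c'; case: ifPn => // /c0.
transitivity (\int[mu]_(x in A) (\sum_(i <- enum P) ((c' i)%:E * (\1_(Y i) x)%:E)))%E.
  apply: eq_integral => x /[1!inE] -[i /= Pi Yix].
  rewrite (bigD1_seq i) ?mem_enum ?enum_uniq//= indicE mem_set// mule1.
  rewrite big1 ?adde0 /c' ?Pi ?(gc i)// => j ji.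
  rewrite indicE memNset ?mule0// => Yjx; move/eqP: ji; apply.
  by apply: tY => //; exists x.
rewrite ge0_integral_sum//; first last.
- by move=> i x _; rewrite mule_ge0// lee_fin.
- move=> i; apply: measurable_funeM; apply/measurable_EFinP; exact: measurable_indic.
- exact: measurable_cells.
rewrite big_enum /=; apply: eq_bigr => i iP; have Pi : P i by [].
have mA := measurable_cells.
rewrite ge0_integralZl_EFin//.
- rewrite integral_indic// /c' Pi; congr (_ * mu _)%E.
  by apply/setIidPl => x Yx; exists i.
- by apply/measurable_EFinP; exact: measurable_indic.
Qed.

End cells.

Section bochner_theory.
Context d (T : measurableType d) (R : realType) (E : completeNormedModType R).
Variable mu : {measure set T -> \bar R}.
Implicit Types (A B : set T) (f s : T -> E).

Lemma simple_integral_cells (I : finType) (Y : I -> set T) (P : pred I) s (v : I -> E) :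
  (forall i, measurable (Y i)) -> trivIset setT Y ->
  (forall i, P i -> (mu (Y i) < +oo)%E) -> simple_function s ->
  (forall i x, P i -> Y i x -> s x = v i) ->
  simple_integral mu (\bigcup_(i in [set i | P i]) Y i) s =
  \sum_(i | P i) fine (mu (Y i)) *: v i.
Proof.
move=> mY tY fY ss sv; rewrite /simple_integral fsbig_finite; last exact: ss.1.
set A := \bigcup_(i in _) _.
have fiber y : fine (mu (A `&` s @^-1` [set y])) = \sum_(i | P i && (v i == y)) fine (mu (Y i)).
  have -> : A `&` s @^-1` [set y] = \bigcup_(i in [set i | P i && (v i == y)]) Y i.
    apply/seteqP; split=> [x [[i /= Pi Yix] sx]|x [i /= /andP[Pi /eqP <-] Yix]].
      by exists i => //=; rewrite Pi -(sv i x)//=; apply/eqP.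
    by split; [exists i|exact: sv].
  rewrite measure_cells//= fine_sum// => i /andP[Pi _].
  by rewrite ge0_fin_numE// fY.
under eq_bigr do rewrite fiber scaler_suml.
rewrite (exchange_big_dep P) /=; last by move=> y i _ /andP[].
apply: eq_bigr => i Pi; rewrite Pi /=.
have [[x Yix]|Yi0] := pselect (Y i !=set0).
  rewrite (big_rem (v i)) /=; last first.
    by rewrite in_fset_set ?inE; [exists x => //; exact: sv|exact: ss.1].
  rewrite eqxx big_seq_cond big1 ?addr0// => y /andP[yr /eqP viy].
  by move: yr; rewrite -viy mem_rem_uniqF// fset_uniq.
have -> : Y i = set0 by apply/seteqP; split=> // x Yx; apply: Yi0; exists x.
by rewrite measure0 scale0r big1// => y _; rewrite scale0r.
Qed.

Section pair_cells.
Variables (s s' : T -> E) (A : set T).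
Hypotheses (ss : simple_function s) (ss' : simple_function s') (mA : measurable A).

Let K := fset_set (range s `*` range s').
Let Y (i : K) : set T := A `&` [set x | (s x, s' x) = val i].

Let mY i : measurable (Y i).
Proof. by apply: measurableI => //; exact: (simple_measurable2 (fun p => p = val i)). Qed.

Let tY : trivIset setT Y.
Proof. by move=> i j _ _ [x [[_ /= xi] [_ /= xj]]]; apply: val_inj; exact: etrans (esym xi) xj. Qed.

Let AY : A = \bigcup_(i in [set i | predT i]) Y i.
Proof.
apply/seteqP; split=> [x Ax|x [i _ []//]].
have xK : (s x, s' x) \in K.
  rewrite in_fset_set ?inE; first by split=> /=; exists x.
  by apply: finite_setX; [exact: ss.1|exact: ss'.1].
by exists [` xK]%fset.
Qed.

Let Ys i x : Y i x -> s x = (val i).1. Proof. by move=> [_ /= <-]. Qed.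
Let Ys' i x : Y i x -> s' x = (val i).2. Proof. by move=> [_ /= <-]. Qed.

Hypothesis fA : (mu A < +oo)%E.

Let fY i : (mu (Y i) < +oo)%E.
Proof. by apply: le_lt_trans fA; rewrite le_measure ?inE//; exact: subIsetl. Qed.

(** On the cells where both functions are constant this is the triangle inequality
    for finite sums. *)
Lemma simple_integral_diff_le :
  (`|simple_integral mu A s - simple_integral mu A s'|%:E <=
   \int[mu]_(x in A) `|s x - s' x|%:E)%E.
Proof.
rewrite AY (simple_integral_cells (v := fun i => (val i).1))//; last by move=> i x _ /Ys.
rewrite (simple_integral_cells (v := fun i => (val i).2))//; last by move=> i x _ /Ys'.
rewrite (integral_cells mu mY tY (c := fun i => `|(val i).1 - (val i).2|))//; last first.
  by move=> i x _ Yx; rewrite -(Ys Yx) -(Ys' Yx).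
rewrite -sumrB (eq_bigr (fun i => (fine (mu (Y i)) * `|(val i).1 - (val i).2|)%:E)).
  rewrite sumEFin lee_fin; apply: (le_trans (ler_norm_sum _ _ _)); apply: ler_sum => i _.
  by rewrite -scalerBr normrZ ger0_norm ?fine_ge0.
by move=> i _; rewrite muleC EFinM fineK// ge0_fin_numE.
Qed.

End pair_cells.

Section on_finite_set.
Variable A : set T.
Hypotheses (mA : measurable A) (fA : (mu A < +oo)%E).

Lemma simple_integral0 : simple_integral mu A (fun=> 0) = 0 :> E.
Proof.
have [f0 _] := @simple_cst _ T R E 0.
rewrite /simple_integral fsbig_finite// big_seq big1// => y; rewrite in_fset_set// inE.
by move=> [x _ <-]; rewrite scaler0.
Qed.

Lemma simple_integral_norm_le s : simple_function s ->
  (`|simple_integral mu A s|%:E <= \int[mu]_(x in A) `|s x|%:E)%E.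
Proof.
move=> ss; have := simple_integral_diff_le ss (simple_cst 0) mA fA.
by rewrite simple_integral0 subr0; under eq_integral do rewrite subr0.
Qed.

Let mEnorm f s : strongly_measurable A f -> simple_function s ->
  measurable_fun A (fun x => `|f x - s x|%:E).
Proof. by move=> mf ss; apply/measurable_EFinP; exact: strongly_measurable_norm. Qed.

Lemma simple_integral_approx f s s' : strongly_measurable A f ->
  simple_function s -> simple_function s' ->
  (`|simple_integral mu A s - simple_integral mu A s'|%:E <=
   \int[mu]_(x in A) `|f x - s x|%:E + \int[mu]_(x in A) `|f x - s' x|%:E)%E.
Proof.
move=> mf ss ss'; apply: (le_trans (simple_integral_diff_le ss ss' mA fA)).
have m1 := mEnorm mf ss; have m2 := mEnorm mf ss'.
rewrite -ge0_integralD//.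
apply: ge0_le_integral => //.
- by apply/measurable_EFinP; exact: (simple_measurable_fun2 (fun a b => `|a - b|)).
- exact: emeasurable_funD.
move=> x _; rewrite -EFinD lee_fin (distrC (f x) (s x)).
by rewrite (le_trans _ (ler_normD _ _))// addrA subrK.
Qed.

Lemma integrable_simpleT s : simple_function s -> integrable_simple mu A s.
Proof.
move=> ss; split=> // y _; apply: le_lt_trans fA; rewrite le_measure ?inE//.
by apply: measurableI => //; exact: ss.2.
Qed.

(** Any approximating sequence computes the integral, as two of them approach each
    other in [L^1]. *)
Lemma bochner_approx f v (s : nat -> T -> E) : is_bochner_integral mu A f v ->
  (forall n, simple_function (s n)) ->
  (\int[mu]_(x in A) `|f x - s n x|%:E)%E @[n --> \oo] --> 0%E ->
  simple_integral mu A (s n) @[n --> \oo] --> v.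
Proof.
move=> [mf [u [iu fu uv]]] ss fs; apply/cvgrPdist_le => e e0.
have e3 : 0 < e / 3 by rewrite divr_gt0.
have small (a : nat -> \bar R) : a n @[n --> \oo] --> 0%E -> \forall n \near \oo, (a n <= (e / 3)%:E)%E.
  move=> /fine_cvgP[fa /cvgrPdist_le /(_ _ e3)]; move: fa; apply: filterS2 => n fan.
  by rewrite sub0r normrN /= => /(le_trans (ler_norm _)); rewrite -lee_fin fineK.
move/cvgrPdist_le : uv => /(_ _ e3) uv.
near=> n.
have h1 : (\int[mu]_(x in A) `|f x - u n x|%:E <= (e / 3)%:E)%E by near: n; exact: small.
have h2 : (\int[mu]_(x in A) `|f x - s n x|%:E <= (e / 3)%:E)%E by near: n; exact: small.
have h3 : `|v - simple_integral mu A (u n)| <= e / 3 by near: n.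
have := le_trans (simple_integral_approx mf (iu n).1 (ss n)) (leeD h1 h2).
rewrite -EFinD lee_fin => h4.
rewrite -(subrK (simple_integral mu A (u n)) v) -addrA.
apply: (le_trans (ler_normD _ _)); apply: le_trans (lerD h3 h4) _.
by rewrite -!mulrDl ler_pdivrMr//; lra.
Unshelve. all: by end_near. Qed.

Lemma bochner_unique f v v' : is_bochner_integral mu A f v ->
  is_bochner_integral mu A f v' -> v = v'.
Proof.
move=> bv [mf [u [iu fu uv']]].
have uv := bochner_approx bv (fun n => (iu n).1) fu.
exact: (cvg_unique _ uv uv').
Qed.

Lemma bochner_integralE f v : is_bochner_integral mu A f v ->
  bochner_integral mu A f = v.
Proof.
by move=> bv; apply: (bochner_unique _ bv); apply: (@xgetPex E 0 (is_bochner_integral mu A f)); exists v.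
Qed.

Lemma bochner_norm_le f v : is_bochner_integral mu A f v ->
  (`|v|%:E <= \int[mu]_(x in A) `|f x|%:E)%E.
Proof.
move=> bv; have [mf [u [iu fu uv]]] := bv.
have [fi|] := ltP (\int[mu]_(x in A) `|f x|%:E)%E +oo%E; last first.
  by rewrite leye_eq => /eqP ->; rewrite leey.
have fi' : (\int[mu]_(x in A) `|f x|%:E)%E \is a fin_num.
  by rewrite ge0_fin_numE//; apply: integral_ge0 => x _; rewrite lee_fin.
have bound n : (`|simple_integral mu A (u n)|%:E <=
    \int[mu]_(x in A) `|f x|%:E + \int[mu]_(x in A) `|f x - u n x|%:E)%E.
  apply: le_trans (simple_integral_norm_le (iu n).1) _.
  have mn0 : measurable_fun A (fun x => `|f x|%:E).
    by apply/measurable_EFinP; exact: strongly_measurable_norm0.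
  have mn := mEnorm mf (iu n).1.
  rewrite -ge0_integralD//.
  apply: ge0_le_integral => //.
  - by apply/measurable_EFinP; exact: (simple_measurable_fun2 (fun a _ => `|a|) mA (iu n).1 (iu n).1).
  - exact: emeasurable_funD.
  move=> x _; rewrite -EFinD lee_fin addrC -lerBlDr.
  by rewrite (le_trans (lerB_dist _ _))// distrC.
have c1 : (`|simple_integral mu A (u n)|%:E)%E @[n --> \oo] --> `|v|%:E.
  by apply: cvg_EFin; [exact: nearW|exact: cvg_norm].
have c2 : (\int[mu]_(x in A) `|f x|%:E + \int[mu]_(x in A) `|f x - u n x|%:E)%E @[n --> \oo] -->
    (\int[mu]_(x in A) `|f x|%:E)%E.
  rewrite -[X in _ --> X]adde0; apply: cvgeD => //.
    by rewrite fin_num_adde_defr.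
  exact: cvg_cst.
by apply: (lee_cvg_to c1 c2); exact: nearW.
Qed.

(** The approximants [s n] are cut off where they exceed twice the limit, so that
    dominated convergence applies. *)
Lemma bochner_exists f : strongly_measurable A f ->
  (\int[mu]_(x in A) `|f x|%:E < +oo)%E -> exists v, is_bochner_integral mu A f v.
Proof.
move=> mf fi; have [s ss sf] := mf.
pose B n := A `&` [set x | `|s n x| <= 2 * `|f x|].
have mB n : measurable (B n).
  have m1 : measurable_fun A (fun x => `|s n x|).
    exact: (simple_measurable_fun2 (fun a _ => `|a|) mA (ss n) (ss n)).
  have m2 : measurable_fun A (fun x => 2 * `|f x|).
    by apply: measurable_funM => //; exact: strongly_measurable_norm0.
  exact: (measurable_fun_le mA m1 m2).
pose u n x := \1_(B n) x *: s n x.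
have su n : simple_function (u n) by exact: simple_indicZ.
have un x n : A x -> `|s n x| <= 2 * `|f x| -> u n x = s n x.
  by move=> Ax h; rewrite /u indicE mem_set ?scale1r.
have un0 x n : ~ (`|s n x| <= 2 * `|f x|) -> u n x = 0.
  by move=> h; rewrite /u indicE memNset ?scale0r// => -[].
have dom n x : A x -> `|f x - u n x| <= 3 * `|f x|.
  move=> Ax; have [h|h] := pselect (`|s n x| <= 2 * `|f x|).
    rewrite un//; apply: (le_trans (ler_normB _ _)).
    by move: h; set a := `|s n x|; set b := `|f x|; lra.
  rewrite un0// subr0; have := normr_ge0 (f x); set b := `|f x|; lra.
have cvgu x : A x -> (`|f x - u n x|%:E)%E @[n --> \oo] --> (0 : \bar R).
  move=> Ax; apply: cvg_EFin; first exact: nearW.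
  rewrite -[X in _ --> X](normr0 E); apply: cvg_norm.
  rewrite -[X in _ --> X](subrr (f x)); apply: cvgB; first exact: cvg_cst.
  have [fx0|fx0] := eqVneq (f x) 0.
    rewrite fx0; apply: cvg_near_cst; apply: nearW => n.
    have [h|h] := pselect (`|s n x| <= 2 * `|f x|); last exact: un0.
    rewrite un//; move: h; rewrite fx0 normr0 mulr0 normr_le0.
    by move=> /eqP.
  have fx : 0 < `|f x| by rewrite normr_gt0.
  have /cvgrPdist_le /(_ _ fx) near1 := sf x Ax.
  apply: cvg_trans (sf x Ax); apply: near_eq_cvg.
  move: near1; apply: filterS => n h; rewrite un//.
  rewrite -[s n x](subrK (f x)) (le_trans (ler_normD _ _))//.
  by rewrite distrC; move: h; set a := `|_ - _|; set b := `|f x|; lra.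
have m3 : measurable_fun A (fun x => (3 * `|f x|)%:E).
  apply/measurable_EFinP; apply: measurable_funM => //; exact: strongly_measurable_norm0.
have int3 : mu.-integrable A (fun x => (3 * `|f x|)%:E).
  apply/integrableP; split => //.
  under eq_integral do rewrite gee0_abs ?lee_fin ?mulr_ge0// EFinM.
  rewrite ge0_integralZl_EFin//; last first.
    by apply/measurable_EFinP; exact: strongly_measurable_norm0.
  by rewrite lte_mul_pinfty.
have cvg0 : (\int[mu]_(x in A) `|f x - u n x|%:E)%E @[n --> \oo] --> (0 : \bar R).
  have := @dominated_cvg _ _ _ mu A mA (fun n x => `|f x - u n x|%:E) (cst 0%E)
    (fun x => (3 * `|f x|)%:E) (fun n => mEnorm mf (su n)) cvgu _ int3.
  rewrite integral0; apply => // n x Ax.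
  by rewrite gee0_abs ?lee_fin//; exact: dom.
have cau : cauchy (simple_integral mu A (u n) @[n --> \oo]).
  apply/cauchy_ballP => e e0.
  have e3 : 0 < e / 3 by rewrite divr_gt0.
  have small : \forall n \near \oo, (\int[mu]_(x in A) `|f x - u n x|%:E <= (e / 3)%:E)%E.
    move/fine_cvgP : cvg0 => [fa /cvgrPdist_le /(_ _ e3)]; move: fa; apply: filterS2 => n fan.
    by rewrite sub0r normrN /= => /(le_trans (ler_norm _)); rewrite -lee_fin fineK.
  exists ((fun n => simple_integral mu A (u n)) @` [set n | (\int[mu]_(x in A) `|f x - u n x|%:E <= (e / 3)%:E)%E],
          (fun n => simple_integral mu A (u n)) @` [set n | (\int[mu]_(x in A) `|f x - u n x|%:E <= (e / 3)%:E)%E]).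
    split; rewrite /= /nbhs /=; move: small; apply: filterS => n h; by exists n.
  move=> [_ _] [[n /= hn <-] [m /= hm <-]]; rewrite -ball_normE /=.
  have := le_trans (simple_integral_approx mf (su n) (su m)) (leeD hn hm).
  rewrite -EFinD lee_fin => /le_lt_trans; apply.
  by rewrite -mulrDl ltr_pdivrMr//; lra.
have /cauchy_cvgP cu := cau.
exists (lim (simple_integral mu A (u n) @[n --> \oo])); split => //.
by exists u; split=> // n; exact: integrable_simpleT.
Qed.

End on_finite_set.

Lemma bochner_integralP A f : measurable A -> (mu A < +oo)%E -> strongly_measurable A f ->
  (\int[mu]_(x in A) `|f x|%:E < +oo)%E ->
  is_bochner_integral mu A f (bochner_integral mu A f).
Proof.
move=> mA fA mf fi; have [v bv] := bochner_exists mA fA mf fi.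
rewrite (bochner_integralE mA fA bv); exact: bv.
Qed.

Lemma bochner_simple A s : measurable A -> (mu A < +oo)%E -> simple_function s ->
  bochner_integral mu A s = simple_integral mu A s.
Proof.
move=> mA fA ss; apply: bochner_integralE => //; split.
  exact: simple_strongly_measurable.
exists (fun=> s); split => //; first by move=> n; exact: integrable_simpleT.
  under eq_fun do under eq_integral do rewrite subrr normr0.
  by rewrite integral0; exact: cvg_cst.
exact: cvg_cst.
Qed.

Section additivity.
Variables (I : finType) (Y : I -> set T) (P : pred I).
Hypothesis mY : forall i, measurable (Y i).
Hypothesis tY : trivIset setT Y.
Variable A : set T.
Hypothesis AY : A = \bigcup_(i in [set i | P i]) Y i.
Hypothesis fA : (mu A < +oo)%E.

Let mA : measurable A. Proof. by rewrite AY; exact: measurable_cells. Qed.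

Let YA i : P i -> Y i `<=` A. Proof. by rewrite AY => Pi x Yx; exists i. Qed.

Let fY i : P i -> (mu (Y i) < +oo)%E.
Proof. by move=> Pi; apply: le_lt_trans fA; rewrite le_measure ?inE//; exact: YA. Qed.

Lemma simple_integral_additive s : simple_function s ->
  simple_integral mu A s = \sum_(i | P i) simple_integral mu (Y i) s.
Proof.
move=> ss; have fsE (B : set T) : simple_integral mu B s =
    \sum_(y <- fset_set (range s)) fine (mu (B `&` s @^-1` [set y])) *: y.
  by rewrite /simple_integral fsbig_finite//; exact: ss.1.
under [RHS]eq_bigr do rewrite fsE.
rewrite fsE exchange_big /=; apply: eq_bigr => y _.
rewrite -scaler_suml; congr (_ *: _).
have -> : A `&` s @^-1` [set y] = \bigcup_(i in [set i | P i]) (Y i `&` s @^-1` [set y]).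
  by rewrite AY setI_bigcupl.
have mYs i : measurable (Y i `&` s @^-1` [set y]) by apply: measurableI => //; exact: ss.2.
rewrite measure_cells//.
  rewrite fine_sum// => i Pi; rewrite ge0_fin_numE//.
  by apply: le_lt_trans (fY Pi); rewrite le_measure ?inE//; exact: subIsetl.
move=> i j _ _ [x [[Yi _] [Yj _]]]; apply: tY => //; by exists x.
Qed.

Lemma bochner_additive f : strongly_measurable A f ->
  (\int[mu]_(x in A) `|f x|%:E < +oo)%E ->
  bochner_integral mu A f = \sum_(i | P i) bochner_integral mu (Y i) f.
Proof.
move=> mf fi; have bA := bochner_integralP mA fA mf fi.
have [_ [u [iu fu uA]]] := bA.
have mfE : measurable_fun A (fun x => `|f x|%:E).
  by apply/measurable_EFinP; exact: strongly_measurable_norm0.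
have bY i : P i -> is_bochner_integral mu (Y i) f (bochner_integral mu (Y i) f).
  move=> Pi; apply: bochner_integralP => //; first exact: fY.
    exact: strongly_measurable_subset (YA Pi) mf.
  by apply: le_lt_trans fi; apply: ge0_subset_integral => //; exact: YA.
have uY i : P i -> simple_integral mu (Y i) (u n) @[n --> \oo] --> bochner_integral mu (Y i) f.
  move=> Pi; apply: (bochner_approx (mY i) (fY Pi) (bY i Pi)) => [n|]; first exact: (iu n).1.
  apply: (@squeeze_cvge _ _ _ _ (cst 0%E) _ (fun n => (\int[mu]_(x in A) `|f x - u n x|%:E)%E)).
  - apply: nearW => n; apply/andP; split; first by apply: integral_ge0 => x _; rewrite lee_fin.
    apply: ge0_subset_integral => //; last exact: YA.
    by apply/measurable_EFinP; apply: strongly_measurable_norm => //; exact: (iu n).1.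
  - exact: cvg_cst.
  - exact: fu.
have sA : simple_integral mu A (u n) @[n --> \oo] --> \sum_(i | P i) bochner_integral mu (Y i) f.
  under eq_fun do rewrite (simple_integral_additive (iu _).1).
  exact: cvgn_sum.
exact: (cvg_unique _ uA sA).
Qed.

End additivity.

Lemma eq_bochner_integral A f g : (forall x, A x -> f x = g x) ->
  bochner_integral mu A f = bochner_integral mu A g.
Proof.
move=> fg; rewrite /bochner_integral; congr xget; apply/funext => v.
have sub (f1 f2 : T -> E) : (forall x, A x -> f1 x = f2 x) ->
    is_bochner_integral mu A f1 v -> is_bochner_integral mu A f2 v.
  move=> f12 [[u su uf] [s [is_ fs sv]]]; split.
    by exists u => // x Ax; rewrite -f12//; exact: uf.
  exists s; split => //; apply: cvg_trans fs; apply: near_eq_cvg; apply: nearW => n.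
  by apply: eq_integral => x; rewrite inE => Ax; rewrite f12.
apply/propext; split; apply: sub => // x Ax; by rewrite fg.
Qed.

Lemma LE_normE (q : R) A f : 0 < q ->
  LE_norm mu q%:E A f = ((\int[mu]_(x in A) (`|f x| `^ q)%:E) `^ q^-1)%E.
Proof.
move=> q0; rewrite /LE_norm unlock /Lnorm [in RHS]integral_mkcond; congr (_ `^ _)%E.
apply: eq_integral => x _; rewrite !patchE; case: ifPn => _.
  by rewrite abse_EFin normr_id poweR_EFin.
by rewrite abse0 poweR_EFin powR0// gt_eqF.
Qed.

End bochner_theory.

(** * Geometry of dyadic cubes *)
Section dyadic_cubes.
Variables (R : realType) (d : nat).
Implicit Types (Q S : dyadic_cube d) (x y : 'rV[R]_d) (k : int).

Notation cube := (@cube R d).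

(** The cubes of generation [k] are the fibres of this map. *)
Definition cube_index k x : {ffun 'I_d -> int} :=
  [ffun i => Num.floor (x ord0 i * 2 ^ k)].

Lemma cubeP Q x : cube Q x <-> cube_index Q.1 x = Q.2.
Proof.
have s0 : (0 : R) < 2 ^ Q.1 by rewrite exprz_gt0.
have e i : (Num.floor (x ord0 i * 2 ^ Q.1) == Q.2 i) =
    ((Q.2 i)%:~R * 2 ^ (- Q.1) <= x ord0 i < (Q.2 i + 1)%:~R * 2 ^ (- Q.1)).
  by rewrite floor_eq -invr_expz ler_pdivrMr// ltr_pdivlMr.
split=> [xQ|xQ i]; last by rewrite -e -xQ ffunE.
by apply/ffunP => i; rewrite ffunE; apply/eqP; rewrite e; exact: xQ.
Qed.

Lemma cube_index_mem k x : cube (k, cube_index k x) x.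
Proof. exact/cubeP. Qed.

Lemma floor_halve (a b : R) : Num.floor (a * 2) = Num.floor (b * 2) ->
  Num.floor a = Num.floor b.
Proof.
move=> ab; apply/esym/floor_def; set m := Num.floor a.
have [/andP[ma am] bfl] := (floor_itv a, floor_itv (b * 2)).
rewrite -ab in bfl; set n := Num.floor (a * 2) in bfl.
have mn : m * 2 <= n.
  by rewrite floor_ge_int intrM ler_pM2r.
have nm : n < (m + 1) * 2.
  by rewrite floor_lt_int intrM ltr_pM2r.
have mn' : (m * 2)%:~R <= (n%:~R : R) by rewrite ler_int.
have nm' : (n + 1)%:~R <= (((m + 1) * 2)%:~R : R).
  by rewrite ler_int; move: nm; rewrite -lezD1.
move: bfl => /andP[nb bn]; apply/andP; split.
  by have := le_trans mn' nb; rewrite intrM ler_pM2r.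
by have := lt_le_trans bn nm'; rewrite intrM ltr_pM2r.
Qed.

Lemma cube_index_coarsen k (n : nat) x y : cube_index (k + n%:Z) x = cube_index (k + n%:Z) y ->
  cube_index k x = cube_index k y.
Proof.
elim: n => [|n IHn]; first by rewrite addr0.
move=> xy; apply: IHn; apply/ffunP => i; rewrite !ffunE; apply: floor_halve.
have := congr1 (fun f : {ffun 'I_d -> int} => f i) xy; rewrite !ffunE.
rewrite intS (addrC 1) addrA expfzDr ?pnatr_eq0// expr1z !mulrA; exact.
Qed.

Lemma cube_index_le k k' x y : k <= k' -> cube_index k' x = cube_index k' y ->
  cube_index k x = cube_index k y.
Proof.
move=> kk'; have -> : k' = k + `|k' - k|%N%:Z.
  by rewrite gez0_abs ?subr_ge0// subrKC.
exact: cube_index_coarsen.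
Qed.

Lemma cube_nested Q S x : Q.1 <= S.1 -> cube Q x -> cube S x -> cube S `<=` cube Q.
Proof.
move=> QS /cubeP xQ /cubeP xS y /cubeP yS; apply/cubeP; rewrite -xQ.
by apply: (cube_index_le QS); rewrite yS.
Qed.

Lemma cube_inj_level Q S x : Q.1 = S.1 -> cube Q x -> cube S x -> Q = S.
Proof.
case: Q S => [k m] [k' m'] /= <- /cubeP /= xm /cubeP /= xm'.
by rewrite -xm -xm'.
Qed.

Definition corner Q : 'rV[R]_d := \row_i ((Q.2 i)%:~R * 2 ^ (- Q.1)).

Lemma corner_mem Q : cube Q (corner Q).
Proof.
by move=> i; rewrite mxE lexx/= ltr_pM2r ?exprz_gt0// ltr_int ltzD1.
Qed.

Definition dyadic_child (e : {ffun 'I_d -> bool}) Q : dyadic_cube d :=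
  (Q.1 + 1, [ffun i => Q.2 i * 2 + (e i : nat)%:Z]).

Lemma dyadic_child_inj Q : injective (dyadic_child^~ Q).
Proof.
move=> e e' [] /ffunP ee'; apply/ffunP => i; have := ee' i; rewrite !ffunE.
by move/addrI; case: (e i) (e' i) => -[].
Qed.

Lemma dyadic_child_sub e Q : cube (dyadic_child e Q) `<=` cube Q.
Proof.
move=> x /cubeP /ffunP xe; apply/cubeP/ffunP => i; have := xe i; rewrite !ffunE /=.
rewrite expfzDr ?pnatr_eq0// expr1z mulrA; set a := x ord0 i * 2 ^ Q.1 => h.
have /andP[lo hi] := floor_itv (a * 2); rewrite h in lo hi.
apply: floor_def; set m := Q.2 i in lo hi *; apply/andP; split.
  rewrite -(ler_pM2r (_ : 0 < 2))//; apply: le_trans lo.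
  rewrite (_ : m%:~R * 2 = (m * 2)%:~R); last by rewrite intrM.
  by rewrite ler_int lerDl.
rewrite -(ltr_pM2r (_ : 0 < 2))//; apply: (lt_le_trans hi).
rewrite (_ : (m + 1)%:~R * 2 = ((m + 1) * 2)%:~R); last by rewrite intrM.
rewrite ler_int mulrDl mul1r -addrA lerD2l.
by case: (e i).
Qed.

Lemma dyadic_child_cover Q x : cube Q x -> exists e, cube (dyadic_child e Q) x.
Proof.
move=> /cubeP /ffunP xQ.
pose e := [ffun i => cube_index (Q.1 + 1) x i == Q.2 i * 2 + 1].
exists e; apply/cubeP/ffunP => i; have := xQ i; rewrite !ffunE /=.
rewrite expfzDr ?pnatr_eq0// expr1z mulrA; set a := x ord0 i * 2 ^ Q.1 => h.
have /andP[lo hi] := floor_itv a; rewrite h in lo hi.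
have lo' : Q.2 i * 2 <= Num.floor (a * 2).
  by rewrite floor_ge_int intrM ler_pM2r.
have hi' : Num.floor (a * 2) < (Q.2 i + 1) * 2.
  by rewrite floor_lt_int intrM ltr_pM2r.
case: eqP => [-> //|ne]; rewrite addr0; apply/eqP; rewrite eq_le lo' andbT.
move: hi' ne; set z := Num.floor _; rewrite mulrDl mul1r => hi' /eqP ne.
have : z < Q.2 i * 2 + 1.
  by rewrite lt_neqAle; apply/andP; split => //; rewrite -ltzD1 -addrA.
by rewrite ltzD1.
Qed.

Lemma trivIset_children Q : trivIset setT (fun e => cube (dyadic_child e Q)).
Proof.
move=> e e' _ _ [x [xe xe']]; apply: (@dyadic_child_inj Q).
exact: (cube_inj_level _ xe xe').
Qed.

Lemma cube_children Q : cube Q = \bigcup_e cube (dyadic_child e Q).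
Proof.
apply/seteqP; split=> [x /dyadic_child_cover[e xe]|x [e _]]; first by exists e.
exact: dyadic_child_sub.
Qed.

Lemma measurable_cube Q : measurable (cube Q).
Proof.
have -> : cube Q = \bigcap_i (fun v : 'rV[R]_d => v ord0 i) @^-1`
    `[(Q.2 i)%:~R * 2 ^ (- Q.1), (Q.2 i + 1)%:~R * 2 ^ (- Q.1)[%classic.
  apply/seteqP; split=> v H i; first by move=> _; rewrite /= in_itv; exact: H.
  by have := H i I; rewrite /= in_itv.
apply: fin_bigcap_measurable => // i _.
by rewrite -[X in measurable X]setTI; exact: measurable_rV_coord.
Qed.

Lemma lebesgue_cube Q : lebesgue_rV R d (cube Q) = ((2 ^ (- Q.1)) ^+ d)%:E.
Proof.
rewrite /Defs.cube lebesgue_rV_box => [|i]; last first.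
  by rewrite ler_pM2r ?exprz_gt0// ler_int lerDl.
congr (_%:E); under eq_bigr do rewrite intrD mulrDl addrC addKr mul1r.
by rewrite prodr_const card_ord.
Qed.

Lemma lebesgue_cube_gt0 Q : 0 < fine (lebesgue_rV R d (cube Q)).
Proof. by rewrite lebesgue_cube /= exprn_gt0// exprz_gt0. Qed.

Lemma lebesgue_child e Q : fine (lebesgue_rV R d (cube (dyadic_child e Q))) =
  fine (lebesgue_rV R d (cube Q)) / (2 ^ d)%:R.
Proof.
rewrite !lebesgue_cube /= opprD expfzDr ?pnatr_eq0// exprMn natrX; congr (_ * _).
by rewrite -invr_expz expr1z exprVn.
Qed.

Section refinement.
Variables (D : {fset dyadic_cube d}) (N : int).
Hypothesis DN : forall Q, Q \in D -> Q.1 <= N.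

(** Every descendant down to generation [N] is kept, so that each cube is a union of
    cubes of that generation and the passage to the parent stays in the family. *)
Definition refined : set (dyadic_cube d) :=
  [set Q | exists2 S, S \in D & [/\ S.1 <= Q.1, Q.1 <= N & cube Q `<=` cube S]].

Lemma refined_sub Q : Q \in D -> refined Q.
Proof. by move=> QD; exists Q => //; split => //; exact: DN. Qed.

Lemma refined_closed Q S : refined Q -> Q.1 <= S.1 -> S.1 <= N -> cube S `<=` cube Q ->
  refined S.
Proof.
move=> [Q0 Q0D [Q0Q _ sub]] QS SN SQ; exists Q0 => //; split => //.
  exact: le_trans QS.
exact: subset_trans sub.
Qed.

Lemma finite_descendants S (n : nat) :
  finite_set [set Q | Q.1 = S.1 + n%:Z /\ cube Q `<=` cube S].
Proof.
elim: n => [|n IHn].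
  apply: (@sub_finite_set _ _ [set S]); last exact: finite_set1.
  move=> Q /= [QS sub]; apply: (cube_inj_level _ (corner_mem Q)).
    by rewrite QS addr0.
  exact/sub/corner_mem.
pose pairs := [set Q | Q.1 = S.1 + n%:Z /\ cube Q `<=` cube S] `*` [set: {ffun 'I_d -> bool}].
apply: (@sub_finite_set _ _ ((fun p => dyadic_child p.2 p.1) @` pairs)); last first.
  by apply: finite_image; apply: finite_setX => //; exact: finite_finset.
move=> Q /= [QS sub]; pose x := corner Q.
have xQ : cube Q x by exact: corner_mem.
pose Q' : dyadic_cube d := (S.1 + n%:Z, cube_index (S.1 + n%:Z) x).
have xQ' : cube Q' x by exact: cube_index_mem.
have [e xe] := dyadic_child_cover xQ'.
exists (Q', e) => /=; last first.
  by apply: (cube_inj_level _ xe xQ); rewrite /= QS intS (addrC 1) addrA.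
split=> //=; split=> //; apply: (cube_nested _ (sub _ xQ) xQ') => /=.
by rewrite lerDl.
Qed.

Lemma finite_refined : finite_set refined.
Proof.
apply: (@sub_finite_set _ _ (\bigcup_(S in [set` D]) \bigcup_(n in `I_(`|N - S.1|.+1)%N)
    [set Q | Q.1 = S.1 + n%:Z /\ cube Q `<=` cube S])).
  move=> Q [S SD [SQ QN sub]]; exists S => //; exists `|Q.1 - S.1|%N.
    rewrite /= ltnS -lez_nat !gez0_abs ?subr_ge0 ?lerD2r//; exact: le_trans QN.
  by split => //; rewrite gez0_abs ?subr_ge0// subrKC.
apply: bigcup_finite; first exact: finite_fset.
move=> S _; apply: bigcup_finite; first exact: finite_II.
move=> n _; exact: finite_descendants.
Qed.

Lemma refined_leaf Q x : refined Q -> cube Q x ->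
  exists2 S, refined S & S.1 = N /\ cube S x.
Proof.
move=> rQ xQ; have [_ _ [_ QN _]] := rQ.
exists (N, cube_index N x); last by split => //; exact: cube_index_mem.
apply: (refined_closed rQ) => //=.
exact: (cube_nested _ xQ (cube_index_mem _ _)).
Qed.

(** Each coordinate contributes a factor two, so in positive dimension the parent
    contains a second child. *)
Lemma refined_parent (d0 : (0 < d)%N) Q S : refined Q -> refined S ->
  cube Q `<=` cube S -> ~ (cube S `<=` cube Q) ->
  exists Q', [/\ refined Q', Q'.1 + 1 = Q.1, cube Q `<=` cube Q', cube Q' `<=` cube S &
    ~ (cube Q' `<=` cube Q)].
Proof.
move=> rQ rS QS SQ; have [_ _ [_ QN _]] := rQ.
pose x := corner Q; have xQ : cube Q x by exact: corner_mem.
have SQ1 : S.1 < Q.1.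
  rewrite ltNge; apply/negP => h; apply: SQ; exact: (cube_nested h xQ (QS _ xQ)).
have SQ1' : S.1 <= Q.1 - 1 by rewrite -lezD1 in SQ1; rewrite lerBrDr.
have Q1 : Q.1 - 1 <= Q.1 by rewrite gerBl.
pose Q' : dyadic_cube d := (Q.1 - 1, cube_index (Q.1 - 1) x).
have xQ' : cube Q' x by exact: cube_index_mem.
have Q'S : cube Q' `<=` cube S by apply: (@cube_nested S Q' x) => //; exact: QS.
exists Q'; split => //.
- by apply: (refined_closed rS) => //=; exact: le_trans QN.
- by rewrite subrK.
- exact: (@cube_nested Q' Q x).
move=> sub; pose c b : dyadic_cube d := dyadic_child [ffun _ => b] Q'.
have cQ b : c b = Q.
  apply: (cube_inj_level _ (corner_mem _)); first by rewrite /= subrK.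
  by apply: sub; apply: dyadic_child_sub; exact: corner_mem.
have /dyadic_child_inj/ffunP/(_ (Ordinal d0)) : c true = c false by rewrite !cQ.
by rewrite !ffunE.
Qed.

End refinement.

Section measures.
Variable mu : {measure set 'rV[R]_d -> \bar R}.

(** The closure of a cube is compact. *)
Lemma locally_finite_cube Q : locally_finite mu -> (mu (cube Q) < +oo)%E.
Proof.
move=> lf; have /choice[U Uo] : forall x : 'rV[R]_d, exists U : set 'rV[R]_d,
    open_nbhs x U /\ (mu U < +oo)%E.
  by move=> x; have [U xU fU] := lf x; exists U.
pose box : set 'rV[R]_d := [set v | forall i, `[(Q.2 i)%:~R * 2 ^ (- Q.1),
  (Q.2 i + 1)%:~R * 2 ^ (- Q.1)]%classic (v ord0 i)].
have cbox : compact box.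
  have := @rV_compact R d (fun i => `[(Q.2 i)%:~R * 2 ^ (- Q.1),
    (Q.2 i + 1)%:~R * 2 ^ (- Q.1)]%classic); apply => i.
  exact: segment_compact.
have Qbox : cube Q `<=` box.
  by move=> x xQ i; have /andP[lo hi] := xQ i; rewrite /= in_itv/= lo ltW.
have [F _ covF] : finite_subset_cover setT U box.
  move: cbox; rewrite compact_cover; apply => [x _|x _]; first by have [[]] := Uo x.
  by exists x => //; have [[]] := Uo x.
have mU x : measurable (U x) by apply: rV_open_measurable; have [[]] := Uo x.
have [mB fB] : measurable (\big[setU/set0]_(x <- F) U x) /\
    (mu (\big[setU/set0]_(x <- F) U x) < +oo)%E.
  elim: (F : seq _) => [|x s [mB fB]]; first by rewrite big_nil measure0.
  rewrite big_cons; split; first exact: measurableU.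
  apply: le_lt_trans (measureU2 _ _ _) _ => //; apply: lte_add_pinfty => //.
  by have [] := Uo x.
apply: le_lt_trans fB; apply: le_measure; rewrite ?inE//; first exact: measurable_cube.
by move=> x /Qbox /covF [y yF Uy]; rewrite -bigcup_seq; exists y.
Qed.

Definition cube_center Q : 'rV[R]_d :=
  \row_i (((Q.2 i)%:~R + 2^-1) * 2 ^ (- Q.1)).

Lemma euclidean_ballE x (r : R) : 0 < r ->
  euclidean_ball x r = [set y | \sum_(i < d) (y ord0 i - x ord0 i) ^+ 2 < r ^+ 2].
Proof.
move=> r0; apply/seteqP; split=> y /=; set X := \sum_(i < d) _.
  move=> h; have X0 : 0 <= X by apply: sumr_ge0 => i _; exact: sqr_ge0.
  rewrite -(sqr_sqrtr X0) ltrXn2r// ?nnegrE ?sqrtr_ge0//; exact: ltW.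
have X0 : 0 <= X by apply: sumr_ge0 => i _; exact: sqr_ge0.
by move=> h; rewrite /euclidean_ball /= -(gtr0_norm r0) -sqrtr_sqr ltr_sqrt// exprn_gt0.
Qed.

Lemma measurable_euclidean_ball x (r : R) : 0 < r -> measurable (euclidean_ball x r).
Proof.
move=> r0; rewrite euclidean_ballE//.
have mf : measurable_fun setT (fun y : 'rV[R]_d => \sum_(i < d) (y ord0 i - x ord0 i) ^+ 2).
  apply: measurable_sum => i; apply: measurable_funX; apply: measurable_funB => //.
  exact: measurable_rV_coord.
rewrite [X in measurable X](_ : _ = setT `&` (fun y : 'rV[R]_d =>
  \sum_(i < d) (y ord0 i - x ord0 i) ^+ 2) @^-1` `]-oo, (r ^+ 2)[%classic).
  by apply: mf => //; exact: measurable_itv.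
by rewrite setTI; apply/seteqP; split => y /=; rewrite in_itv.
Qed.

(** A cube contains the ball of half its side around its centre; its parent lies in
    a ball larger by a power of two that depends on the dimension only. *)
Lemma doubling_parent : doubling mu -> exists2 K : R, 1 <= K & forall Q Q',
  Q'.1 + 1 = Q.1 -> cube Q `<=` cube Q' -> (mu (cube Q') <= K%:E * mu (cube Q))%E.
Proof.
move=> [K0 dbl0]; pose K := Num.max K0 1.
have K1 : 1 <= K by rewrite le_max lexx orbT.
have Kge0 : 0 <= K by exact: le_trans K1.
exists (K ^+ (4 * d + 1)) => [|Q Q' QQ' sub]; first by rewrite exprn_ege1.
pose c := cube_center Q; pose s : R := 2 ^ (- Q.1).
have s0 : 0 < s by rewrite exprz_gt0.
have s20 : 0 < s / 2 by rewrite divr_gt0.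
have iter n : (mu (euclidean_ball c (2 ^+ n * (s / 2))) <=
    (K ^+ n)%:E * mu (euclidean_ball c (s / 2)))%E.
  elim: n => [|n IHn]; first by rewrite !expr0 mul1r mul1e.
  have [_ h _] := dbl0 c (2 ^+ n * (s / 2)) (mulr_gt0 (exprn_gt0 _ (ltr0Sn _ _)) s20).
  rewrite exprS -mulrA; apply: (le_trans h); rewrite exprS EFinM -muleA.
  apply: (@le_trans _ _ (K%:E * mu (euclidean_ball c (2 ^+ n * (s / 2))))%E).
    by rewrite lee_wpmul2r// lee_fin le_max lexx.
  by rewrite lee_wpmul2l// lee_fin.
have inner : euclidean_ball c (s / 2) `<=` cube Q.
  rewrite euclidean_ballE// => y /= hy i.
  have : (y ord0 i - c ord0 i) ^+ 2 < (s / 2) ^+ 2.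
    apply: le_lt_trans hy; rewrite (bigD1 i) //= lerDl.
    by apply: sumr_ge0 => j _; exact: sqr_ge0.
  rewrite -ltr_sqrt ?exprn_gt0// !sqrtr_sqr (gtr0_norm s20) ltr_norml mxE -/s.
  rewrite intrD => /andP[]; set m := (Q.2 i)%:~R; set yi := y ord0 i => h1 h2.
  have e : (m + 2^-1) * s = m * s + s / 2 by rewrite mulrDl (mulrC s).
  rewrite e in h1 h2; rewrite mulrDl mul1r; apply/andP; split; lra.
have r0 : 0 < 2 ^+ (4 * d + 1) * (s / 2) by rewrite mulr_gt0// exprn_gt0.
have outer : cube Q' `<=` euclidean_ball c (2 ^+ (4 * d + 1) * (s / 2)).
  rewrite euclidean_ballE// => y yQ' /=.
  have cQ : cube Q c.
    apply: inner; rewrite euclidean_ballE//= big1 ?exprn_gt0// => i _.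
    by rewrite subrr expr0n.
  have s' : 2 ^ (- Q'.1) = 2 * s.
    have -> : Q'.1 = Q.1 - 1 by rewrite -QQ' addrK.
    by rewrite opprB expfzDr ?pnatr_eq0// expr1z mulrC /s mulrC.
  have cy (i : 'I_d) : (y ord0 i - c ord0 i) ^+ 2 <= (2 * s) ^+ 2.
    have s2 : 0 <= 2 * s by rewrite mulr_ge0// ltW.
    rewrite -(real_normK (num_real _)) lerXn2r ?nnegrE//.
    have := yQ' i; have := sub _ cQ i; rewrite s'.
    have -> : (Q'.2 i + 1)%:~R * (2 * s) = (Q'.2 i)%:~R * (2 * s) + 2 * s.
      by rewrite intrD; ring.
    set m := (Q'.2 i)%:~R * _; set yi := y ord0 i; set ci := c ord0 i.
    move=> /andP[h1 h2] /andP[h3 h4]; rewrite ler_norml; apply/andP; split; lra.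
  apply: (@le_lt_trans _ _ (d%:R * (2 * s) ^+ 2)).
    rewrite mulr_natl -[X in _ *+ X]card_ord -sumr_const; exact: ler_sum.
  have -> : (2 ^+ (4 * d + 1) * (s / 2)) ^+ 2 = (2 ^+ (4 * d)) ^+ 2 / 4 * (2 * s) ^+ 2.
    by rewrite exprD expr1; field.
  rewrite ltr_pM2r ?exprn_gt0 ?mulr_gt0// ltr_pdivlMr//.
  rewrite -natrX -[4]/(4%:R) -natrM -natrX ltr_nat.
  apply: (@leq_trans (2 ^ (4 * d))); first by rewrite mulnC; exact: ltn_expl.
  by rewrite -mulnn leq_pmulr// expn_gt0.
have mQ' := measurable_cube Q'; have mQ := measurable_cube Q.
apply: (@le_trans _ _ (mu (euclidean_ball c (2 ^+ (4 * d + 1) * (s / 2))))).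
  by apply: le_measure => //; rewrite inE//; exact: measurable_euclidean_ball.
apply: (le_trans (iter _)); apply: lee_wpmul2l; first by rewrite lee_fin exprn_ge0.
by apply: le_measure => //; rewrite inE//; exact: measurable_euclidean_ball.
Qed.

End measures.
End dyadic_cubes.

(** * Integrals over finitely many cells *)
Section integral_tools.
Context d (T : measurableType d) (R : realType) (mu : {measure set T -> \bar R}).

Lemma ge0_integral_cells (I : finType) (Y : I -> set T) (P : pred I) (g : T -> \bar R) :
  (forall i, measurable (Y i)) -> trivIset setT Y -> (forall x, 0 <= g x)%E ->
  measurable_fun (\bigcup_(i in [set i | P i]) Y i) g ->
  (\int[mu]_(x in \bigcup_(i in [set i | P i]) Y i) g x =
   \sum_(i | P i) \int[mu]_(x in Y i) g x)%E.
Proof.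
move=> mY tY g0; have -> : \bigcup_(i in [set i | P i]) Y i = \big[setU/set0]_(i <- enum P) Y i.
  rewrite -bigcup_seq; congr bigcup; apply/seteqP.
  by split => i /=; rewrite mem_enum.
move=> mg; rewrite ge0_integral_bigsetU//; [by rewrite big_enum|exact: enum_uniq|].
exact: sub_trivIset tY.
Qed.

Lemma LE_norm_poweR (E : completeNormedModType R) (q : R) A (f : T -> E) : 0 < q ->
  (LE_norm mu q%:E A f `^ q = \int[mu]_(x in A) (`|f x| `^ q)%:E)%E.
Proof.
move=> q0; rewrite LE_normE// -poweRrM mulVf ?gt_eqF// poweRe1//.
by apply: integral_ge0 => x _; rewrite lee_fin powR_ge0.
Qed.

Lemma poweR_mono (q : R) (x y : \bar R) : 0 <= q -> (0 <= x)%E -> (x <= y)%E ->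
  (x `^ q <= y `^ q)%E.
Proof.
move=> q0 x0 xy; apply: gt0_ler_poweR => //; rewrite in_itv/= ?leey ?andbT//.
exact: le_trans xy.
Qed.

Lemma simple_bounded (E : completeNormedModType R) (s : T -> E) : simple_function s ->
  exists2 C : R, 0 <= C & forall x, `|s x| <= C.
Proof.
move=> [fs _]; exists (\sum_(y <- fset_set (range s)) `|y|); first exact: sumr_ge0.
move=> x; rewrite (bigD1_seq (s x)) ?fset_uniq//=; last first.
  by rewrite in_fset_set// inE; exists x.
by rewrite lerDl sumr_ge0.
Qed.

Lemma simple_integrable (E : completeNormedModType R) A (s : T -> E) :
  measurable A -> (mu A < +oo)%E -> simple_function s ->
  (\int[mu]_(x in A) `|s x|%:E < +oo)%E.
Proof.
move=> mA fA ss; have [C C0 sC] := simple_bounded ss.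
apply: (@le_lt_trans _ _ (\int[mu]_(x in A) (cst C%:E x))%E).
  apply: ge0_le_integral => //; last by move=> x _; rewrite lee_fin.
  by apply/measurable_EFinP; exact: (simple_measurable_fun2 (fun a _ => `|a|) mA ss ss).
by rewrite integral_cst// lte_mul_pinfty.
Qed.

Lemma measurable_norm_powR (f : T -> R) A (q : R) : measurable_fun A f ->
  measurable_fun A (fun x => (f x `^ q)%:E).
Proof. by move=> mf; apply/measurable_EFinP; exact: (measurableT_comp (measurable_powR q) mf). Qed.

End integral_tools.

(** * Trees as step functions on Lebesgue cubes *)
Section lebesgue_trees.
Variables (R : realType) (d : nat) (E : banachLatticeType R).
Hypothesis d_gt0 : (0 < d)%N.

Local Notation leb := (lebesgue_rV R d).
Local Notation cube := (@cube R d).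
Local Notation b := #|{: {ffun 'I_d -> bool}}|.
Local Notation tree := (tree E b).
Implicit Types (t : tree) (Q : dyadic_cube d).

Definition subcube (j : 'I_b) Q : dyadic_cube d := dyadic_child (enum_val j) Q.

Definition vol Q : R := fine (leb (cube Q)).

Fixpoint tree_fun t Q : 'rV[R]_d -> E :=
  match t with
  | Leaf v => fun x => \1_(cube Q) x *: v
  | Node c => fun x => \sum_(j < b) tree_fun (c j) (subcube j Q) x
  end.

Fixpoint tree_cubes t Q : seq (dyadic_cube d) :=
  match t with
  | Leaf _ => [:: Q]
  | Node c => Q :: flatten [seq tree_cubes (c j) (subcube j Q) | j <- enum 'I_b]
  end.

Let cardb : b = (2 ^ d)%N. Proof. by rewrite card_ffun card_bool card_ord. Qed.

Lemma branching_gt1 : (1 < b)%N.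
Proof. by rewrite cardb -{1}(expn0 2) ltn_exp2l. Qed.

Let mY Q (j : 'I_b) : measurable (cube (subcube j Q)).
Proof. exact: measurable_cube. Qed.

Let tY Q : trivIset setT (fun j : 'I_b => cube (subcube j Q)).
Proof. by move=> i j _ _ /(trivIset_children I I) /enum_val_inj. Qed.

Let cubeY Q : cube Q = \bigcup_(j in [set j : 'I_b | predT j]) cube (subcube j Q).
Proof.
rewrite cube_children; apply/seteqP; split=> [x [e _ xe]|x [j _ xj]]; last by exists (enum_val j).
by exists (enum_rank e) => //; rewrite /subcube enum_rankK.
Qed.

Let fleb Q : (leb (cube Q) < +oo)%E. Proof. by rewrite lebesgue_cube ltry. Qed.

Let lebE Q : leb (cube Q) = (vol Q)%:E. Proof. by rewrite /vol lebesgue_cube. Qed.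

Lemma vol_gt0 Q : 0 < vol Q. Proof. exact: lebesgue_cube_gt0. Qed.

Lemma vol_subcube j Q : vol (subcube j Q) = vol Q / b%:R.
Proof. by rewrite /vol lebesgue_child cardb. Qed.

Lemma tree_fun_simple t Q : simple_function (tree_fun t Q).
Proof.
elim: t Q => [v|c IH] Q /=; first by apply: simple_indicZ; [exact: measurable_cube|exact: simple_cst].
by apply: simple_sum => j _; exact: IH.
Qed.

Lemma tree_fun_out t Q x : ~ cube Q x -> tree_fun t Q x = 0.
Proof.
elim: t Q => [v|c IH] Q /= xQ; first by rewrite indicE memNset// scale0r.
by rewrite big1// => j _; apply: IH => /(@dyadic_child_sub R d).
Qed.

Lemma tree_fun_child c Q j x : cube (subcube j Q) x ->
  tree_fun (Node c) Q x = tree_fun (c j) (subcube j Q) x.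
Proof.
move=> xj /=; rewrite (bigD1 j) //= big1 ?addr0// => i ij.
apply: tree_fun_out => xi; move/eqP: ij; apply; apply: (tY (Q := Q)) => //.
by exists x.
Qed.

Lemma tree_fun_integral t Q :
  bochner_integral leb (cube Q) (tree_fun t Q) = vol Q *: tavg t.
Proof.
elim: t Q => [v|c IH] Q /=.
  rewrite (@eq_bochner_integral _ _ _ _ _ _ _ (fun=> v)); last first.
    by move=> x xQ; rewrite indicE mem_set// scale1r.
  rewrite bochner_simple; [|exact: measurable_cube|exact: fleb|exact: simple_cst].
  have QE : cube Q = \bigcup_(i in [set i : unit | predT i]) cube Q.
    by apply/seteqP; split=> [x xQ|x [_ _]//]; exists tt.
  rewrite [in LHS]QE (simple_integral_cells (v := fun=> v))//.
  - by rewrite (big_pred1 tt)//; case.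
  - by move=> _; exact: measurable_cube.
  - by move=> [] [].
  - by move=> _ _; exact: fleb.
  - exact: simple_cst.
have sN := tree_fun_simple (Node c) Q.
have sm := simple_strongly_measurable (cube Q) sN.
have fi := simple_integrable (@measurable_cube R d Q) (fleb Q) sN.
rewrite (bochner_additive (mY Q) (tY (Q := Q)) (cubeY Q) (fleb Q) sm fi).
rewrite scalerA scaler_sumr; apply: eq_bigr => j _.
rewrite (@eq_bochner_integral _ _ _ _ _ _ _ (tree_fun (c j) (subcube j Q))).
  by rewrite IH vol_subcube.
by move=> x xj; exact: (tree_fun_child c xj).
Qed.

Lemma integral_subcubes (g : 'rV[R]_d -> \bar R) Q : (forall x, 0 <= g x)%E ->
  measurable_fun (cube Q) g ->
  (\int[leb]_(x in cube Q) g x = \sum_(j < b) \int[leb]_(x in cube (subcube j Q)) g x)%E.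
Proof.
move=> g0; rewrite {1 2}cubeY => mg.
exact: (ge0_integral_cells leb (mY Q) (tY (Q := Q)) g0 mg).
Qed.

Lemma tree_fun_energy (q : R) t Q : 0 < q ->
  (\int[leb]_(x in cube Q) (`|tree_fun t Q x| `^ q)%:E =
   (vol Q * tmean (fun v => `|v| `^ q) t)%:E)%E.
Proof.
move=> q0; elim: t Q => [v|c IH] Q.
  rewrite (eq_integral (cst (`|v| `^ q)%:E)); last first.
    by move=> x; rewrite inE => xQ /=; rewrite indicE mem_set// scale1r.
  rewrite integral_cst; last exact: measurable_cube.
  rewrite [X in (_ * X)%E](_ : _ = (vol Q)%:E); last exact: lebE.
  by rewrite -EFinM mulrC.
have sN := tree_fun_simple (Node c) Q.
rewrite integral_subcubes; [|by move=> x; rewrite lee_fin powR_ge0|]; last first.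
  apply: measurable_norm_powR.
  exact: (simple_measurable_fun2 (fun a _ => `|a|) (@measurable_cube _ _ Q) sN sN).
rewrite /= mulrA mulr_sumr -sumEFin; apply: eq_bigr => j _.
rewrite -(vol_subcube j) -IH; apply: eq_integral => x; rewrite inE => xj.
by rewrite -(tree_fun_child c xj).
Qed.

Lemma tree_fun_average t Q (G : 'rV[R]_d -> E) :
  (forall x, cube Q x -> G x = tree_fun t Q x) -> average Q G = tavg t.
Proof.
move=> GE; rewrite /average (eq_bochner_integral _ GE) tree_fun_integral scalerA.
by rewrite mulVf ?scale1r// gt_eqF// vol_gt0.
Qed.

(** Descending the tree, [u] collects the averages over the cubes passed so far, all
    of which the maximal function dominates. *)
Lemma tree_fun_maximal (q : R) t Q (G M0 : 'rV[R]_d -> E) (u : E) : 0 < q -> 0 <= u ->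
  measurable_fun setT (fun x => `|M0 x|) ->
  (forall x, cube Q x -> G x = tree_fun t Q x) ->
  (forall x, cube Q x -> u <= M0 x) ->
  (forall S x, S \in tree_cubes t Q -> cube S x -> average S G <= M0 x) ->
  ((vol Q * tmax q t u)%:E <= \int[leb]_(x in cube Q) (`|M0 x| `^ q)%:E)%E.
Proof.
move=> q0 + mM; elim: t Q u => [v|c IH] Q u u0 GE uM avM.
  have ge x : cube Q x -> Order.join u v <= M0 x.
    have avE : average Q G = v := tree_fun_average GE.
    move=> xQ; rewrite leUx uM//= -avE; apply: avM => //.
    by rewrite inE.
  have -> : (vol Q * tmax q (Leaf b v) u)%:E =
      (\int[leb]_(x in cube Q) cst (`|Order.join u v| `^ q)%:E x)%E.
    rewrite integral_cst; last exact: measurable_cube.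
    rewrite [X in (_ * X)%E](_ : _ = (vol Q)%:E); last exact: lebE.
    by rewrite -EFinM mulrC.
  apply: ge0_le_integral.
  - exact: measurable_cube.
  - by move=> x _; rewrite lee_fin powR_ge0.
  - exact: measurable_cst.
  - exact: measurable_norm_powR (measurable_funTS mM).
  move=> x xQ; rewrite lee_fin ge0_ler_powR ?nnegrE ?(ltW q0)//.
  apply: bl_norm_le; first exact: le_trans u0 (leUl _ _).
  exact: ge.
rewrite integral_subcubes; [|by move=> x; rewrite lee_fin powR_ge0|]; last first.
  exact: measurable_norm_powR (measurable_funTS mM).
rewrite [tmax _ _ _]/= mulrA mulr_sumr -sumEFin; apply: lee_sum => j _.
have avE : average Q G = tavg (Node c) := tree_fun_average GE.
rewrite -(vol_subcube j) -[X in Order.join u X]/(tavg (Node c)) -avE; apply: IH.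
- exact: le_trans u0 (leUl _ _).
- by move=> x xj; rewrite -(tree_fun_child c xj); apply: GE; exact: dyadic_child_sub xj.
- move=> x xj; have xQ : cube Q x by exact: dyadic_child_sub xj.
  by rewrite leUx uM//=; apply: avM => //; rewrite inE eqxx.
move=> S x Sj; apply: avM; rewrite /= inE; apply/orP; right.
by apply/flattenP; exists (tree_cubes (c j) (subcube j Q)) => //; apply/mapP; exists j => //; rewrite mem_enum.
Qed.

Lemma lattice_sup_ub (s : seq E) y : y \in s -> y <= lattice_sup s.
Proof.
case: s => [//|z s]; rewrite inE => /orP[/eqP ->|ys]; first exact: bigjoin_ge_idx.
exact: (@bigjoin_ub _ _ _ _ _ id).
Qed.

Lemma dyadic_maximal_ge (D : {fset dyadic_cube d}) (G : 'rV[R]_d -> E) Q x :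
  Q \in D -> cube Q x -> average Q G <= dyadic_maximal D G x.
Proof.
move=> QD xQ; apply: lattice_sup_ub; apply/mapP; exists Q => //.
by rewrite indicE mem_set// scale1r.
Qed.

Lemma dyadic_maximal_simple (D : {fset dyadic_cube d}) (G : 'rV[R]_d -> E) :
  simple_function (dyadic_maximal D G).
Proof.
rewrite /dyadic_maximal; have term Q : simple_function (fun x => \1_(cube Q) x *: average Q G).
  by apply: simple_indicZ; [exact: measurable_cube|exact: simple_cst].
case: (enum_fset D) => [|Q s] /=; first exact: simple_cst.
elim: s => [|S s IHs]; first by under eq_fun do rewrite big_nil; exact: term.
have := simple_map2 (fun a c : E => Order.join a c) (term S) IHs.
by congr simple_function; apply/funext => x; rewrite /= big_cons.
Qed.

Lemma opnorm_sup_bound d' (T : measurableType d') (mu : {measure set T -> \bar R})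
    (I : Type) (q : R) (S : I -> (T -> E) -> T -> E) :
  (ereal_sup [set LE_opnorm mu q (S i) | i in setT] < +oo)%E ->
  exists2 C : R, 0 <= C & forall i f, LE mu q%:E setT f ->
    (LE_norm mu q%:E setT (S i f) <= C%:E * LE_norm mu q%:E setT f)%E.
Proof.
set s := ereal_sup _ => soo.
have [K K0 sK] : exists2 K : R, 0 <= K & (s < K%:E)%E.
  move: soo; case: s => [r _|//|_]; last by exists 0; rewrite // ltNyr.
  exists (Num.max 0 r + 1); first by rewrite addr_ge0// le_max lexx.
  by rewrite lte_fin ltr_pwDr// le_max lexx orbT.
exists K => // i f fq.
have : (LE_opnorm mu q (S i) < K%:E)%E.
  by apply: le_lt_trans sK; apply: ereal_sup_ubound; exists i.
move=> /ereal_inf_lt[_ [C [C0 CS] <-]]; rewrite lte_fin => CK.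
apply: (le_trans (CS f fq)); apply: lee_wpmul2r; first exact: Lnorm_ge0.
by rewrite lee_fin ltW.
Qed.

(** The property is used for the cubes occurring in the tree, the root being the unit
    cube. *)
Theorem Hardy_Littlewood_trees : dyadic_Hardy_Littlewood d E ->
  exists q C : R, [/\ 1 < q, 0 <= C & @tree_maximal_bound R E b q C].
Proof.
move=> [q q1 /opnorm_sup_bound[C C0 HL]].
have q0 : 0 < q by exact: lt_trans q1.
exists q, (C `^ q); split => //; first exact: powR_ge0.
move=> t t0; pose Q : dyadic_cube d := (0, [ffun=> 0]).
pose G := tree_fun t Q; pose D := [fset S | S in tree_cubes t Q]%fset.
have intG : (\int[leb]_x (`|G x| `^ q)%:E = (vol Q * tmean (fun v => `|v| `^ q) t)%:E)%E.
  rewrite -(tree_fun_energy t Q q0) [RHS]integral_mkcond; apply: eq_integral => x _.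
  rewrite patchE; case: ifPn => // /negP xQ; rewrite /G tree_fun_out ?normr0 ?powR0 ?gt_eqF//.
  by move=> h; apply: xQ; rewrite inE.
have GL : LE leb q%:E setT G.
  split; first exact/simple_strongly_measurable/tree_fun_simple.
  by rewrite LE_normE// intG poweR_EFin ltry.
have sM := dyadic_maximal_simple D G.
have mM : measurable_fun setT (fun x => `|dyadic_maximal D G x|).
  exact: (simple_measurable_fun2 (fun a _ => `|a|) measurableT sM sM).
have QD : Q \in tree_cubes t Q by case: (t) => [v|c] /=; rewrite inE eqxx.
have mD S : S \in tree_cubes t Q -> S \in D by move=> St; rewrite in_fset /= .
have lower : ((vol Q * tmax q t 0)%:E <=
    \int[leb]_(x in cube Q) (`|dyadic_maximal D G x| `^ q)%:E)%E.
  apply: (tree_fun_maximal (G := G)) => // [x xQ|S x /mD SD xS]; last exact: dyadic_maximal_ge.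
  apply: (le_trans _ (dyadic_maximal_ge G (mD _ QD) xQ)).
  by rewrite (@tree_fun_average t Q G)//; apply: tavg_ge0 => //; exact: branching_gt1.
have upper : (\int[leb]_(x in cube Q) (`|dyadic_maximal D G x| `^ q)%:E <=
    (C `^ q)%:E * \int[leb]_x (`|G x| `^ q)%:E)%E.
  apply: (@le_trans _ _ (\int[leb]_x (`|dyadic_maximal D G x| `^ q)%:E)%E).
    apply: ge0_subset_integral => //; first exact: measurable_cube.
    exact: measurable_norm_powR.
  rewrite -!LE_norm_poweR//; apply: le_trans (poweR_mono (ltW q0) _ (HL D G GL)) _.
    exact: Lnorm_ge0.
  by rewrite poweRM ?lee_fin// ?poweR_EFin//; exact: Lnorm_ge0.
have := le_trans lower upper; rewrite intG -EFinM lee_fin mulrCA.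
by rewrite ler_pM2l// vol_gt0.
Qed.

End lebesgue_trees.

(** * Reduction to finite weighted families *)
Section jensen_integral.
Context d (T : measurableType d) (R : realType) (mu : {measure set T -> \bar R}).

(** Young's inequality is again the tangent line at the mean, as in [jensen_powR]. *)
Lemma jensen_integral A (phi : T -> R) (p W I : R) : 1 < p -> measurable A ->
  mu A = W%:E -> 0 < W -> (forall x, 0 <= phi x) -> measurable_fun A phi ->
  (\int[mu]_(x in A) (phi x)%:E = I%:E)%E ->
  ((W * (I / W) `^ p)%:E <= \int[mu]_(x in A) (phi x `^ p)%:E)%E.
Proof.
move=> p1 mA muA W0 phi0 mphi phiI.
have p0 : 0 < p by exact: lt_trans p1.
have pm0 : 0 < p - 1 by rewrite subr_gt0.
have I0 : 0 <= I by rewrite -lee_fin -phiI; apply: integral_ge0 => x _; rewrite lee_fin.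
set m := I / W; have m0 : 0 <= m by rewrite divr_ge0// ltW.
pose s := p / (p - 1); have s0 : 0 < s by rewrite divr_gt0.
have ps : p^-1 + s^-1 = 1.
  by rewrite /s invf_div -{1}(div1r p) -mulrDl subrKC mulfV// gt_eqF.
have ms : (m `^ (p - 1)) `^ s = m `^ p.
  by rewrite -powRrM /s mulrCA divff ?mulr1// gt_eqF.
have mpow : measurable_fun A (fun x => (phi x `^ p)%:E) by exact: measurable_norm_powR.
have [J|] := ltP (\int[mu]_(x in A) (phi x `^ p)%:E)%E +oo%E; last first.
  by rewrite leye_eq => /eqP ->; rewrite leey.
have J0 : (0 <= \int[mu]_(x in A) (phi x `^ p)%:E)%E.
  by apply: integral_ge0 => x _; rewrite lee_fin powR_ge0.
have : (\int[mu]_(x in A) ((m `^ (p - 1))%:E * (phi x)%:E) <=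
    \int[mu]_(x in A) ((p^-1)%:E * (phi x `^ p)%:E + (cst (m `^ p / s)%:E x)))%E.
  apply: ge0_le_integral => //.
  - by move=> x _; rewrite mule_ge0// lee_fin// powR_ge0.
  - by apply: measurable_funeM; exact/measurable_EFinP.
  - by apply: emeasurable_funD => //; exact: measurable_funeM.
  move=> x _; rewrite -!EFinM -EFinD lee_fin mulrC (mulrC p^-1) -ms.
  by apply: conjugate_powR => //; exact: powR_ge0.
rewrite ge0_integralZl_EFin ?powR_ge0//; [|by move=> x _; rewrite lee_fin|exact/measurable_EFinP].
have ip0 : 0 <= p^-1 by rewrite invr_ge0 ltW.
have cs0 : 0 <= m `^ p / s by rewrite divr_ge0 ?powR_ge0// ltW.
rewrite ge0_integralD//; first last.
- exact: measurable_funeM.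
- by move=> x _; rewrite mule_ge0// lee_fin// powR_ge0.
rewrite ge0_integralZl_EFin//; last by move=> x _; rewrite lee_fin powR_ge0.
rewrite integral_cst// muA phiI.
have Jfin : (\int[mu]_(x in A) (phi x `^ p)%:E)%E \is a fin_num by rewrite ge0_fin_numE.
rewrite -(fineK Jfin) -!EFinM -EFinD !lee_fin; set Jr := fine _ => h.
have IE : m `^ (p - 1) * I = m `^ p * W.
  have -> : I = m * W by rewrite /m divfK// gt_eqF.
  by rewrite mulrA (mulrC (m `^ _)) mulr_powRB1.
rewrite IE in h; have sE : s^-1 = 1 - p^-1 by rewrite -ps addrC addKr.
rewrite sE in h.
have : p^-1 * (m `^ p * W) <= p^-1 * Jr.
  move: h; set a := m `^ p; rewrite mulrBr mulr1 mulrBl => h.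
  have -> : p^-1 * (a * W) = a * W - (a * W - a * p^-1 * W) by ring.
  by rewrite lerBlDr.
by rewrite ler_pM2l ?invr_gt0// mulrC.
Qed.

End jensen_integral.

Section discretization.
Variables (R : realType) (d : nat) (E : banachLatticeType R).
Variable mu : {measure set 'rV[R]_d -> \bar R}.
Hypothesis mu_lf : locally_finite mu.
Variable lambda : dyadic_cube d -> {linear E -> E}.
Hypothesis lambda_pos : forall Q, positive_operator (lambda Q).

Local Notation cube := (@cube R d).

Variables (D : {fset dyadic_cube d}) (N : int).
Hypothesis DN : forall Q, Q \in D -> Q.1 <= N.
Implicit Types (Q S : dyadic_cube d).

Definition refinement : {fset dyadic_cube d} := fset_set (refined R D N).

Lemma refinementP Q : Q \in refinement <-> refined R D N Q.
Proof. by rewrite in_fset_set ?inE//; exact: finite_refined. Qed.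

Definition leaves : {fset dyadic_cube d} := [fset Q in refinement | Q.1 == N]%fset.

Local Notation L := {: leaves}.

Definition leaf_cube (P : leaves) : set 'rV[R]_d := cube (val P).

(** Cubes become sets of leaves, and inclusion of cubes becomes inclusion of sets
    ([body_subset]). *)
Definition body Q : {set L} := [set P : leaves | `[< leaf_cube P `<=` cube Q >]]%SET.

Definition bodies : {set {set L}} := [set A in [seq body Q | Q <- refinement]]%SET.

Definition leaf_mass (P : leaves) : R := fine (mu (leaf_cube P)).

Lemma leaf_mass_ge0 P : 0 <= leaf_mass P. Proof. exact: fine_ge0. Qed.

Let fmu Q : (mu (cube Q) < +oo)%E. Proof. exact: locally_finite_cube. Qed.

Lemma leaf_massE P : mu (leaf_cube P) = (leaf_mass P)%:E.
Proof. by rewrite fineK// ge0_fin_numE//; exact: fmu. Qed.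

Lemma leafP (P : leaves) : val P \in refinement /\ (val P).1 = N.
Proof. by have := valP P; rewrite !inE /= => /andP[-> /eqP]. Qed.

Let mX P : measurable (leaf_cube P). Proof. exact: measurable_cube. Qed.

Let tX : trivIset setT leaf_cube.
Proof.
move=> P P' _ _ [x [xP xP']]; apply: val_inj; apply: (cube_inj_level _ xP xP').
by rewrite (leafP P).2 (leafP P').2.
Qed.

Lemma mem_bodies Q : Q \in refinement -> body Q \in bodies.
Proof. by move=> QD; rewrite inE; apply/mapP; exists Q. Qed.

Lemma bodiesP A : A \in bodies -> exists2 Q, Q \in refinement & A = body Q.
Proof. by rewrite inE => /mapP[Q]; exists Q. Qed.

Lemma mem_bodyE Q P x : Q \in refinement -> leaf_cube P x -> (P \in body Q) <-> cube Q x.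
Proof.
move=> /refinementP[_ _ [_ QN _]] xP; rewrite inE; split=> [/asboolP sub|xQ]; first exact: sub.
by apply/asboolP; apply: (cube_nested _ xQ xP); rewrite (leafP P).2.
Qed.

Lemma leaf_exists Q x : Q \in refinement -> cube Q x -> exists P : leaves, leaf_cube P x.
Proof.
move=> /refinementP rQ xQ; have [S rS [SN xS]] := refined_leaf rQ xQ.
have SL : S \in leaves by rewrite !inE /= SN eqxx andbT; exact/refinementP.
by exists [` SL]%fset.
Qed.

Lemma cube_body Q : Q \in refinement ->
  cube Q = \bigcup_(P in [set P | P \in body Q]) leaf_cube P.
Proof.
move=> QD; apply/seteqP; split=> [x xQ|x [P /= PQ xP]]; last exact/(mem_bodyE QD xP).
by have [P xP] := leaf_exists QD xQ; exists P => //=; exact/(mem_bodyE QD xP).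
Qed.

Lemma body_subset Q S : Q \in refinement -> S \in refinement ->
  (body Q \subset body S) <-> (cube Q `<=` cube S).
Proof.
move=> QD SD; split=> [/fintype.subsetP sub x|sub].
  rewrite (cube_body QD) => -[P /= PQ xP].
  exact/(mem_bodyE SD xP)/sub.
apply/fintype.subsetP => P; rewrite inE => /asboolP PQ; rewrite inE; apply/asboolP.
exact: subset_trans PQ sub.
Qed.

Lemma bodies_laminar : laminar bodies.
Proof.
move=> _ _ /bodiesP[Q QD ->] /bodiesP[S SD ->].
have [//|dis] := boolP [disjoint body Q & body S]; first by rewrite !orbT.
move: dis => /pred0Pn[P /= /andP[PQ PS]].
have xP := @corner_mem R d (val P).
have xQ : cube Q (corner R (val P)) by exact/(mem_bodyE QD xP).
have xS : cube S (corner R (val P)) by exact/(mem_bodyE SD xP).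
have [QS|/ltW SQ] := leP Q.1 S.1.
  by apply/or3P/Or32/(body_subset SD QD); exact: (cube_nested QS xQ xS).
by apply/or3P/Or31/(body_subset QD SD); exact: (cube_nested SQ xS xQ).
Qed.

Lemma bodies_singletons P : [set P]%SET \in bodies.
Proof.
have -> : [set P]%SET = body (val P); last exact: mem_bodies (leafP P).1.
apply/finset.setP => P'; rewrite finset.in_set1 inE; apply/eqP/asboolP => [->//|sub].
have xP' := @corner_mem R d (val P').
exact: (tX I I (ex_intro _ _ (conj xP' (sub _ xP')))).
Qed.

Lemma mass_body Q : Q \in refinement -> mu (cube Q) = (mass leaf_mass (body Q))%:E.
Proof.
move=> QD; rewrite (cube_body QD) measure_cells// /mass -sumEFin.
by apply: eq_bigr => P _; rewrite leaf_massE.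
Qed.

Section block_operator.
Variable A : {set L}.

(** The sum over all cubes with the same body: in dimension zero cubes of different
    generations coincide as sets. *)
Definition block_op (e : E) : E := \sum_(Q <- refinement | body Q == A) lambda Q e.

Let block_op_linear : linear block_op.
Proof.
move=> a x y; rewrite /block_op scaler_sumr -big_split /=.
by apply: eq_bigr => Q _; rewrite linearP.
Qed.

HB.instance Definition _ := GRing.isLinear.Build R E E *:%R block_op block_op_linear.

End block_operator.

Definition block (A : {set L}) : {linear E -> E} := block_op A.

Lemma block_pos A : positive_operator (block A).
Proof. by move=> e e0; apply: bl_sum_ge0 => Q _; exact: lambda_pos. Qed.

Local Notation leaf_op := (local_op leaf_mass bodies block).

Lemma local_opE (B : {set L}) (h : L -> E) P :
  leaf_op B h P = \sum_(Q <- refinement | (P \in body Q) && (body Q \subset B))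
    lambda Q (wsum leaf_mass (body Q) h).
Proof.
rewrite /local_op /block /= /block_op.
rewrite (exchange_big_dep (fun Q => (P \in body Q) && (body Q \subset B))) /=; last first.
  by move=> A Q /and3P[_ PA AB] /eqP ->; rewrite PA AB.
rewrite big_seq_cond [RHS]big_seq_cond; apply: eq_bigr => Q /and3P[QD PQ QB].
rewrite (big_pred1 (body Q))// => A /=; rewrite eq_sym.
by case: eqP => [->|]; rewrite ?andbF// mem_bodies// PQ QB.
Qed.

(** Testing on step functions is testing for the discrete operator. *)
Definition step (h : L -> E) (x : 'rV[R]_d) : E := \sum_P \1_(leaf_cube P) x *: h P.

Lemma step_simple h : simple_function (step h).
Proof. by apply: simple_sum => P _; apply: simple_indicZ => //; exact: simple_cst. Qed.

Lemma step_leaf h P x : leaf_cube P x -> step h x = h P.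
Proof.
move=> xP; rewrite /step (bigD1 P) //= indicE mem_set// scale1r big1 ?addr0// => P' P'P.
rewrite indicE memNset ?scale0r// => xP'; move/eqP: P'P; apply.
by apply: tX => //; exists x.
Qed.

Lemma step_integral h Q : Q \in refinement ->
  bochner_integral mu (cube Q) (step h) = wsum leaf_mass (body Q) h.
Proof.
move=> QD; rewrite bochner_simple; [|exact: measurable_cube|exact: fmu|exact: step_simple].
rewrite (cube_body QD) (simple_integral_cells (v := h))//.
- by move=> P _; exact: fmu.
- exact: step_simple.
- by move=> P x _; exact: step_leaf.
Qed.

Lemma integral_leaves (g : 'rV[R]_d -> R) (c : L -> R) (Z : {set L}) :
  (forall P, 0 <= c P) -> (forall P x, leaf_cube P x -> g x = c P) ->
  (\int[mu]_(x in \bigcup_(P in [set P | P \in Z]) leaf_cube P) (g x)%:E =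
   (rsum leaf_mass Z c)%:E)%E.
Proof.
move=> c0 gc; rewrite (integral_cells mu mX tX (c := c))//; last by move=> P x _; exact: gc.
by rewrite /rsum -sumEFin; apply: eq_bigr => P _; rewrite leaf_massE -EFinM mulrC.
Qed.

Lemma integral_support (g : 'rV[R]_d -> R) (Z : set 'rV[R]_d) :
  (forall x, ~ Z x -> g x = 0) -> (\int[mu]_x (g x)%:E = \int[mu]_(x in Z) (g x)%:E)%E.
Proof.
move=> g0; rewrite [RHS]integral_mkcond; apply: eq_integral => x _.
by rewrite patchE; case: ifPn => // /negP xZ; rewrite g0// => h; apply: xZ; rewrite inE.
Qed.

Lemma dyadic_op_in_step h S P x : S \in refinement -> leaf_cube P x ->
  dyadic_op_in mu lambda refinement S (step h) x = leaf_op (body S) h P.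
Proof.
move=> SD xP; rewrite local_opE /dyadic_op_in big_seq_cond [RHS]big_seq_cond.
rewrite [LHS](bigID (fun Q => P \in body Q)) /= [X in _ + X]big1 ?addr0.
  apply: eq_big => [Q|Q /andP[/andP[QD _] PQ]].
    case QD : (Q \in refinement) => //=; rewrite andbC; congr andb.
    by apply/asboolP/idP => /(body_subset QD SD).
  rewrite step_integral// indicE mem_set ?scale1r//; exact/(mem_bodyE QD xP).
move=> Q /andP[/andP[QD _] /negP PQ].
by rewrite indicE memNset ?scale0r// => /(mem_bodyE QD xP).
Qed.

Lemma dyadic_op_in_norm h S : S \in refinement ->
  LE_norm mu 1 setT (dyadic_op_in mu lambda refinement S (step h)) =
  (rsum leaf_mass (body S) (fun P => `|leaf_op (body S) h P|))%:E.
Proof.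
move=> SD; rewrite (LE_normE _ _ _ (q := 1))// invr1 poweRe1; last first.
  by apply: integral_ge0 => x _; rewrite lee_fin powR_ge0.
rewrite (integral_support (Z := cube S)); last first.
  move=> x xS; rewrite /dyadic_op_in big1 ?normr0 ?powR0// => Q /asboolP QS.
  by rewrite indicE memNset ?scale0r// => /QS.
rewrite (cube_body SD); apply: integral_leaves => // P x xP.
by rewrite powRr1// (dyadic_op_in_step _ SD xP).
Qed.

(** The maximum with one makes the constant nonnegative. *)
Lemma bounded_testing_leaves (B : R) : (forall f S, S \in refinement ->
    LE mu +oo%E (cube S) f ->
    (LE_norm mu 1 setT (dyadic_op_in mu lambda refinement S f) <=
       B%:E * LE_norm mu +oo (cube S) f * mu (cube S))%E) ->
  bounded_testing leaf_mass bodies block (Num.max B 1).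
Proof.
move=> test _ h c /bodiesP[S SD ->] h0 c0 hc.
have normh : (LE_norm mu +oo (cube S) (step h) <= c%:E)%E.
  rewrite /LE_norm unlock /Lnorm; case: ifPn => // _.
  apply/ess_sup_inf.ess_supP; apply: aeW => x /=; rewrite patchE; case: ifPn; last first.
    by rewrite abse0 lee_fin.
  rewrite inE => xS; have [P xP] := leaf_exists SD xS.
  rewrite abse_EFin normr_id lee_fin (step_leaf _ xP); apply: hc.
  exact/(mem_bodyE SD xP).
have inL : LE mu +oo%E (cube S) (step h).
  split; first exact/simple_strongly_measurable/step_simple.
  exact: le_lt_trans normh (ltry _).
rewrite -lee_fin -dyadic_op_in_norm//; apply: (le_trans (test _ _ SD inL)).
rewrite (mass_body SD) EFinM; apply: lee_wpmul2r; first by rewrite lee_fin mass_ge0//; exact: leaf_mass_ge0.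
have B0 : 0 <= Num.max B 1 by rewrite le_max ler01 orbT.
rewrite EFinM; apply: (@le_trans _ _ ((Num.max B 1)%:E * LE_norm mu +oo (cube S) (step h))%E).
  by apply: lee_wpmul2r; [exact: Lnorm_ge0|rewrite lee_fin le_max lexx].
by apply: lee_wpmul2l => //; rewrite lee_fin.
Qed.

Lemma power_testing_leaves (B t : R) n : 1 < t -> t < n%:R ->
  (forall f S, S \in refinement -> LE mu t%:E (cube S) f ->
    (LE_norm mu 1 setT (dyadic_op_in mu lambda refinement S f) <=
       B%:E * LE_norm mu t%:E (cube S) f * mu (cube S) `^ (1 - t^-1))%E) ->
  power_testing leaf_mass bodies block n (Num.max B 1).
Proof.
move=> t1 tn test _ h c /bodiesP[S SD ->] h0 c0 hc.
have t0 : 0 < t by exact: lt_trans t1.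
set W := mass leaf_mass (body S) in hc *.
have W0 : 0 <= W by apply: mass_ge0; exact: leaf_mass_ge0.
have ht : rsum leaf_mass (body S) (fun P => `|h P| `^ t) <= c `^ t * W.
  by apply: (power_mean_down leaf_mass_ge0 t0 tn c0).
have normh : (LE_norm mu t%:E (cube S) (step h) <= (c * W `^ t^-1)%:E)%E.
  rewrite LE_normE// (cube_body SD) (integral_leaves _ (c := fun P => `|h P| `^ t)); last 2 first.
  - by move=> P; exact: powR_ge0.
  - by move=> P x xP; rewrite (step_leaf _ xP).
  rewrite poweR_EFin lee_fin.
  have -> : c * W `^ t^-1 = (c `^ t * W) `^ t^-1.
    by rewrite powRM ?powR_ge0// -powRrM divff ?gt_eqF// powRr1.
  rewrite ge0_ler_powR ?nnegrE ?invr_ge0 ?(ltW t0) ?mulr_ge0 ?powR_ge0//.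
  by apply: rsum_ge0 => [P|P _]; [exact: leaf_mass_ge0|exact: powR_ge0].
have inL : LE mu t%:E (cube S) (step h).
  split; first exact/simple_strongly_measurable/step_simple.
  exact: le_lt_trans normh (ltry _).
rewrite -lee_fin -dyadic_op_in_norm//; apply: (le_trans (test _ _ SD inL)).
rewrite (mass_body SD) poweR_EFin -/W.
have B0 : 0 <= Num.max B 1 by rewrite le_max ler01 orbT.
have -> : Num.max B 1 * c * W = Num.max B 1 * (c * W `^ t^-1) * W `^ (1 - t^-1).
  rewrite -!mulrA -powRD.
    by rewrite addrC subrK powRr1.
  by rewrite addrC subrK oner_eq0.
rewrite EFinM; apply: lee_wpmul2r; first by rewrite lee_fin powR_ge0.
rewrite EFinM; apply: (@le_trans _ _ ((Num.max B 1)%:E * LE_norm mu t%:E (cube S) (step h))%E).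
  by apply: lee_wpmul2r; [exact: Lnorm_ge0|rewrite lee_fin le_max lexx].
by apply: lee_wpmul2l => //; rewrite lee_fin.
Qed.

Lemma parent_doubling_leaves (K : R) : (0 < d)%N ->
  (forall Q Q', Q'.1 + 1 = Q.1 -> cube Q `<=` cube Q' ->
    (mu (cube Q') <= K%:E * mu (cube Q))%E) ->
  parent_doubling leaf_mass bodies K.
Proof.
move=> d0 dbl _ _ /bodiesP[Q QD ->] /bodiesP[F FD ->] /(body_subset QD FD) QF QneF.
have FQ : ~ (cube F `<=` cube Q).
  move=> /(body_subset FD QD) FQ; move/negP: QneF; apply.
  by rewrite finset.eqEsubset FQ andbT; exact/(body_subset QD FD).
have [rQ rF] : refined R D N Q /\ refined R D N F by split; exact/refinementP.
have [Q' [rQ' lev QQ' Q'F Q'Q]] := refined_parent d0 rQ rF QF FQ.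
have Q'D : Q' \in refinement by exact/refinementP.
exists (body Q'); split.
- exact: mem_bodies.
- exact/(body_subset QD Q'D).
- exact/(body_subset Q'D FD).
- apply/negP => /eqP Q'E; apply: Q'Q; apply/(body_subset Q'D QD).
  by rewrite Q'E.
- by rewrite -lee_fin EFinM -!mass_body//; exact: dbl.
Qed.

Section function.
Variables (p : R) (f : 'rV[R]_d -> E).
Hypotheses (p1 : 1 < p) (fL : LE mu p%:E setT f).

Let p0 : 0 < p. Proof. exact: lt_trans p1. Qed.

Let mf A : strongly_measurable A f.
Proof. exact: strongly_measurable_subset (subsetT A) fL.1. Qed.

Let mnf A : measurable A -> measurable_fun A (fun x => `|f x|).
Proof. by move=> mA; exact: strongly_measurable_norm0. Qed.

Lemma norm_integrable Q : (\int[mu]_(x in cube Q) `|f x|%:E < +oo)%E.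
Proof.
have mQ := @measurable_cube R d Q.
have mpow (A : set 'rV[R]_d) : measurable A -> measurable_fun A (fun x => (`|f x| `^ p)%:E).
  by move=> mA; apply: measurable_norm_powR; exact: mnf.
have ppos x : (0 <= (`|f x| `^ p)%:E)%E by rewrite lee_fin powR_ge0.
have fp : (\int[mu]_(x in cube Q) (`|f x| `^ p)%:E < +oo)%E.
  apply: (@le_lt_trans _ _ (\int[mu]_x (`|f x| `^ p)%:E)%E).
    by apply: ge0_subset_integral => //; exact: mpow.
  by rewrite -LE_norm_poweR//; apply: poweR_lty; exact: fL.2.
apply: (@le_lt_trans _ _ (\int[mu]_(x in cube Q) (cst 1%:E x + (`|f x| `^ p)%:E))%E).
  apply: ge0_le_integral => //.
  - by apply/measurable_EFinP; exact: mnf.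
  - by apply: emeasurable_funD => //; exact: mpow.
  move=> x _; rewrite -EFinD lee_fin.
  have [h|/ltW h] := leP `|f x| 1.
    by rewrite (le_trans h)// lerDl powR_ge0.
  by rewrite (le_trans (le1r_powR h (ltW p1)))// lerDr.
rewrite ge0_integralD//; last exact: mpow.
by rewrite integral_cst// mul1e lte_add_pinfty.
Qed.

Definition leaf_integral (P : leaves) : E := bochner_integral mu (leaf_cube P) f.

(** On leaves of mass zero the value is zero, which loses nothing as the integral of
    [f] over them vanishes. *)
Definition leaf_modulus (P : leaves) : E := (leaf_mass P)^-1 *: modulus (leaf_integral P).

Lemma norm_leaf_integral P :
  (`|leaf_integral P|%:E <= \int[mu]_(x in leaf_cube P) `|f x|%:E)%E.
Proof.
apply: (bochner_norm_le (mX P) (fmu _)).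
exact: (bochner_integralP (mX P) (fmu _) (mf _) (norm_integrable _)).
Qed.

Lemma leaf_modulus_ge0 P : 0 <= leaf_modulus P.
Proof. by rewrite bl_ge0Z ?invr_ge0 ?leaf_mass_ge0// modulus_ge0. Qed.

Lemma mass_leaf_modulus P : leaf_mass P *: leaf_modulus P = modulus (leaf_integral P).
Proof.
have [P0|P0] := eqVneq (leaf_mass P) 0; last by rewrite scalerA mulfV// scale1r.
have : leaf_integral P = 0.
  apply/eqP; rewrite -normr_le0 -lee_fin (le_trans (norm_leaf_integral P))//.
  rewrite null_set_integral//; last by rewrite leaf_massE P0.
  by apply/measurable_EFinP; exact: mnf.
by move=> ->; rewrite P0 scale0r /modulus oppr0 joinxx.
Qed.

Lemma cube_integral Q : Q \in refinement ->
  bochner_integral mu (cube Q) f = \sum_(P in body Q) leaf_integral P.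
Proof.
move=> QD; exact: (bochner_additive mX tX (cube_body QD) (fmu Q) (mf _) (norm_integrable Q)).
Qed.

Lemma cube_integral_le Q : Q \in refinement ->
  - wsum leaf_mass (body Q) leaf_modulus <= bochner_integral mu (cube Q) f /\
  bochner_integral mu (cube Q) f <= wsum leaf_mass (body Q) leaf_modulus.
Proof.
move=> QD; rewrite cube_integral// /wsum; under eq_bigr do rewrite mass_leaf_modulus.
by rewrite -sumrN; split; apply: bl_ler_sum => P _; [exact: lerN_modulus|exact: ler_modulus].
Qed.

Definition op_value (P : leaves) : E :=
  \sum_(Q <- D | P \in body Q) lambda Q (bochner_integral mu (cube Q) f).

Let DD Q : Q \in D -> Q \in refinement.
Proof. by move=> QD; apply/refinementP; exact: refined_sub. Qed.

Lemma dyadic_op_value P x : leaf_cube P x -> dyadic_op mu lambda D f x = op_value P.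
Proof.
move=> xP; rewrite /dyadic_op /op_value (bigID (fun Q => P \in body Q)) /=.
rewrite [X in _ + X]big_seq_cond [X in _ + X]big1 ?addr0; last first.
  move=> Q /andP[/DD QD /negP PQ].
  by rewrite indicE memNset ?scale0r// => /(mem_bodyE QD xP).
rewrite big_seq_cond [RHS]big_seq_cond; apply: eq_bigr => Q /andP[/DD QD PQ].
by rewrite indicE mem_set ?scale1r//; exact/(mem_bodyE QD xP).
Qed.

Lemma dyadic_op_out x : ~ (\bigcup_(P in [set P | P \in [set: L]%SET]) leaf_cube P) x ->
  dyadic_op mu lambda D f x = 0.
Proof.
move=> xU; rewrite /dyadic_op big_seq big1// => Q /DD QD.
rewrite indicE memNset ?scale0r// => xQ; apply: xU.
by have [P xP] := leaf_exists QD xQ; exists P => //=; rewrite inE.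
Qed.

(** Positivity enters twice: it dominates the operator on [f] by the operator on the
    moduli, and it lets the collection of cubes be enlarged. *)
Lemma norm_op_value P : `|op_value P| <= `|leaf_op [set: L]%SET leaf_modulus P|.
Proof.
pose T := \sum_(Q <- D | P \in body Q) lambda Q (wsum leaf_mass (body Q) leaf_modulus).
have pos Q : 0 <= lambda Q (wsum leaf_mass (body Q) leaf_modulus).
  apply: lambda_pos; apply: wsum_ge0 => [P'|P' _]; first exact: leaf_mass_ge0.
  exact: leaf_modulus_ge0.
have T0 : 0 <= T by apply: bl_sum_ge0.
apply: (@le_trans _ _ `|T|).
  apply: bl_norm_sandwich; rewrite /T /op_value -?sumrN big_seq_cond [leRHS]big_seq_cond.
    apply: bl_ler_sum => Q /andP[/DD QD _]; rewrite -linearN.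
    by apply: positive_le => //; have [] := cube_integral_le QD.
  apply: bl_ler_sum => Q /andP[/DD QD _].
  by apply: positive_le => //; have [] := cube_integral_le QD.
apply: bl_norm_le => //; rewrite local_opE.
have -> : T = \sum_(Q <- refinement | (P \in body Q) && (Q \in D))
    lambda Q (wsum leaf_mass (body Q) leaf_modulus).
  rewrite /T -[LHS]big_filter -[RHS]big_filter; apply: perm_big; apply: uniq_perm.
  - by rewrite filter_uniq// fset_uniq.
  - by rewrite filter_uniq// fset_uniq.
  move=> Q; rewrite !mem_filter -andbA; congr andb.
  by apply/idP/andP => [QD|[]//]; split => //; exact: DD.
rewrite [leRHS](bigID (fun Q => Q \in D)) /= -[leLHS]addr0; apply: bl_leD.
  rewrite le_eqVlt; apply/orP; left; apply/eqP; apply: eq_bigl => Q.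
  by rewrite finset.subsetT andbT.
exact: bl_sum_ge0.
Qed.

(** The norm of an integral is at most the integral of the norm, to which Jensen's
    inequality applies. *)
Lemma leaf_modulus_energy P :
  ((leaf_mass P * `|leaf_modulus P| `^ p)%:E <=
   \int[mu]_(x in leaf_cube P) (`|f x| `^ p)%:E)%E.
Proof.
have [P0|P0] := eqVneq (leaf_mass P) 0.
  by rewrite P0 mul0r; apply: integral_ge0 => x _; rewrite lee_fin powR_ge0.
have {}P0 : 0 < leaf_mass P by rewrite lt_def P0 leaf_mass_ge0.
have fI : (\int[mu]_(x in leaf_cube P) `|f x|%:E)%E \is a fin_num.
  rewrite ge0_fin_numE; first exact: norm_integrable.
  by apply: integral_ge0 => x _; rewrite lee_fin.
have := jensen_integral p1 (mX P) (leaf_massE P) P0 (fun x => normr_ge0 (f x)) (mnf (mX P))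
  (esym (fineK fI)).
apply: le_trans; rewrite lee_fin ler_pM2l// ge0_ler_powR ?nnegrE ?(ltW p0)//.
  by rewrite divr_ge0 ?fine_ge0 ?(ltW P0)//; apply: integral_ge0 => x _; rewrite lee_fin.
rewrite normrZ ger0_norm ?invr_ge0 ?(ltW P0)// norm_modulus mulrC ler_pM2r ?invr_gt0//.
by rewrite -lee_fin fineK//; exact: norm_leaf_integral.
Qed.

Lemma leaf_modulus_total :
  ((rsum leaf_mass [set: L]%SET (fun P => `|leaf_modulus P| `^ p))%:E <=
   \int[mu]_x (`|f x| `^ p)%:E)%E.
Proof.
have ppos x : (0 <= (`|f x| `^ p)%:E)%E by rewrite lee_fin powR_ge0.
set U := \bigcup_(P in [set P | P \in [set: L]%SET]) leaf_cube P.
have mU : measurable U by exact: measurable_cells.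
have mpow (A : set 'rV[R]_d) : measurable A -> measurable_fun A (fun x => (`|f x| `^ p)%:E).
  by move=> mA; apply: measurable_norm_powR; exact: mnf.
apply: (@le_trans _ _ (\int[mu]_(x in U) (`|f x| `^ p)%:E)%E); last first.
  by apply: ge0_subset_integral => //; exact: mpow.
rewrite (ge0_integral_cells mu mX tX ppos (mpow _ mU)) /rsum -sumEFin.
by apply: lee_sum => P _; exact: leaf_modulus_energy.
Qed.

Lemma dyadic_op_bound (p' C M : R) : 1 < p' -> p^-1 + p'^-1 = 1 -> 0 < C ->
  M = C * (2 `^ p + 2 `^ p') ->
  (forall g : L -> E, (forall P, 0 <= g P) ->
    sparse_stopping leaf_mass bodies block (stop_ratio p p') C g) ->
  (LE_norm mu p%:E setT (dyadic_op mu lambda D f) <=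
   ((2 * M * (2 * M) `^ (p - 1)) `^ p^-1)%:E * LE_norm mu p%:E setT f)%E.
Proof.
move=> p'1 pp' C0 MC stop; set K := 2 * M * _.
have M0 : 0 < M by rewrite MC mulr_gt0// addr_gt0// powR_gt0.
have K0 : 0 <= K by rewrite mulr_ge0 ?powR_ge0// mulr_ge0// ltW.
have bound := sparse_stopping_bound leaf_mass_ge0 bodies_laminar bodies_singletons
  MC p1 p'1 pp' C0 (stop _ leaf_modulus_ge0).
have ip0 : 0 <= p^-1 by rewrite invr_ge0 ltW.
rewrite !LE_normE// -poweR_EFin -poweRM ?lee_fin//; last first.
  by apply: integral_ge0 => x _; rewrite lee_fin powR_ge0.
apply: poweR_mono => //.
  by apply: integral_ge0 => x _; rewrite lee_fin powR_ge0.
rewrite (integral_support (Z := \bigcup_(P in [set P | P \in [set: L]%SET]) leaf_cube P)); last first.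
  by move=> x xU; rewrite dyadic_op_out// normr0 powR0// gt_eqF.
rewrite (integral_leaves _ (c := fun P => `|op_value P| `^ p)); last 2 first.
- by move=> P; exact: powR_ge0.
- by move=> P x xP; rewrite (dyadic_op_value xP).
apply: (@le_trans _ _ (K * rsum leaf_mass [set: L]%SET (fun P => `|leaf_modulus P| `^ p))%:E).
  rewrite lee_fin; apply: le_trans bound; apply: rsum_le => [P|P _]; first exact: leaf_mass_ge0.
  by rewrite ge0_ler_powR ?nnegrE ?(ltW p0)// norm_op_value.
by rewrite EFinM; apply: lee_wpmul2l => //; exact: leaf_modulus_total.
Qed.

End function.

End discretization.

(** * Bounds uniform in the collection of cubes *)
Lemma fset_generation_bound d (D : {fset dyadic_cube d}) :
  exists N, forall Q, Q \in D -> Q.1 <= N.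
Proof.
exists (\sum_(Q <- D) `|Q.1|) => Q QD.
apply: (le_trans (ler_norm _)); rewrite (bigD1_seq Q) ?fset_uniq//= lerDl.
exact: sumr_ge0.
Qed.

Section uniform_stopping.
Variables (R : realType) (d : nat) (E : banachLatticeType R).
Variable mu : {measure set 'rV[R]_d -> \bar R}.
Hypothesis mu_lf : locally_finite mu.
Variable lambda : dyadic_cube d -> {linear E -> E}.
Hypothesis lambda_pos : forall Q, positive_operator (lambda Q).
Hypothesis d_gt0 : (0 < d)%N.

(** The constants depend neither on the collection nor on the generation of the
    leaves. *)
Definition uniform_stopping (eta C : R) := forall D N, (forall Q, Q \in D -> Q.1 <= N) ->
  forall g, (forall P, 0 <= g P) ->
    sparse_stopping (@leaf_mass R d mu D N) (bodies R D N) (@block R d E lambda D N) eta C g.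

(** The summand one makes the constant positive, as [sparse_stopping_bound] requires. *)
Lemma uniform_stopping_majorant (eta C : R) : 0 < eta -> 0 <= C ->
  (forall D N, (forall Q, Q \in D -> Q.1 <= N) -> forall g, (forall P, 0 <= g P) ->
    testing_majorant (@leaf_mass R d mu D N) (bodies R D N) (@block R d E lambda D N) eta C g) ->
  uniform_stopping (eta + eta) (C / eta + 1).
Proof.
move=> eta0 C0 maj D N DN g g0.
apply: (sparse_stopping_le _ (C := C / eta)).
- by move=> P; exact: leaf_mass_ge0.
- by rewrite lerDl.
apply: testing_majorant_sparse => //.
- by move=> P; exact: leaf_mass_ge0.
- exact: bodies_laminar.
- exact: block_pos.
exact: maj.
Qed.

Lemma Lt_uniform_stopping (eta t : R) : 0 < eta < 1 -> 1 < t -> Lt_testing mu lambda t ->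
  exists2 C, 0 < C & uniform_stopping (eta + eta) C.
Proof.
move=> /andP[eta0 eta1] t1 [B test].
(* packing controls natural powers, so take one beyond t *)
pose n := (Num.truncn t).+1.
have B0 : 0 <= Num.max B 1 by rewrite le_max ler01 orbT.
have C0 : 0 <= Num.max B 1 * (power_const R n / eta).
  by rewrite mulr_ge0// divr_ge0// ltW// power_const_gt0.
exists (Num.max B 1 * (power_const R n / eta) / eta + 1).
  by rewrite ltr_wpDl// divr_ge0// ltW.
apply: uniform_stopping_majorant => // D N DN g g0.
apply: power_testing_majorant => //.
- by move=> P; exact: leaf_mass_ge0.
- exact: bodies_laminar.
- exact: bodies_singletons.
- by rewrite eta0.
apply: (power_testing_leaves mu_lf t1) => [|f S SD fL]; first exact: truncnS_gt.
exact: test.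
Qed.

Lemma doubling_uniform_stopping (eta : R) : 0 < eta < 1 -> Loo_testing mu lambda ->
  doubling mu -> exists2 C, 0 < C & uniform_stopping (eta + eta) C.
Proof.
move=> /andP[eta0 eta1] [B test] /doubling_parent[K K1 dbl].
have B0 : 0 <= Num.max B 1 by rewrite le_max ler01 orbT.
have K0 : 0 <= K by exact: le_trans K1.
have C0 : 0 <= Num.max B 1 * (K / eta) by rewrite mulr_ge0// divr_ge0// ltW.
exists (Num.max B 1 * (K / eta) / eta + 1); first by rewrite ltr_wpDl// divr_ge0// ltW.
apply: uniform_stopping_majorant => // D N DN g g0.
apply: doubling_majorant => //.
- by move=> P; exact: leaf_mass_ge0.
- exact: bodies_laminar.
- exact: bodies_singletons.
- by rewrite eta0.
- exact: parent_doubling_leaves.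
apply: (bounded_testing_leaves mu_lf) => f S SD fL.
exact: test.
Qed.

Lemma Hardy_Littlewood_uniform_stopping (eta : R) : 0 < eta < 1 ->
  Loo_testing mu lambda -> dyadic_Hardy_Littlewood d E ->
  exists2 C, 0 < C & uniform_stopping ((eta + eta) + (eta + eta)) C.
Proof.
move=> /andP[eta0 eta1] [B test] /(Hardy_Littlewood_trees d_gt0)[q [A [q1 A0 HL]]].
pose n := (Num.truncn q).+1.
have B0 : 0 <= Num.max B 1 by rewrite le_max ler01 orbT.
pose s := (4 * A / eta) `^ q^-1; have s0 : 0 <= s by exact: powR_ge0.
have ee0 : 0 < eta + eta by exact: addr_gt0.
have C0 : 0 <= Num.max B 1 * (s * (power_const R n / eta)).
  by rewrite mulr_ge0// mulr_ge0// divr_ge0// ltW// power_const_gt0.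
exists (Num.max B 1 * (s * (power_const R n / eta)) / (eta + eta) + 1).
  by rewrite ltr_wpDl// divr_ge0// ltW.
apply: uniform_stopping_majorant => // D N DN g g0.
apply: maximal_majorant => //.
- by move=> P; exact: leaf_mass_ge0.
- exact: bodies_laminar.
- exact: bodies_singletons.
- by rewrite eta0.
- apply: (maximal_transfer (branching_gt1 d_gt0) q1 A0 HL) => //.
  + exact: truncnS_gt.
  + by move=> P; exact: leaf_mass_ge0.
  + exact: bodies_laminar.
  + exact: bodies_singletons.
apply: (bounded_testing_leaves mu_lf) => f S SD fL.
exact: test.
Qed.

Lemma uniform_stopping_bounded (p p' C : R) : 1 < p -> 1 < p' -> p^-1 + p'^-1 = 1 ->
  0 < C -> uniform_stopping (stop_ratio p p') C ->
  (ereal_sup [set LE_opnorm mu p (dyadic_op mu lambda D) |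
               D in [set: {fset dyadic_cube d}]] < +oo)%E.
Proof.
move=> p1 p'1 pp' C0 stop.
pose M := C * (2 `^ p + 2 `^ p'); pose K := (2 * M * (2 * M) `^ (p - 1)) `^ p^-1.
apply: (@le_lt_trans _ _ K%:E); last exact: ltry.
apply: ge_ereal_sup => _ [D _ <-]; have [N DN] := fset_generation_bound D.
apply: ereal_inf_lbound; exists K => //; split; first exact: powR_ge0.
move=> f fL; exact: (dyadic_op_bound mu_lf lambda_pos DN p1 fL p'1 pp' C0 erefl (stop D N DN)).
Qed.

End uniform_stopping.

Theorem theorem1p7 (R : realType) (d : nat) (hd : (0 < d)%N)
  (p : R) (hp : 1 < p) (E : banachLatticeType R)
  (mu : {measure set 'rV[R]_d -> \bar R}) (hmu : locally_finite mu)
  (lambda : dyadic_cube d -> {linear E -> E})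
  (hlambda : forall Q, positive_operator (lambda Q)) :
  [\/ Loo_testing mu lambda /\ dyadic_Hardy_Littlewood d E,
      Loo_testing mu lambda /\ doubling mu
    | exists2 t : R, p < t & Lt_testing mu lambda t] ->
  (ereal_sup [set LE_opnorm mu p (dyadic_op mu lambda D) |
               D in [set: {fset dyadic_cube d}]] < +oo)%E.
Proof.
have hp0 : 0 < p by exact: lt_trans hp.
have hp' : 0 < p - 1 by rewrite subr_gt0.
pose p' := p / (p - 1).
have p'1 : 1 < p' by rewrite ltr_pdivlMr// mul1r ltrBlDr ltrDl.
have pp' : p^-1 + p'^-1 = 1.
  by rewrite /p' invf_div -{1}(div1r p) -mulrDl subrKC mulfV// gt_eqF.
have [r0 r1 _ _] := stop_ratioP hp p'1; set r := stop_ratio p p' in r0 r1.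
have half (x : R) : 0 < x < 1 -> 0 < x / 2 < 1.
  by move=> /andP[x0 x1]; rewrite divr_gt0//= ltr_pdivrMr// mul1r (lt_trans x1)// ltr1n.
have r01 : 0 < r < 1 by rewrite r0.
have halves (x : R) : x = x / 2 + x / 2 by exact: splitr.
have done C : 0 < C -> uniform_stopping mu lambda r C ->
    (ereal_sup [set LE_opnorm mu p (dyadic_op mu lambda D) |
               D in [set: {fset dyadic_cube d}]] < +oo)%E.
  exact: uniform_stopping_bounded.
(* every majorant yields twice its exceptional fraction, and the maximal function
   adds an exceptional set of its own *)
case=> [[Loo HL]|[Loo dbl]|[t pt Lt]].
- have [C C0 stop] := Hardy_Littlewood_uniform_stopping hmu hlambda hd (half _ (half _ r01)) Loo HL.
  by apply: (done C C0); rewrite (halves r) {1 2}(halves (r / 2)).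
- have [C C0 stop] := doubling_uniform_stopping hmu hlambda hd (half _ r01) Loo dbl.
  by apply: (done C C0); rewrite (halves r).
- have [C C0 stop] := Lt_uniform_stopping hmu hlambda (half _ r01) (lt_trans hp pt) Lt.
  by apply: (done C C0); rewrite (halves r).
Qed.
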